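(* Let $n\ge 1$ be an integer. Let $\omega_0,\dots,\omega_{n-1}\in[0,\infty]$ satisfy $\omega_0\ge 1/n$ and \[ \frac{j\omega_j}{\omega_j+j+1}\ \le\ \omega_{j-1}\ \le\ \frac{(n-j)\omega_j-1}{n-j+1}\qquad(1\le j\le n-1), \] with the convention that the left-most ratio equals $j$ when $\omega_j=\infty$ (and the right-most ratio is $\infty$ when $\omega_j=\infty$). Then there exists a point $\mathbf{u}\in\mathbb{R}^{n+1}$ whose coordinates are linearly independent over $\mathbb{Q}$ such that \[ \omega_j(\mathbf{u})=\omega_j\quad\text{and}\quad \hat\omega_j(\mathbf{u})=\frac{j+1}{n-j}\qquad(0\le j\le n-1). \]
   Context: $\mathbb{R}^{n+1}$ carries the standard inner product; its exterior algebra carries the Euclidean structure for which, for any orthonormal basis $\mathbf{e}_1,\dots,\mathbf{e}_{n+1}$, the products $\mathbf{e}_{i_1}\wedge\cdots\wedge\mathbf{e}_{i_k}$ ($i_1<\dots<i_k$) are orthonormal. A subspace $S$ of $\mathbb{R}^{n+1}$ is defined over $\mathbb{Q}$ if it is spanned by vectors of $\mathbb{Q}^{n+1}$; its height is $H(S)=\|\mathbf{x}_1\wedge\cdots\wedge\mathbf{x}_k\|$ where $\mathbf{x}_1,\dots,\mathbf{x}_k$ is a $\mathbb{Z}$-basis of $S\cap\mathbb{Z}^{n+1}$. For nonzero $\mathbf{u}$ and nonzero subspace $S$ with basis $\mathbf{x}_1,\dots,\mathbf{x}_k$, $\mathrm{dist}(\mathbf{u},S)=\|\mathbf{u}\wedge\mathbf{x}_1\wedge\cdots\wedge\mathbf{x}_k\|/(\|\mathbf{u}\|\,\|\mathbf{x}_1\wedge\cdots\wedge\mathbf{x}_k\|)$.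 For $\mathbf{u}\in\mathbb{R}^{n+1}\setminus\{0\}$ and $0\le j\le n-1$, $\omega_j(\mathbf{u})$ (resp. $\hat\omega_j(\mathbf{u})$) is the supremum of all real $\omega$ such that for arbitrarily large $Q$ (resp. for all sufficiently large $Q$) there exists a subspace $S$ of $\mathbb{R}^{n+1}$ defined over $\mathbb{Q}$ of dimension $j+1$ with $H(S)\le Q$ and $H(S)\,\mathrm{dist}(\mathbf{u},S)\le Q^{-\omega}$. *)

(* Defs.v *)
From Stdlib Require Import Reals Lra Lia ZArith QArith Qreals List.
Open Scope R_scope.

(** Vectors of R^{n+1}: functions nat -> R, only coordinates 0..n matter. *)
Definition vec := nat -> R.

Definition sumR (l : list R) : R := fold_right Rplus 0 l.

Definition lincomb (cs : list R) (xs : list vec) (i : nat) : R :=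
  sumR (map (fun p => fst p * snd p i) (combine cs xs)).

Definition in_span (n : nat) (xs : list vec) (v : vec) : Prop :=
  exists cs : list R, length cs = length xs /\
    forall i, (i <= n)%nat -> v i = lincomb cs xs i.

Definition in_Zspan (n : nat) (xs : list vec) (v : vec) : Prop :=
  exists cs : list Z, length cs = length xs /\
    forall i, (i <= n)%nat -> v i = lincomb (map IZR cs) xs i.

Definition lin_indep (n : nat) (xs : list vec) : Prop :=
  forall cs : list R, length cs = length xs ->
    (forall i, (i <= n)%nat -> lincomb cs xs i = 0) -> Forall (fun c => c = 0) cs.

Definition Z_indep (n : nat) (xs : list vec) : Prop :=
  forall cs : list Z, length cs = length xs ->
    (forall i, (i <= n)%nat -> lincomb (map IZR cs) xs i = 0) ->
    Forall (fun c => c = 0%Z) cs.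

Definition integer_vec (n : nat) (x : vec) : Prop :=
  forall i, (i <= n)%nat -> exists z : Z, x i = IZR z.

Definition rational_vec (n : nat) (x : vec) : Prop :=
  forall i, (i <= n)%nat -> exists q : Q, x i = Q2R q.

Definition vnorm (n : nat) (u : vec) : R :=
  sqrt (sumR (map (fun i => u i ^ 2) (seq 0 (S n)))).

Fixpoint det (k : nat) (M : nat -> nat -> R) : R :=
  match k with
  | O => 1
  | S k' => sumR (map (fun j => (-1) ^ j * M 0%nat j *
              det k' (fun a b => M (S a) (if (b <? j)%nat then b else S b)))
              (seq 0 (S k')))
  end.

Fixpoint combos {A : Type} (k : nat) (l : list A) : list (list A) :=
  match k, l with
  | O, _ => nil :: nil
  | S _, nil => nil
  | S k', a :: l' => map (cons a) (combos k' l') ++ combos k l'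
  end.

(** ||x_1 /\ ... /\ x_k|| : the coordinate of x_1/\.../\x_k on
    e_{i_1}/\.../\e_{i_k} (i_1<...<i_k) is the minor det(x_a(i_b)). *)
Definition wedge_norm (n : nat) (xs : list vec) : R :=
  let k := length xs in
  sqrt (sumR (map (fun I =>
      (det k (fun a b => nth a xs (fun _ => 0) (nth b I 0%nat))) ^ 2)
    (combos k (seq 0 (S n))))).

Definition is_basis (n : nat) (S : vec -> Prop) (bs : list vec) : Prop :=
  lin_indep n bs /\ forall v, S v <-> in_span n bs v.

Definition rational_subspace (n : nat) (S : vec -> Prop) : Prop :=
  exists rs, Forall (rational_vec n) rs /\ forall v, S v <-> in_span n rs v.

Definition has_dim (n : nat) (S : vec -> Prop) (k : nat) : Prop :=
  exists bs, length bs = k /\ is_basis n S bs.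

Definition Z_basis (n : nat) (S : vec -> Prop) (xs : list vec) : Prop :=
  Forall (integer_vec n) xs /\ Forall S xs /\ Z_indep n xs /\
  forall v, S v -> integer_vec n v -> in_Zspan n xs v.

Definition height_is (n : nat) (S : vec -> Prop) (h : R) : Prop :=
  exists xs, Z_basis n S xs /\ h = wedge_norm n xs.

Definition dist_is (n : nat) (u : vec) (S : vec -> Prop) (d : R) : Prop :=
  exists bs, is_basis n S bs /\
    d = wedge_norm n (u :: bs) / (vnorm n u * wedge_norm n bs).

Definition approx (n : nat) (u : vec) (j : nat) (w Qb : R) : Prop :=
  exists V : vec -> Prop, rational_subspace n V /\ has_dim n V (j + 1) /\
    exists h d, height_is n V h /\ dist_is n u V d /\
      h <= Qb /\ h * d <= Rpower Qb (- w).

Definition omega_set (n : nat) (u : vec) (j : nat) (w : R) : Prop :=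
  forall Q0, exists Qb, Q0 <= Qb /\ 1 <= Qb /\ approx n u j w Qb.

Definition omega_hat_set (n : nat) (u : vec) (j : nat) (w : R) : Prop :=
  exists Q0, forall Qb, Q0 <= Qb -> 1 <= Qb -> approx n u j w Qb.

Inductive ereal := EFin (r : R) | EInf.

Definition ele (a b : ereal) : Prop :=
  match a, b with
  | _, EInf => True
  | EInf, EFin _ => False
  | EFin x, EFin y => x <= y
  end.

Definition is_sup (A : R -> Prop) (e : ereal) : Prop :=
  match e with
  | EFin r => is_lub A r
  | EInf => forall M, exists x, A x /\ M < x
  end.

Definition omega (n : nat) (u : vec) (j : nat) (e : ereal) : Prop :=
  is_sup (omega_set n u j) e.
Definition omega_hat (n : nat) (u : vec) (j : nat) (e : ereal) : Prop :=
  is_sup (omega_hat_set n u j) e.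

Definition lower_bd (j : nat) (w : ereal) : ereal :=
  match w with
  | EFin r => EFin (INR j * r / (r + INR j + 1))
  | EInf => EFin (INR j)
  end.
Definition upper_bd (n j : nat) (w : ereal) : ereal :=
  match w with
  | EFin r => EFin ((INR (n - j) * r - 1) / INR (n - j + 1))
  | EInf => EInf
  end.

Definition Q_indep_coords (n : nat) (u : vec) : Prop :=
  forall c : nat -> Q,
    sumR (map (fun i => Q2R (c i) * u i) (seq 0 (S n))) = 0 ->
    forall i, (i <= n)%nat -> Qeq (c i) 0.

(* Main.v *)
(** In the language of the parametric geometry of numbers, set [psi j = 1 / (1 + omega_j)]. The two
    transference inequalities say that [psi j / (n - j)] and [(1 - psi j) / (j + 1)] are
    nonincreasing in [j]. A point [u] is obtained from a basis of the integer lattice by iterating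
    [y_b <- y_b + c y_a], each new vector [y_b] being the next one to be added to the others, so that
    the dual basis changes by [f_a <- f_a - c f_b] and [|f_a|] becomes about [c |f_b|]. All the [y_a]
    tend to the direction of [u], and choosing the labels [a] and the multipliers [c] one prescribes
    the trajectory of the successive minima of [max(|x|, exp q |x.u|)], up to errors that are
    negligible against [q].

    The trajectory returns infinitely often to the diagonal, where all levels are equal, which gives
    the uniform exponents. Between two returns, for [k = 0, ..., n] in turn, [k + 1] of the levels rise
    together, in small steps, from [c] to [c r], and then the [n - k] others do the same. The ratio [r]
    is such that [omega_k] is attained halfway (for [k = n], where all levels rise together, it only
    makes [q] grow), and by the two monotonicity properties no other exponent exceeds its prescribed
    value along the way. *)

Require Import Defs.
From Stdlib Require Import Reals QArith Qreals List.
From Stdlib Require Import Lra Lia ZArith.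
From mathcomp Require all_boot all_order all_fingroup all_algebra Rstruct.
From Coquelicot Require Import Coquelicot.
Open Scope R_scope.

(** * Norms of exterior products *)

(** The points and forms of one step are dual integral bases with explicit bounds, and they serve
    both directions: the forms take integer values on lattice points, which excludes subspaces that
    are too good, while the spans of the points provide good ones. This takes the place of
    Minkowski's second theorem and of the duality of compound bodies.

    The obstacle is the error. Each step costs a bounded factor, so after [i] steps all estimates
    are off by [exp (O(i))], and this has to be negligible against [q]. Excursion [t] is therefore
    given only [O(t^2)] steps, hence [O(t^3)] steps in total up to its end, while its base level
    grows exponentially in [t]. On the other hand its steps must be fine: if one level of a group
    ran far ahead of the others, the largest levels could exceed the share of [q] that a smaller
    index permits. The rise of an excursion is as large as [t + 2] when the exponent is infinite, so
    [(t + 1)^2] rounds are what keeps the levels of a group within [O(base t / (t + 1))] of each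
    other. *)

Definition minor (xs : list vec) (J : list nat) : R :=
  det (length xs) (fun a b => nth a xs (fun _ => 0) (nth b J 0%nat)).

Lemma wedge_norm_minors (n : nat) (xs : list vec) :
  wedge_norm n xs =
  sqrt (sumR (map (fun J => minor xs J ^ 2) (combos (length xs) (seq 0 (S n))))).
Proof. reflexivity. Qed.

Lemma sumR_map_nonneg {A} (f : A -> R) (l : list A) :
  (forall x, In x l -> 0 <= f x) -> 0 <= sumR (map f l).
Proof.
  induction l as [|a l IH]; simpl; intros H; [lra|].
  assert (0 <= f a) by (apply H; auto).
  assert (0 <= sumR (map f l)) by (apply IH; auto). lra.
Qed.

Lemma sumR_map_le {A} (f g : A -> R) (l : list A) :
  (forall x, In x l -> f x <= g x) -> sumR (map f l) <= sumR (map g l).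
Proof.
  induction l as [|a l IH]; simpl; intros H; [lra|].
  assert (f a <= g a) by (apply H; auto).
  assert (sumR (map f l) <= sumR (map g l)) by (apply IH; auto). lra.
Qed.

Lemma sumR_map_eq {A} (f g : A -> R) (l : list A) :
  (forall x, In x l -> f x = g x) -> sumR (map f l) = sumR (map g l).
Proof. intros H; f_equal; apply map_ext_in; exact H. Qed.

Lemma sumR_map_scal {A} (c : R) (f : A -> R) (l : list A) :
  sumR (map (fun x => c * f x) l) = c * sumR (map f l).
Proof. induction l as [|a l IH]; simpl; [|rewrite IH]; ring. Qed.

Lemma sumR_map_plus {A} (f g : A -> R) (l : list A) :
  sumR (map (fun x => f x + g x) l) = sumR (map f l) + sumR (map g l).
Proof. induction l as [|a l IH]; simpl; [|rewrite IH]; ring. Qed.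

Lemma sumR_map_const {A} (c : R) (l : list A) :
  sumR (map (fun _ => c) l) = INR (length l) * c.
Proof.
  induction l as [|a l IH]; [simpl; ring|].
  simpl map; simpl length; rewrite S_INR; simpl; rewrite IH; ring.
Qed.

Lemma sumR_map_In {A} (f : A -> R) (l : list A) (a : A) :
  (forall x, In x l -> 0 <= f x) -> In a l -> f a <= sumR (map f l).
Proof.
  induction l as [|b l IH]; simpl; intros H Ha; [easy|].
  assert (0 <= f b) by (apply H; auto).
  destruct Ha as [->|Ha].
  - assert (0 <= sumR (map f l)) by (apply sumR_map_nonneg; auto). lra.
  - assert (f a <= sumR (map f l)) by (apply IH; auto). lra.
Qed.

Lemma length_combos {A} (k : nat) (l : list A) :
  INR (length (combos k l)) <= 2 ^ length l.
Proof.
  revert k; induction l as [|a l IH]; intros [|k]; simpl; try lra.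
  - generalize (IH 0%nat); destruct l; simpl; [lra|]. intros; nra.
  - rewrite length_app, length_map, plus_INR.
    generalize (IH k) (IH (S k)); lra.
Qed.

Lemma minor_le_wedge_norm (n : nat) (xs : list vec) (J : list nat) :
  In J (combos (length xs) (seq 0 (S n))) -> Rabs (minor xs J) <= wedge_norm n xs.
Proof.
  intros HJ. rewrite wedge_norm_minors, <- sqrt_Rsqr_abs.
  apply sqrt_le_1_alt. rewrite Rsqr_pow2.
  apply (sumR_map_In (fun J => minor xs J ^ 2)); [intros; apply pow2_ge_0|exact HJ].
Qed.

Lemma wedge_norm_nonneg (n : nat) (xs : list vec) : 0 <= wedge_norm n xs.
Proof. apply sqrt_pos. Qed.

(** There are at most [2 ^ S n] minors. The square root of their number would do; the cruder
    constant only enters [loss]. *)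
Lemma wedge_norm_le (n : nat) (xs : list vec) (B : R) :
  0 <= B ->
  (forall J, In J (combos (length xs) (seq 0 (S n))) -> Rabs (minor xs J) <= B) ->
  wedge_norm n xs <= 2 ^ S n * B.
Proof.
  intros HB H. rewrite wedge_norm_minors.
  assert (H2 : 1 <= 2 ^ S n) by (apply pow_R1_Rle; lra).
  rewrite <- (sqrt_pow2 (2 ^ S n * B)) by nra.
  apply sqrt_le_1_alt.
  apply Rle_trans with (INR (length (combos (length xs) (seq 0 (S n)))) * B ^ 2).
  - rewrite <- sumR_map_const. apply sumR_map_le. intros J HJ.
    rewrite <- (pow2_abs (minor xs J)). specialize (H J HJ).
    generalize (Rabs_pos (minor xs J)); intros; simpl; nra.
  - generalize (length_combos (length xs) (seq 0 (S n))).
    rewrite length_seq. intros.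
    replace ((2 ^ S n * B) ^ 2) with (2 ^ S n * (2 ^ S n) * B ^ 2) by ring.
    assert (0 <= B ^ 2) by apply pow2_ge_0. apply Rmult_le_compat_r; [easy|nra].
Qed.

Lemma wedge_norm_scale (n : nat) (d : R) (bs xs : list vec) :
  length bs = length xs ->
  (forall J, In J (combos (length xs) (seq 0 (S n))) -> minor bs J = d * minor xs J) ->
  wedge_norm n bs = Rabs d * wedge_norm n xs.
Proof.
  intros Hl H. rewrite !wedge_norm_minors, Hl, <- sqrt_Rsqr_abs, <- sqrt_mult_alt
    by apply Rle_0_sqr.
  f_equal. rewrite <- sumR_map_scal. apply sumR_map_eq. intros J HJ.
  rewrite H by exact HJ. unfold Rsqr; ring.
Qed.

Lemma combos_length {A} (k : nat) (l J : list A) : In J (combos k l) -> length J = k.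
Proof.
  revert k J; induction l as [|a l IH]; intros [|k] J; simpl; intros H.
  - destruct H as [<-|[]]; reflexivity.
  - destruct H.
  - destruct H as [<-|[]]; reflexivity.
  - apply in_app_or in H as [H|H]; [|now apply IH].
    apply in_map_iff in H as (J' & <- & H). simpl; f_equal; now apply IH.
Qed.

Lemma combos_incl {A} (k : nat) (l J : list A) : In J (combos k l) -> incl J l.
Proof.
  revert k J; induction l as [|a l IH]; intros [|k] J; simpl; intros H.
  - destruct H as [<-|[]]; intros x [].
  - destruct H.
  - destruct H as [<-|[]]; intros x [].
  - apply in_app_or in H as [H|H].
    + apply in_map_iff in H as (J' & <- & H).
      intros x [->|Hx]; [now left|right; now apply (IH _ _ H)].
    + intros x Hx; right; now apply (IH _ _ H).
Qed.

(** The factor [D] is the determinant of a change of basis, which cancels in height times distance.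
    [v] may vanish, since [/ v] is carried along as a factor. *)
Lemma ratio_cancel (v w D U : R) : w <> 0 -> D <> 0 ->
  w * (D * U / (v * (D * w))) = U / v.
Proof.
  intros Hw HD. unfold Rdiv. rewrite !Rinv_mult. generalize (/ v); intros z.
  field; auto.
Qed.

(** * Minors as determinants of matrices *)

Module Minors.
Import all_boot all_order all_fingroup all_algebra Rstruct.
Import Order.TTheory GRing.Theory Num.Theory.
Set Implicit Arguments. Unset Strict Implicit.
Local Open Scope ring_scope.

Lemma list_seqE m n : List.seq m n = iota m n.
Proof. by elim: n m => //= n IH m; rewrite IH. Qed.

Lemma list_nthE (T : Type) (x0 : T) s i : List.nth i s x0 = nth x0 s i.
Proof. by elim: s i => [|x s IH] [|i] //=. Qed.

Lemma sumR_bigE (T : Type) (F : T -> R) s : sumR (List.map F s) = \sum_(x <- s) F x.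
Proof. by elim: s => [|x s IH] /=; rewrite ?big_nil ?big_cons ?IH. Qed.

Lemma sumR_ordE (F : nat -> R) n : sumR (List.map F (List.seq 0 n)) = \sum_(i < n) F i.
Proof. by rewrite list_seqE sumR_bigE -(big_mkord xpredT) /index_iota subn0. Qed.

Lemma detE k M : det k M = \det (\matrix_(i < k, j < k) M i j).
Proof.
elim: k M => [|k IH] M; first by rewrite det_mx00.
rewrite (expand_det_row _ ord0) [LHS]sumR_ordE.
apply: eq_bigr => j _; rewrite -/det IH mxE RpowE /cofactor add0n /=.
rewrite !RmultE -mulrA mulrCA; congr (_ * (_ * \det _)).
apply/matrixP => a b; rewrite !mxE /=; congr (M _ _).
(* The index shift past column [j] in [det] is [bump j], the one of the cofactor. *)
rewrite /bump leqNgt.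
by case: Nat.ltb_spec => [/ssrnat.ltP -> //|/ssrnat.leP]; rewrite leqNgt => /negbTE ->.
Qed.

Definition coord (xs : list vec) (a t : nat) : R := List.nth a xs (fun _ => 0) t.
Arguments coord : simpl never.

Lemma minorE k xs (J : list nat) : length xs = k ->
  minor xs J = \det (\matrix_(a < k, b < k) coord xs a (nth 0%N J b)).
Proof.
move=> <-; rewrite /minor detE; congr (\det _).
by apply/matrixP => a b; rewrite !mxE /coord [List.nth b J _]list_nthE.
Qed.

Lemma mem_combos (s l : seq nat) : subseq s l -> List.In s (combos (size s) l).
Proof.
elim: l s => [|x l IH] [|y s] //=; try by left.
case: eqP => [-> /IH H|_ /IH H]; apply/List.in_app_iff.
  by left; apply/List.in_map_iff; exists s.
by right.
Qed.

(** A repeated column makes the determinant vanish, and otherwise sorting the columns changes only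
    its sign. Arbitrary choices [phi] are allowed because expansions below run over all functions
    and not over increasing sequences. *)
Lemma det_cols_le_wedge_norm n k xs (phi : 'I_k -> 'I_n.+1) : length xs = k ->
  `|\det (\matrix_(a < k, b < k) coord xs a (phi b))| <= wedge_norm n xs.
Proof.
move=> lxs; have [inj|] := boolP (injectiveb phi); last first.
  case/injectivePn => i1 [i2 ne e].
  rewrite -det_tr (determinant_alternate ne) ?normr0; last by move=> j; rewrite !mxE e.
  exact/RleP/wedge_norm_nonneg.
pose t : k.-tuple nat := [tuple nat_of_ord (phi b) | b < k].
have ut : uniq t.
  by rewrite map_inj_uniq ?enum_uniq // => a b /val_inj; exact/injectiveP.
pose s := [seq i <- iota 0 n.+1 | i \in (t : seq nat)].
have pst : perm_eq s t.
  apply: uniq_perm => // [|i]; first by rewrite filter_uniq // iota_uniq.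
  rewrite mem_filter mem_iota /= add0n; case: (boolP (i \in _)) => //= /mapP[b _ ->].
  exact: ltn_ord.
have szs : size s = k by rewrite (perm_size pst) size_tuple.
have /tuple_permP[p sE] := pst.
have sub : subseq s (List.seq 0 (S n)) by rewrite list_seqE filter_subseq.
have Hs : List.In s (combos (length xs) (List.seq 0 (S n))).
  by rewrite lxs -szs; apply: mem_combos.
have /RleP := minor_le_wedge_norm _ _ _ Hs.
rewrite (minorE _ lxs) RabsE; apply: le_trans.
set M := (X in `|\det X| <= _); set M' := (X in _ <= `|\det X|).
suff -> : M' = col_perm p M.
  by rewrite col_permE det_mulmx det_perm normrM normr_sign mulr1.
apply/matrixP => a b; rewrite !mxE sE; congr (coord _ _ _).
by rewrite (nth_map b) ?size_enum_ord // nth_ord_enum tnth_mktuple.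
Qed.

(** The Cauchy-Binet formula before its terms are grouped by the image of [phi]. Since only upper
    bounds are taken termwise, grouping would bring nothing. *)
Lemma det_expand_functions k N (A : 'M[R]_(k, N)) (B : 'M[R]_(N, k)) :
  \det (A *m B) =
  \sum_(phi : {ffun 'I_k -> 'I_N})
     (\prod_i A i (phi i)) * \det (\matrix_(i, j) B (phi i) j).
Proof.
transitivity (\sum_(s : 'S_k) \sum_(phi : {ffun 'I_k -> 'I_N})
    (-1) ^+ s * \prod_i (A i (phi i) * B (phi i) (s i))).
  apply: eq_bigr => s _; rewrite -big_distrr /=; congr (_ * _).
  rewrite -(bigA_distr_bigA (fun i j => A i j * B j (s i))) /=.
  by apply: eq_bigr => i _; rewrite mxE.
rewrite exchange_big; apply: eq_bigr => phi _; rewrite big_distrr /=.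
apply: eq_bigr => s _; rewrite mulrCA big_split /=; congr (_ * (_ * _)).
by apply: eq_bigr => i _; rewrite mxE.
Qed.

(** With weights that separate into rows and columns, every term of the Leibniz formula has the same
    bound. *)
Lemma det_bound k (A : 'M[R]_k) (alpha beta : 'I_k -> R) :
  (forall i j, `|A i j| <= alpha i * beta j) ->
  `|\det A| <= k`!%:R * (\prod_i alpha i * \prod_i beta i).
Proof.
move=> H; apply: (le_trans (ler_norm_sum _ _ _)).
apply: (@le_trans _ _ (\sum_(s : 'S_k) (\prod_i alpha i * \prod_i beta i))); last first.
  by rewrite sumr_const card_Sn mulr_natl.
apply: ler_sum => s _; rewrite normrM normr_sign mul1r normr_prod.
rewrite [\prod_i beta i](reindex_perm s) -big_split /=.
by apply: ler_prod => i _; rewrite normr_ge0 H.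
Qed.

(** * Spans, bases and integral points in matrix form *)

Definition mxl (n k : nat) (xs : list vec) : 'M[R]_(k, n.+1) := \matrix_(a, t) coord xs a t.

Definition rowv (n : nat) (v : vec) : 'rV[R]_n.+1 := \row_t v t.

Lemma lincombE k cs xs i : length cs = k -> length xs = k ->
  lincomb cs xs i = \sum_(a < k) nth 0 cs a * coord xs a i.
Proof.
elim: k cs xs => [|k IH] [|c cs] [|x xs] //; first by rewrite big_ord0.
move=> [lc] [lx]; rewrite big_ord_recl; congr (_ + _).
exact: IH.
Qed.

Lemma lincomb_mul n k (cs : list R) xs : length cs = k -> length xs = k ->
  rowv n (lincomb cs xs) = (\row_(a < k) nth 0 cs a) *m mxl n k xs.
Proof.
move=> lc lx; apply/rowP => t; rewrite !mxE (lincombE _ lc lx).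
by apply: eq_bigr => a _; rewrite !mxE.
Qed.

Lemma in_spanE n k xs v : length xs = k -> in_span n xs v <-> (rowv n v <= mxl n k xs)%MS.
Proof.
move=> lx; split.
  move=> [cs [lc H]]; rewrite lx in lc.
  have -> : rowv n v = rowv n (lincomb cs xs).
    by apply/rowP => t; rewrite !mxE H //; apply/ssrnat.leP; rewrite -ltnS.
  by rewrite (lincomb_mul n lc lx) submxMl.
case/submxP => D eD; exists [seq D 0 a | a <- enum 'I_k].
have ls : length [seq D 0 a | a <- enum 'I_k] = k by rewrite [length _]size_map size_enum_ord.
rewrite ls lx; split=> // i /ssrnat.leP; rewrite -ltnS => Hi.
have /rowP/(_ (Ordinal Hi)) := eD; rewrite !mxE /= => ->.
rewrite (lincombE _ ls lx); apply: eq_bigr => a _; rewrite mxE.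
by rewrite (nth_map a) ?size_enum_ord // nth_ord_enum.
Qed.

Lemma lin_indepE n k xs : length xs = k -> lin_indep n xs <-> row_free (mxl n k xs).
Proof.
move=> lx; split=> [H|fr cs lc H].
  apply/inj_row_free => v Hv.
  pose cs := [seq v 0 a | a <- enum 'I_k].
  have lc : length cs = k by rewrite [length _]size_map size_enum_ord.
  have /List.Forall_forall F0 : List.Forall (fun c => c = 0) cs.
    apply: H => [|i /ssrnat.leP]; first by rewrite lc lx.
    rewrite -ltnS => Hi; have /rowP/(_ (Ordinal Hi)) := Hv; rewrite !mxE => e0; rewrite -[RHS]e0.
    rewrite (lincombE _ lc lx); apply: eq_bigr => a _; rewrite !mxE.
    by rewrite (nth_map a) ?size_enum_ord // nth_ord_enum.
  apply/rowP => a; rewrite mxE; apply: F0.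
  apply: (@List.in_map _ _ (fun a => v 0 a)).
  by move: (mem_enum 'I_k a); elim: (enum _) => //= x s IH; rewrite inE => /orP[/eqP->|/IH]; auto.
rewrite lx in lc.
have /(row_free_inj fr) e0 : (\row_(a < k) nth 0 cs a) *m mxl n k xs = 0 *m mxl n k xs.
  rewrite mul0mx -(lincomb_mul n lc lx); apply/rowP => t; rewrite !mxE; apply: H.
  by apply/ssrnat.leP; rewrite -ltnS.
apply/List.Forall_nth => i d Hi; rewrite list_nthE.
have Hi' : (i < k)%N by rewrite -lc; apply/ssrnat.ltP.
have /rowP/(_ (Ordinal Hi')) := e0; rewrite !mxE /= => e1.
rewrite (set_nth_default 0) ?e1 //; exact/ssrnat.ltP.
Qed.

Lemma IZR_int (z : Z) : exists m : int, IZR z = m%:~R.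
Proof.
case: z => [|p|p]; first by exists 0.
  by exists (nat_of_pos p)%:Z; rewrite IZRposE INRE.
by exists (- (nat_of_pos p)%:Z); rewrite IZR_NEG IZRposE INRE mulrNz.
Qed.

Lemma int_IZR (m : int) : exists z : Z, m%:~R = IZR z.
Proof.
have H (k : nat) : k%:R = IZR (Z.of_nat k) by rewrite -INR_IZR_INZ INRE.
case: m => k; first by exists (Z.of_nat k); rewrite -H.
by exists (Z.opp (Z.of_nat k.+1)); rewrite opp_IZR -H NegzE mulrNz.
Qed.

(** The rank of a rational matrix is the same over the rationals and over the reals, and a rational
    relation becomes an integral one when multiplied by the product [d] of its denominators. *)
Lemma Z_indep_row_free n k xs : length xs = k ->
  List.Forall (integer_vec n) xs -> Z_indep n xs -> row_free (mxl n k xs).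
Proof.
move=> lx /List.Forall_forall Hint Hind.
have Hm : forall (a : 'I_k) (t : 'I_n.+1), exists m : int, coord xs a t = m%:~R.
  move=> a t.
  have Ha : List.In (List.nth a xs (fun _ => 0)) xs.
    by apply: List.nth_In; rewrite lx; apply/ssrnat.ltP.
  have [|z e] := Hint _ Ha t; first by apply/ssrnat.leP; rewrite -ltnS.
  by have [m zm] := IZR_int z; exists m; rewrite -zm.
have Hm1 : forall a : 'I_k, exists g : 'I_n.+1 -> int, forall t : 'I_n.+1, coord xs a t = (g t)%:~R.
  by move=> a; apply: fin_all_exists (Hm a).
have [g Hg] := fin_all_exists Hm1.
pose M : 'M[rat]_(k, n.+1) := \matrix_(a, t) (g a t)%:~R.
have -> : mxl n k xs = map_mx ratr M.
  by apply/matrixP => a t; rewrite !mxE Hg ratr_int.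
rewrite row_free_map; apply/inj_row_free => v Hv.
pose d : int := \prod_(a < k) denq (v 0 a).
have d0 : d != 0 by apply/prodf_neq0 => a _; exact: denq_neq0.
have Hc : forall a : 'I_k, exists z : Z, ratr (d%:~R * v 0 a) = IZR z :> R.
  move=> a; pose e := \prod_(i < k | i != a) denq (v 0 i).
  have -> : d%:~R * v 0 a = (numq (v 0 a) * e)%:~R.
    rewrite /d (bigD1 a) //= -/e !intrM -{2}[v 0 a]divq_num_den mulrC mulrA divfK //.
    by rewrite intr_eq0 denq_neq0.
  by have [z zE] := int_IZR (numq (v 0 a) * e); exists z; rewrite -zE ratr_int.
have [c cE] := fin_all_exists Hc.
pose cs := [seq c a | a <- enum 'I_k].
have lc : length cs = k by rewrite [length _]size_map size_enum_ord.
have lc' : length (List.map IZR cs) = k by rewrite length_map.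
have /List.Forall_forall F0 : List.Forall (fun c => c = Z0) cs.
  apply: Hind => [|i /ssrnat.leP]; first by rewrite lc lx.
  rewrite -ltnS => Hi.
  have /(congr1 (fun w : 'rV_n.+1 => (ratr (d%:~R * w 0 (Ordinal Hi)) : R))) := Hv.
  rewrite !mxE mulr0 rmorph0 => e0; rewrite -[RHS]e0 (lincombE _ lc' lx).
  rewrite big_distrr /= rmorph_sum; apply: eq_bigr => a _.
  rewrite !mxE mulrA rmorphM /= cE ratr_int (Hg a (Ordinal Hi)); congr (_ * _).
  rewrite (nth_map Z0) ?[size _]lc //.
  by rewrite (nth_map a) ?size_enum_ord // nth_ord_enum.
apply/rowP => a; rewrite mxE; apply/eqP.
have /F0 ca : List.In (c a) cs.
  apply: (@List.in_map _ _ c).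
  by move: (mem_enum 'I_k a); elim: (enum _) => //= x s IH; rewrite inE => /orP[/eqP->|/IH]; auto.
have /eqP := cE a; rewrite ca -[IZR 0]/(0 : R) fmorph_eq0 mulf_eq0 intr_eq0.
by rewrite (negbTE d0).
Qed.

Lemma integer_multiple n v : rational_vec n v ->
  exists2 d : R, d != 0 & integer_vec n (fun i => d * v i).
Proof.
move=> Hv.
have Hq (t : 'I_n.+1) : exists q : Q, v t = Q2R q.
  by apply: Hv; apply/ssrnat.leP; rewrite -ltnS.
have [q qE] := fin_all_exists Hq.
pose D t := IZR (Z.pos (Qden (q t))).
have D0 t : D t != 0 by apply/eqP; exact: IZR_nz.
exists (\prod_t D t); first by apply/prodf_neq0.
move=> i /ssrnat.leP; rewrite -ltnS => Hi; pose t : 'I_n.+1 := Ordinal Hi.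
have [z zE] : exists z : Z, \prod_(s | s != t) D s = IZR z.
  apply: (big_ind (fun x : R => exists z : Z, x = IZR z)); first by exists (Z.pos xH).
    by move=> x y [z ->] [w ->]; exists (Z.mul z w); rewrite mult_IZR.
  by move=> s _; eexists.
exists (Z.mul (Qnum (q t)) z); rewrite (bigD1 t) //= zE mult_IZR.
rewrite -[v i]/(v t) qE /Q2R -/(D t) !RmultE RinvE mulrC mulrA; congr (_ * _).
by rewrite divfK.
Qed.

(** Each rational generator of [V] has a nonzero integral multiple, which lies in [V] and is thus an
    integral combination of [xs]. *)
Lemma span_integral_points n V rs xs : List.Forall (rational_vec n) rs ->
  (forall v, V v <-> in_span n rs v) -> Z_basis n V xs ->
  forall v, V v -> in_span n xs v.
Proof.
move=> /List.Forall_forall Hr HV [_ [_ [_ Hz]]] v.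
set kx := length xs; set kr := length rs.
rewrite HV (in_spanE n v (erefl kr)) (in_spanE n v (erefl kx)) => /submx_trans; apply.
apply/row_subP => a; have Ha : List.In (List.nth a rs (fun _ => 0)) rs.
  by apply: List.nth_In; apply/ssrnat.ltP.
have [d d0 di] := integer_multiple (Hr _ Ha).
have /Hz/(_ di)[cs [lc Hcs]] : V (fun i => d * List.nth a rs (fun _ => 0) i).
  apply/HV; rewrite (in_spanE n _ (erefl kr)).
  have -> : rowv n (fun i => d * List.nth a rs (fun _ => 0) i) = d *: row a (mxl n kr rs).
    by apply/rowP => t; rewrite !mxE.
  by rewrite scalemx_sub // row_sub.
have -> : row a (mxl n kr rs) = d^-1 *: rowv n (lincomb (List.map IZR cs) xs).
  apply/rowP => t; rewrite !mxE -Hcs ?mulKf //; apply/ssrnat.leP; exact: (ltn_ord t).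
apply/scalemx_sub; rewrite -(in_spanE n _ (erefl kx)).
by exists (List.map IZR cs); rewrite length_map.
Qed.

Lemma minor_linear_image n k (M : 'M[R]_k) bs xs J :
  length bs = k -> length xs = k -> mxl n k bs = M *m mxl n k xs ->
  List.In J (combos k (List.seq 0 (S n))) -> minor bs J = \det M * minor xs J.
Proof.
move=> lb lx e HJ; rewrite (minorE _ lb) (minorE _ lx) -det_mulmx; congr (\det _).
apply/matrixP => a b; rewrite !mxE.
have lJ := combos_length _ _ _ HJ.
have Hb : (nth 0%N J b < n.+1)%N.
  have : List.In (List.nth b J 0%N) (List.seq 0 (S n)).
    by apply: (combos_incl _ _ _ HJ); apply: List.nth_In; rewrite lJ; apply/ssrnat.ltP.
  by rewrite list_nthE => /List.in_seq[_ /ssrnat.ltP].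
have /matrixP/(_ a (Ordinal Hb)) := e; rewrite !mxE /= => ->.
by apply: eq_bigr => c _; rewrite !mxE.
Qed.

Lemma wedge_norm_gt0 n xs : lin_indep n xs -> 0 < wedge_norm n xs.
Proof.
set k := length xs => /(lin_indepE n (erefl k)) fr.
have fu : row_full (mxl n k xs)^T by rewrite /row_full mxrank_tr.
pose phi := fullrankfun fu.
apply: lt_le_trans (det_cols_le_wedge_norm phi (erefl k)).
rewrite normr_gt0 -det_tr -unitfE -unitmxE.
rewrite (_ : _^T = rowsub phi (mxl n k xs)^T) ?fullrowsub_unit //.
by apply/matrixP => a b; rewrite !mxE.
Qed.

(** The height is taken on a Z-basis and the distance on any real basis. Passing from one to the
    other multiplies the norms of [bs] and of [u :: bs] by the same determinant, so height times
    distance depends on the Z-basis alone. The equality of lengths identifies the rank of the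
    lattice with the dimension. *)
Theorem wedge_norm_basis_change n u V xs bs :
  rational_subspace n V -> Z_basis n V xs -> is_basis n V bs ->
  length xs = length bs /\ lin_indep n xs /\
  Rmult (wedge_norm n xs)
    (Rdiv (wedge_norm n (u :: bs)) (Rmult (vnorm n u) (wedge_norm n bs))) =
  Rdiv (wedge_norm n (u :: xs)) (vnorm n u).
Proof.
move=> [rs [Hr HV]] HZ [ib HB]; have sx := span_integral_points Hr HV HZ.
case: (HZ) => [Hxi [HxV [Hxz _]]].
set k := length bs; set kx := length xs.
have frx : row_free (mxl n kx xs) := Z_indep_row_free (erefl kx) Hxi Hxz.
have frb : row_free (mxl n k bs) by apply/(lin_indepE n (erefl k)).
have sxb : (mxl n kx xs <= mxl n k bs)%MS.
  apply/row_subP => a.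
  have /HB/(in_spanE n _ (erefl k)) : V (List.nth a xs (fun _ => 0)).
    move/List.Forall_forall: HxV; apply; apply: List.nth_In; exact/ssrnat.ltP.
  by congr (_ <= _)%MS; apply/rowP => t; rewrite !mxE.
have sbx : (mxl n k bs <= mxl n kx xs)%MS.
  apply/row_subP => a; have Ha : in_span n bs (List.nth a bs (fun _ => 0)).
    apply/(in_spanE n _ (erefl k)).
    rewrite (_ : rowv _ _ = row a (mxl n k bs)) ?row_sub //.
    by apply/rowP => t; rewrite !mxE.
  have /HB/sx/(in_spanE n _ (erefl kx)) := Ha.
  by congr (_ <= _)%MS; apply/rowP => t; rewrite !mxE.
have lx : length xs = k.
  apply/eqP; rewrite -/kx -(eqP frx) -(eqP frb) eqn_leq !mxrankS //.
rewrite /kx in frx sxb sbx; rewrite lx in frx sxb sbx.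
split=> //; split; first exact/(lin_indepE n lx).
have /submxP[M eM] := sbx.
have uM : \det M != 0.
  rewrite -unitfE -unitmxE -row_free_unit /row_free eqn_leq rank_leq_row /=.
  by rewrite -{1}(eqP frb) eM mxrankM_maxl.
have eb : wedge_norm n bs = Rabs (\det M) * wedge_norm n xs.
  apply: wedge_norm_scale => [|J HJ]; rewrite ?lx //.
  by rewrite lx in HJ; exact: minor_linear_image eM HJ.
have eub : wedge_norm n (u :: bs) = Rabs (\det M) * wedge_norm n (u :: xs).
  (* The block matrix fixes [u] and acts by [M] on the other vectors. *)
  have -> : \det M = \det (block_mx (1%:M : 'M_1) 0 0 M) by rewrite det_ublock det1 mul1r.
  apply: wedge_norm_scale => [|J HJ]; rewrite /= ?lx //.
  rewrite /= lx in HJ; apply: (@minor_linear_image n (1 + k)%N _ _ _ _ _ _ _ HJ);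
    rewrite /= ?lx //.
  have E zs : mxl n (1 + k) (u :: zs) = col_mx (rowv n u) (mxl n k zs).
    apply/matrixP => a t; rewrite !mxE; case: splitP => i ai; rewrite !mxE /coord ai.
      by rewrite ord1.
    by [].
  by rewrite !E mul_block_col mul1mx !mul0mx addr0 add0r -eM.
have D0 : Rabs (\det M) != 0 by rewrite RabsE normr_eq0.
have W0 : wedge_norm n xs != 0.
  by rewrite gt_eqF // wedge_norm_gt0 //; apply/(lin_indepE n lx).
by rewrite eb eub; apply: ratio_cancel; apply/eqP.
Qed.

(** * Upper and lower bounds for exterior products *)

Lemma det_bordered k (r : 'rV[R]_k) (c : 'cV[R]_k) (W : 'M[R]_k) :
  \det (block_mx (1%:M : 'M_1) r c W) = \det (W - c *m r).
Proof.
have -> : block_mx (1%:M : 'M_1) r c W =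
    block_mx 1%:M 0 c 1%:M *m block_mx 1%:M r 0 (W - c *m r).
  rewrite mulmx_block !mul1mx !mul0mx !mulmx1 !addr0.
  by rewrite addrC subrK.
by rewrite det_mulmx det_lblock det_ublock !det1 !mul1r.
Qed.

Lemma det_shear k (i0 : 'I_k) (E : 'M[R]_k) :
  (forall i j, j != i0 -> E i j = (i == j)%:R) -> E i0 i0 = 1 -> \det E = 1.
Proof.
case: k i0 E => [[]//|k] i0 E H H0.
rewrite (expand_det_row _ i0) (bigD1 i0) //= big1 => [|j ji]; last first.
  by rewrite H // eq_sym (negbTE ji) mul0r.
rewrite H0 mul1r addr0 /cofactor addnn -signr_odd odd_double expr0 mul1r.
rewrite (_ : row' _ _ = 1%:M) ?det1 //; apply/matrixP => a b; rewrite !mxE.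
by rewrite H 1?eq_sym ?neq_lift // (inj_eq lift_inj) eq_sym.
Qed.

(** Each [x_a] is the multiple [x_a(0) u] plus a remainder of size [alpha a]. Next to [u] the
    multiple disappears by row operations. Without [u] in the product, [det_bordered] trades these
    rank-one parts for one extra row, of weight [U], and one extra column, of weight [theta]; hence
    [theta] enters once and not [k] times. *)
Lemma wedge_norm_upper n k xs u (alpha : nat -> R) theta U :
  length xs = k -> 1 <= U -> 1 <= theta ->
  (forall t, (t <= n)%N -> `|u t| <= U) ->
  (forall a, (a < k)%N -> `|coord xs a 0| <= alpha a * theta) ->
  (forall a t, (a < k)%N -> (t <= n)%N ->
     `|coord xs a t - coord xs a 0 * u t| <= alpha a) ->
  wedge_norm n xs <= 2 ^+ n.+1 * ((k.+1)`!%:R * (U * theta * \prod_(a < k) alpha a)) /\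
  wedge_norm n (u :: xs) <= 2 ^+ n.+1 * ((k.+1)`!%:R * (U * \prod_(a < k) alpha a)).
Proof.
move=> lx U1 th1 Hu H0 Hw.
have th0 : 0 <= theta := le_trans ler01 th1.
have U0 : 0 <= U := le_trans ler01 U1.
have al0 a : (a < k)%N -> 0 <= alpha a by move=> /Hw /(_ (leq0n n)); apply: le_trans.
have Pa0 : 0 <= \prod_(a < k) alpha a by apply: prodr_ge0 => a _; exact: al0.
pose al (i : nat) := if i is a.+1 then alpha a else U.
have alE : \prod_(i < k.+1) al i = U * \prod_(a < k) alpha a by rewrite big_ord_recl.
have HJ (m : nat) (J : seq nat) (b : nat) : (b < m)%N ->
    List.In J (combos m (List.seq 0 (S n))) -> (nth 0%N J b <= n)%N.
  move=> bm HJ; have lJ := combos_length _ _ _ HJ.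
  have : List.In (List.nth b J 0%N) (List.seq 0 (S n)).
    by apply: (combos_incl _ _ _ HJ); apply: List.nth_In; rewrite lJ; apply/ssrnat.ltP.
  by rewrite list_nthE => /List.in_seq[_ /ssrnat.ltP].
split.
- rewrite -RpowE; apply/RleP; apply: wedge_norm_le; first by apply/RleP; rewrite !mulr_ge0.
  move=> J; rewrite lx => HJJ; apply/RleP; rewrite RabsE (minorE J lx).
  pose r : 'rV[R]_k := \row_b - u (nth 0%N J b).
  pose c : 'cV[R]_k := \col_a coord xs a 0.
  pose W : 'M[R]_k := \matrix_(a, b) (coord xs a (nth 0%N J b) - coord xs a 0 * u (nth 0%N J b)).
  have -> : \matrix_(a < k, b < k) coord xs a (nth 0%N J b) = W - c *m r.
    by apply/matrixP => a b; rewrite !mxE big_ord1 !mxE mulrN opprK subrK.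
  rewrite -det_bordered.
  pose be (i : nat) := if i is a.+1 then 1 else theta.
  have -> : U * theta * \prod_(a < k) alpha a = \prod_(i < k.+1) al i * \prod_(i < k.+1) be i.
    by rewrite alE [X in _ = _ * X]big_ord_recl /= [X in _ = _ * (_ * X)]big1 // mulr1 mulrAC.
  apply: (@det_bound (1 + k) _ (fun i => al i) (fun i => be i)) => i j.
  rewrite !mxE; case: splitP => i' ->; rewrite !mxE; case: splitP => j' -> /=.
  + by rewrite !mxE !ord1 eqxx normr1 /= mulr_ege1.
  + by rewrite ord1 /= mulr1 mxE normrN Hu // (HJ k).
  + by rewrite ord1 mxE /= H0.
  + by rewrite mxE -[X in _ <= X]/(alpha i' * 1) mulr1 Hw // (HJ k).
- rewrite -RpowE; apply/RleP; apply: wedge_norm_le; first by apply/RleP; rewrite !mulr_ge0.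
  move=> J; rewrite [length _]/= lx => HJJ; apply/RleP; rewrite RabsE.
  rewrite (@minorE (1 + k) (u :: xs) J) /= ?lx //.
  pose r : 'rV[R]_(1 + k) := \row_b u (nth 0%N J b).
  pose c : 'cV[R]_k := \col_a coord xs a 0.
  pose W : 'M[R]_(k, 1 + k) :=
    \matrix_(a, b) (coord xs a (nth 0%N J b) - coord xs a 0 * u (nth 0%N J b)).
  have -> : \matrix_(a < 1 + k, b < 1 + k) coord (u :: xs) a (nth 0%N J b) =
      block_mx (1%:M : 'M_1) 0 c 1%:M *m col_mx r W.
    rewrite mul_block_col !mul1mx mul0mx addr0; apply/matrixP => a b; rewrite !mxE.
    case: splitP => i' ->; rewrite !mxE; first by rewrite ord1.
    by rewrite big_ord1 !mxE addrC subrK.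
  rewrite det_mulmx det_lblock !det1 !mul1r.
  have -> : U * \prod_(a < k) alpha a = \prod_(i < k.+1) al i * \prod_(i < k.+1) (1 : R).
    by rewrite alE [X in _ = _ * X]big1 // mulr1.
  apply: (@det_bound (1 + k) _ (fun i => al i) (fun i => 1)) => i j.
  rewrite !mxE mulr1; case: splitP => i' ->; rewrite !mxE.
  + by rewrite ord1 /= Hu // (HJ k.+1).
  + by rewrite /= Hw // (HJ k.+1).
Qed.

(** The values of the integral forms [f] on the independent integral vectors [xs] form an integral
    matrix of rank [k], so some [k] by [k] minor of it has absolute value at least 1. Expanding this
    minor along the coordinates gives minors of [u :: xs], and minors of [xs] that carry the small
    factor [r] coming from the values of the forms at [u]. *)
Lemma wedge_norm_lower n k xs u (f : nat -> vec) (e : nat -> R) K r T :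
  length xs = k -> List.Forall (integer_vec n) xs -> lin_indep n xs -> u 0%N = 1 ->
  (forall l t : 'I_n.+1, f l t \is a Num.int) ->
  (\matrix_(l < n.+1, t < n.+1) f l t) \in unitmx ->
  0 <= K -> 0 <= r -> (forall l, 0 <= e l) ->
  (forall l t : 'I_n.+1, `|f l t| <= K * e l) ->
  (forall l : 'I_n.+1, `|\sum_(t < n.+1) f l t * u t| <= K * e l * r) ->
  (forall psi : 'I_k -> 'I_n.+1, injective psi -> \prod_b e (psi b) <= T) ->
  1 <= (n.+1%:R * K) ^+ k * T * (wedge_norm n (u :: xs) + r * wedge_norm n xs).
Proof.
move=> lx /List.Forall_forall Hint /(lin_indepE n lx) fr u0 fi fu K0 r0 e0 Hf Hfu HT.
have wu0 : 0 <= wedge_norm n (u :: xs) by apply/RleP/wedge_norm_nonneg.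
have wx0 : 0 <= wedge_norm n xs by apply/RleP/wedge_norm_nonneg.
pose F := \matrix_(l < n.+1, t < n.+1) f l t.
pose C := mxl n k xs *m F^T.
have xint (a : 'I_k) (t : 'I_n.+1) : coord xs a t \is a Num.int.
  have Ha : List.In (List.nth a xs (fun _ => 0)) xs.
    by apply: List.nth_In; rewrite lx; apply/ssrnat.ltP.
  have [|z zE] := Hint _ Ha t; first by apply/ssrnat.leP; exact: (ltn_ord t).
  by have [m mE] := IZR_int z; apply/intrP; exists m; rewrite -mE -zE.
have Cint a l : C a l \is a Num.int.
  by rewrite !mxE rpred_sum // => t _; rewrite !mxE rpredM.
have frC : row_free C.
  by rewrite /row_free mxrankMfree // row_free_unit unitmx_tr.
have fuC : row_full C^T by rewrite /row_full mxrank_tr.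
pose psi := fullrankfun fuC.
pose D : 'M[R]_k := rowsub psi C^T.
have Du : \det D != 0 by rewrite -unitfE -unitmxE fullrowsub_unit.
have Dint : \det D \is a Num.int.
  rewrite rpred_sum // => s _; rewrite rpredM ?rpredX ?rpredN ?rpred1 //.
  rewrite rpred_prod // => i _.
  by rewrite (_ : D i (s i) = C (s i) (psi i)) ?Cint // mxE mxE.
have D1 : 1 <= `|\det D| by rewrite norm_intr_ge1.
(* As [u 0 = 1], a form satisfies [f.x = (f.u) x(0) + sum over t >= 1 of f_t (x(t) - x(0) u(t))].
   Coordinate 0 of [G] and [W] carries the first term. *)
pose W : 'M[R]_(n.+1, k) := \matrix_(t, a)
  if t == ord0 then coord xs a 0 else coord xs a t - coord xs a 0 * u t.
pose G : 'M[R]_(k, n.+1) := \matrix_(b, t)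
  if t == ord0 then \sum_(s < n.+1) f (psi b) s * u s else f (psi b) t.
have DE : D = G *m W.
  apply/matrixP => b a; rewrite !mxE big_ord_recl [RHS]big_ord_recl !mxE eqxx.
  rewrite big_ord_recl u0 mulr1 mulrDl mulrC -addrA; congr (_ + _).
  rewrite mulr_suml -big_split /=; apply: eq_bigr => t _.
  by rewrite !mxE /= mulrBr mulrC addrC -mulrA [u _ * _]mulrC subrK.
apply: (le_trans D1); rewrite DE det_expand_functions.
apply: (le_trans (ler_norm_sum _ _ _)).
rewrite exprMn -mulrA.
have -> : (n.+1%:R : R) ^+ k = #|{ffun 'I_k -> 'I_n.+1}|%:R.
  by rewrite card_ffun !card_ord natrX.
rewrite -mulrA mulr_natl -sumr_const; apply: ler_sum => phi _.
rewrite normrM.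
have T0 : 0 <= T.
  by apply: le_trans (HT psi (@fullrankfun_inj _ _ _ _ _)); apply: prodr_ge0.
have [inj|] := boolP (injectiveb phi); last first.
  case/injectivePn => i1 [i2 ne ee].
  rewrite (determinant_alternate ne) ?normr0 ?mulr0; last by move=> j; rewrite !mxE ee.
  by rewrite !mulr_ge0 ?exprn_ge0 ?addr_ge0 ?mulr_ge0.
have inj' : injective phi by exact/injectiveP.
have KT : \prod_(b < k) (K * e (psi b)) <= K ^+ k * T.
  rewrite big_split /= prodr_const card_ord ler_wpM2l ?exprn_ge0 //.
  by apply: HT; exact: fullrankfun_inj.
rewrite mulrA.
have [/existsP[b0 /eqP hb0]|] := boolP [exists b, phi b == ord0].
(* Coordinate 0 is chosen, at [b0], so the factor [r] appears there. The shear [E] accounts for the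
   subtraction of [x(0) u] in the other rows, and what remains is a minor of [xs]. *)
- have hb b : b != b0 -> (phi b == ord0) = false.
    by move=> bb; rewrite -hb0 (inj_eq inj'); exact: negbTE.
  apply: (@le_trans _ _ (K ^+ k * T * r * wedge_norm n xs)); last first.
    by rewrite -[X in X <= _]mulrA ler_wpM2l ?mulr_ge0 ?exprn_ge0 // lerDr.
  apply: ler_pM => //.
    rewrite normr_prod (bigD1 b0) //= mxE hb0 eqxx.
    apply: (@le_trans _ _ (K * e (psi b0) * r * \prod_(b | b != b0) (K * e (psi b)))).
      apply: ler_pM => //; first by apply: prodr_ge0.
      by apply: ler_prod => b bb; rewrite normr_ge0 /= mxE hb.
    rewrite mulrAC; apply: ler_wpM2r => //.
    by rewrite (bigD1 b0) //= in KT.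
  pose E : 'M[R]_k := \matrix_(b, c)
    if c == b0 then (if b == b0 then 1 else - u (phi b)) else (b == c)%:R.
  have -> : \matrix_(i, j) W (phi i) j =
      E *m (\matrix_(a < k, b < k) coord xs a (phi b))^T.
    apply/matrixP => b a; rewrite !mxE (bigD1 b0) //= !mxE eqxx.
    case: (eqVneq b b0) => [->|bb].
      rewrite hb0 eqxx mul1r big1 ?addr0 // => c cb.
      by rewrite !mxE (negbTE cb) eq_sym (negbTE cb) mul0r.
    rewrite hb // hb0 (bigD1 b) //= !mxE (negbTE bb) eqxx mul1r big1 ?addr0 => [|c].
      by rewrite addrC mulNr mulrC.
    by case/andP=> cb0 cb; rewrite !mxE (negbTE cb0) eq_sym (negbTE cb) mul0r.
  rewrite det_mulmx (@det_shear _ b0) ?mul1r ?det_tr; first exact: det_cols_le_wedge_norm.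
    by move=> i j ji; rewrite mxE (negbTE ji).
  by rewrite mxE eqxx.
(* Coordinate 0 is avoided: the reduced entries form the Schur complement, with pivot [u 0 = 1], of
   a minor of [u :: xs] on column 0 and the columns [phi]. *)
- rewrite negb_exists => /forallP hb.
  apply: (@le_trans _ _ (K ^+ k * T * wedge_norm n (u :: xs))); last first.
    by rewrite ler_wpM2l ?mulr_ge0 ?exprn_ge0 // lerDl mulr_ge0.
  apply: ler_pM => //.
    apply: le_trans KT; rewrite normr_prod; apply: ler_prod => b _.
    by rewrite normr_ge0 /= mxE (negbTE (hb b)).
  pose phi' (i : 'I_(1 + k)) := match split i with inl _ => ord0 | inr b => phi b end.
  apply: le_trans (@det_cols_le_wedge_norm n (1 + k) (u :: xs) phi' _); last by rewrite /= lx.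
  set M := \matrix_(_, _) coord _ _ _.
  have -> : M = block_mx (1%:M : 'M_1) (\row_b u (phi b)) (\col_a coord xs a 0)
                  (\matrix_(a, b) coord xs a (phi b)).
    apply/matrixP => i j; rewrite !mxE /phi'.
    case: (splitP i) => i' ei; rewrite !mxE; case: (splitP j) => j' ej; rewrite !mxE.
    - by rewrite ei !ord1 eqxx -[LHS]/(u 0%N).
    - by rewrite ei ord1.
    - by rewrite ei.
    - by rewrite ei.
  rewrite det_bordered -[X in _ <= `|X|]det_tr.
  rewrite le_eqVlt; apply/orP; left; apply/eqP; congr (`|\det _|).
  by apply/matrixP => b a; rewrite !mxE (negbTE (hb b)) big_ord1 !mxE.
Qed.

Lemma prod_exp k (L : nat -> R) : \prod_(i < k) exp (L i) = exp (\sum_(i < k) L i).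
Proof.
apply/esym; apply: (big_morph exp); last exact: exp_0.
by move=> x y; rewrite -RplusE exp_plus.
Qed.

Lemma dual_unitmx N (F Y : 'M[R]_N) :
  (forall l m, \sum_t F l t * Y m t = (l == m)%:R) -> F \in unitmx.
Proof.
move=> H; have : F *m Y^T = 1%:M.
  by apply/matrixP => l m; rewrite !mxE -H; apply: eq_bigr => t _; rewrite mxE.
by case/mulmx1_unit.
Qed.

Local Close Scope ring_scope.
Local Open Scope R_scope.

Lemma wedge_norm_lower_exp (n : nat) (xs : list vec) (u : vec) (f y : nat -> nat -> Z)
    (L : nat -> R) (q K T : R) :
  List.Forall (integer_vec n) xs -> lin_indep n xs -> u 0%nat = 1 ->
  (forall l m, le l n -> le m n ->
    sumR (List.map (fun t => IZR (f l t) * IZR (y m t)) (List.seq 0 (S n))) =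
    if Nat.eqb l m then 1 else 0) ->
  0 <= K ->
  (forall l t, le l n -> le t n -> Rabs (IZR (f l t)) <= K * exp (L l)) ->
  (forall l, le l n ->
    Rabs (sumR (List.map (fun t => IZR (f l t) * u t) (List.seq 0 (S n))))
      <= K * exp (L l) * exp (- q)) ->
  (forall I, List.NoDup I -> length I = length xs -> (forall l, List.In l I -> le l n) ->
    sumR (List.map L I) <= T) ->
  1 <= (INR (S n) * K) ^ length xs * exp T *
       (wedge_norm n (u :: xs) + exp (- q) * wedge_norm n xs).
Proof.
move=> Hint Hind u0 Hfy K0 Hf Hfu HT; apply/RleP.
have ordle (i : 'I_n.+1) : le i n by apply/ssrnat.leP; exact: (ltn_ord i).
rewrite RpowE INRE.
apply: (@wedge_norm_lower n _ xs u (fun l t => IZR (f l t)) (fun l => exp (L l)));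
  try by [].
- by move=> l t; have [m ->] := IZR_int (f l t); apply/intrP; exists m.
- apply: (@dual_unitmx _ _ (\matrix_(l < n.+1, t < n.+1) IZR (y l t))) => l m.
  transitivity (if Nat.eqb l m then 1 else 0).
    rewrite -(Hfy l m (ordle l) (ordle m)) sumR_ordE.
    by apply: eq_bigr => t _; rewrite !mxE.
  by rewrite -(inj_eq val_inj) /=; case: Nat.eqb_spec => [->|/eqP/negbTE ->]; rewrite ?eqxx.
- exact/RleP.
- by apply/RleP/Rlt_le/exp_pos.
- by move=> l; apply/RleP/Rlt_le/exp_pos.
- by move=> l t; apply/RleP; rewrite -RabsE; exact: Hf.
- move=> l; apply/RleP; rewrite -RabsE -(sumR_ordE (fun t => IZR (f l t) * u t)).
  exact: Hfu.
- move=> psi inj; set k := length xs in psi inj *.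
  pose I := [seq nat_of_ord (psi b) | b <- enum 'I_k].
  have sI : size I = k by rewrite size_map size_enum_ord.
  have -> : (\prod_b exp (L (psi b)))%R = exp (sumR (List.map L I)).
    rewrite sumR_bigE big_map big_enum /=.
    apply/esym; apply: (big_morph exp); last exact: exp_0.
    by move=> a b; rewrite -RplusE exp_plus.
  apply/RleP; case: (HT I) => [||l|H|->]; try exact: Rle_refl.
  + have : uniq I by rewrite map_inj_uniq ?enum_uniq // => a b /val_inj; exact: inj.
    elim: (I) => [_|x s IH /= /andP[xs' us]]; constructor; last exact: IH.
    move=> Hx; case/negP: xs'; elim: s Hx {IH us} => //= z s IH [->|/IH H].
      by rewrite inE eqxx.
    by rewrite inE H orbT.
  + exact: sI.
  + by move/List.in_map_iff => [b [<- _]].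
  + exact/Rlt_le/exp_increasing.
Qed.

Lemma wedge_norm_upper_exp (n : nat) (I : list nat) (u : vec) (y : nat -> nat -> Z)
    (L : nat -> R) (q K U : R) :
  1 <= U -> 0 <= q ->
  (forall t, le t n -> Rabs (u t) <= U) ->
  (forall l, List.In l I -> Rabs (IZR (y l 0%nat)) <= K * exp (- L l) * exp q) ->
  (forall l t, List.In l I -> le t n ->
    Rabs (IZR (y l t) - IZR (y l 0%nat) * u t) <= K * exp (- L l)) ->
  let xs := List.map (fun l t => IZR (y l t)) I in
  let B := 2 ^ S n * (INR (fact (S (length I))) * (U * (K ^ length I * exp (- sumR (List.map L I))))) in
  wedge_norm n xs <= B * exp q /\ wedge_norm n (u :: xs) <= B.
Proof.
move=> U1 q0 Hu H0 Hw xs B; set k := length I.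
have lx : length xs = k by rewrite /xs length_map.
pose al a := K * exp (- L (nth 0%N I a)).
have cE a t : (a < k)%N -> coord xs a t = IZR (y (nth 0%N I a) t).
  move=> ak; rewrite /coord /xs (List.nth_indep _ _ (fun t => IZR (y 0%N t))); last first.
    by rewrite lx; apply/ssrnat.ltP.
  by rewrite (List.map_nth (fun l t => IZR (y l t))) list_nthE.
have inI a : (a < k)%N -> List.In (nth 0%N I a) I.
  by move=> ak; rewrite -list_nthE; apply: List.nth_In; apply/ssrnat.ltP.
have alE : (\prod_(a < k) al a)%R = K ^ k * exp (- sumR (List.map L I)).
  rewrite big_split /= prodr_const card_ord RpowE; congr (_ * _)%R.
  rewrite (prod_exp k (fun a => - L (nth 0%N I a))); congr exp.
  by rewrite sumrN sumR_bigE (big_nth 0%N) big_mkord.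
have [||t|a|a t|h1 h2] := @wedge_norm_upper n k xs u al (exp q) U lx.
- exact/RleP.
- by apply/RleP; rewrite -[1%R]exp_0; case: q0 => [H|<-]; [apply/Rlt_le/exp_increasing|exact: Rle_refl].
- by move=> /ssrnat.leP/Hu/RleP; rewrite RabsE.
- by move=> ak; rewrite cE // -RabsE; apply/RleP/H0/inI.
- by move=> ak /ssrnat.leP tn; rewrite !cE // -RabsE; apply/RleP/Hw => //; apply/inI.
rewrite -RpowE -factE -(INRE (fact (S k))) alE in h1 h2.
split; apply/RleP; last exact: h2.
suff -> : B * exp q = 2 ^ S n * (INR (fact (S k)) * (U * exp q * (K ^ k * exp (- sumR (List.map L I))))).
  exact: h1.
by rewrite /B -/k; ring.
Qed.

Lemma integer_multiple_nonzero n v : rational_vec n v ->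
  exists d : R, d <> 0 /\ integer_vec n (fun i => d * v i).
Proof. by case/integer_multiple => d /eqP d0 dv; exists d. Qed.

Arguments wedge_norm_basis_change : clear implicits.
Arguments wedge_norm_lower_exp : clear implicits.
Arguments wedge_norm_upper_exp : clear implicits.
Arguments integer_multiple_nonzero : clear implicits.

End Minors.

(** * The multidimensional continued fraction *)

Definition sumN (N : nat) (F : nat -> R) : R := sumR (map F (seq 0 N)).

Lemma sumN_ext (N : nat) (F G : nat -> R) :
  (forall l, (l < N)%nat -> F l = G l) -> sumN N F = sumN N G.
Proof. intros H; apply sumR_map_eq; intros x Hx; apply H; apply in_seq in Hx; lia. Qed.

Lemma sumN_le (N : nat) (F G : nat -> R) :
  (forall l, (l < N)%nat -> F l <= G l) -> sumN N F <= sumN N G.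
Proof. intros H; apply sumR_map_le; intros x Hx; apply H; apply in_seq in Hx; lia. Qed.

Lemma sumN_nonneg (N : nat) (F : nat -> R) :
  (forall l, (l < N)%nat -> 0 <= F l) -> 0 <= sumN N F.
Proof. intros H; apply sumR_map_nonneg; intros x Hx; apply H; apply in_seq in Hx; lia. Qed.

Lemma sumN_S (N : nat) (F : nat -> R) : sumN (S N) F = sumN N F + F N.
Proof.
  unfold sumN. rewrite seq_S, map_app. generalize (map F (seq 0 N)) as l.
  induction l as [|a l IH]; simpl in *; [ring|rewrite IH; ring].
Qed.

Lemma sumN_plus (N : nat) (F G : nat -> R) :
  sumN N (fun l => F l + G l) = sumN N F + sumN N G.
Proof. apply sumR_map_plus. Qed.

Lemma sumN_scal (N : nat) (c : R) (F : nat -> R) : sumN N (fun l => c * F l) = c * sumN N F.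
Proof. apply sumR_map_scal. Qed.

Lemma sumN_const (N : nat) (c : R) : sumN N (fun _ => c) = INR N * c.
Proof. unfold sumN. rewrite sumR_map_const, length_seq. reflexivity. Qed.

Lemma sumN_single (N k : nat) (F : nat -> R) :
  (k < N)%nat -> sumN N (fun l => if Nat.eqb l k then F l else 0) = F k.
Proof.
  induction N as [|N IH]; intros Hk; [lia|]. rewrite sumN_S.
  destruct (Nat.eqb_spec N k) as [->|E].
  - rewrite (sumN_ext _ _ (fun _ => 0)), sumN_const; [ring|].
    intros l Hl; destruct (Nat.eqb_spec l k); [lia|reflexivity].
  - rewrite IH by lia; ring.
Qed.

Lemma sumN_update (N k : nat) (F G : nat -> R) :
  (k < N)%nat -> (forall l, (l < N)%nat -> l <> k -> G l = F l) ->
  sumN N G = sumN N F + (G k - F k).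
Proof.
  intros Hk H. rewrite <- (sumN_single N k (fun l => G l - F l)) by exact Hk.
  rewrite <- sumN_plus. apply sumN_ext. intros l Hl.
  destruct (Nat.eqb_spec l k) as [->|E]; [ring|rewrite H by assumption; ring].
Qed.

Lemma sumN_exchange (N M : nat) (F : nat -> nat -> R) :
  sumN N (fun a => sumN M (F a)) = sumN M (fun b => sumN N (fun a => F a b)).
Proof.
  induction N as [|N IH].
  - unfold sumN at 1; simpl. rewrite (sumN_ext M _ (fun _ => 0)) by reflexivity.
    rewrite sumN_const; ring.
  - rewrite sumN_S, IH, <- sumN_plus. apply sumN_ext; intros; rewrite sumN_S; reflexivity.
Qed.

Lemma sumN_abs (N : nat) (F : nat -> R) : Rabs (sumN N F) <= sumN N (fun l => Rabs (F l)).
Proof.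
  induction N as [|N IH]; [unfold sumN; simpl; rewrite Rabs_R0; lra|].
  rewrite !sumN_S. eapply Rle_trans; [apply Rabs_triang|lra].
Qed.

Definition kron (l k : nat) : R := if Nat.eqb l k then 1 else 0.

Lemma kron_refl (l : nat) : kron l l = 1.
Proof. unfold kron; rewrite Nat.eqb_refl; reflexivity. Qed.

Lemma kron_neq (l k : nat) : l <> k -> kron l k = 0.
Proof. unfold kron; intros H; destruct (Nat.eqb_spec l k); [contradiction|reflexivity]. Qed.

Lemma sumN_kron (N k : nat) (F : nat -> R) : (k < N)%nat -> sumN N (fun l => kron l k * F l) = F k.
Proof.
  intros Hk. rewrite <- (sumN_single N k F Hk). apply sumN_ext; intros l _.
  unfold kron; destruct (Nat.eqb l k); ring.
Qed.

(** At step [i] a multiple of the point [lab i] is added to the point [lab (S i)]; [lev i l] is the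
    prescribed logarithm of the norm of the [l]-th dual form before that step. *)
Record schedule (N : nat) (lab : nat -> nat) (lev : nat -> nat -> R) : Prop := {
  lab_lt : forall i, (lab i < N)%nat;
  lab_0 : lab 0%nat = 0%nat;
  lab_S : forall i, lab (S i) <> lab i;
  lev_0 : forall l, (l < N)%nat -> lev 0%nat l = 1;
  lev_other : forall i l, (l < N)%nat -> l <> lab i -> lev (S i) l = lev i l;
  lev_incr : forall i, lev i (lab i) <= lev (S i) (lab i);
  lev_next : forall i, lev i (lab (S i)) <= lev (S i) (lab i) }.

(** [size] bounds the coefficients of the forms and obeys their recurrence with the sign of the
    multiple reversed. It therefore cannot drop by cancellation, and all estimates are made with
    it. *)
Record state := mkState { pts : nat -> nat -> Z; forms : nat -> nat -> Z; size : nat -> R }.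

(** [c * size b] just exceeds both the prescribed norm [exp (lev (S i) a)] and the old [size a]. The
    second condition makes the added multiple dominate, which gives the lower bound on the new point
    in [szprod_le_pt]. *)
Definition mult (lab : nat -> nat) (lev : nat -> nat -> R) (i : nat) (s : state) : Z :=
  up (Rmax (exp (lev (S i) (lab i))) (size s (lab i)) / size s (lab (S i))).

Definition step (lab : nat -> nat) (lev : nat -> nat -> R) (i : nat) (s : state) : state :=
  let a := lab i in let b := lab (S i) in let c := mult lab lev i s in
  {| pts := fun l t => if Nat.eqb l b then (pts s l t + c * pts s a t)%Z else pts s l t;
     forms := fun l t => if Nat.eqb l a then (forms s l t - c * forms s b t)%Z else forms s l t;
     size := fun l => if Nat.eqb l a then size s a + IZR c * size s b else size s l |}.

Definition start : state :=
  {| pts := fun l t => if Nat.eqb l t then 1%Z else 0%Z;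
     forms := fun l t => if Nat.eqb l t then 1%Z else 0%Z;
     size := fun _ => exp 1 |}.

Fixpoint run (lab : nat -> nat) (lev : nat -> nat -> R) (i : nat) : state :=
  match i with
  | O => start
  | S i' => step lab lev i' (run lab lev i')
  end.

Definition pt lab lev i l t : R := IZR (pts (run lab lev i) l t).
Definition fm lab lev i l t : R := IZR (forms (run lab lev i) l t).
Definition sz lab lev i l : R := size (run lab lev i) l.
Definition cst lab lev i : R := IZR (mult lab lev i (run lab lev i)).
(** The product of all sizes, written through logarithms so that it compares directly with the sum
    of the levels. *)
Definition szprod N lab lev i : R := exp (sumN N (fun l => ln (sz lab lev i l))).

(** * Estimates propagated by the recurrence *)

Section Expansion.
Context (N : nat) (lab : nat -> nat) (lev : nat -> nat -> R).
Context (HS : schedule N lab lev).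

Local Notation y := (pt lab lev).
Local Notation f := (fm lab lev).
Local Notation A := (sz lab lev).
Local Notation c := (cst lab lev).
Local Notation P := (szprod N lab lev).

Lemma pt_0 l t : y 0 l t = kron l t.
Proof. unfold pt, kron; simpl; destruct (Nat.eqb l t); reflexivity. Qed.

Lemma fm_0 l t : f 0 l t = kron l t.
Proof. unfold fm, kron; simpl; destruct (Nat.eqb l t); reflexivity. Qed.

Lemma pt_next i t : y (S i) (lab (S i)) t = y i (lab (S i)) t + c i * y i (lab i) t.
Proof. unfold pt, cst; simpl; rewrite Nat.eqb_refl, plus_IZR, mult_IZR; reflexivity. Qed.

Lemma pt_other i l t : l <> lab (S i) -> y (S i) l t = y i l t.
Proof. intros H; unfold pt; simpl; destruct (Nat.eqb_spec l (lab (S i))); [contradiction|reflexivity]. Qed.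

Lemma fm_cur i t : f (S i) (lab i) t = f i (lab i) t - c i * f i (lab (S i)) t.
Proof. unfold fm, cst; simpl; rewrite Nat.eqb_refl, minus_IZR, mult_IZR; reflexivity. Qed.

Lemma fm_other i l t : l <> lab i -> f (S i) l t = f i l t.
Proof. intros H; unfold fm; simpl; destruct (Nat.eqb_spec l (lab i)); [contradiction|reflexivity]. Qed.

Lemma sz_cur i : A (S i) (lab i) = A i (lab i) + c i * A i (lab (S i)).
Proof. unfold sz, cst; simpl; rewrite Nat.eqb_refl; reflexivity. Qed.

Lemma sz_other i l : l <> lab i -> A (S i) l = A i l.
Proof. intros H; unfold sz; simpl; destruct (Nat.eqb_spec l (lab i)); [contradiction|reflexivity]. Qed.

Lemma cst_bounds i : 0 < A i (lab (S i)) ->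
  Rmax (exp (lev (S i) (lab i))) (A i (lab i)) <= c i * A i (lab (S i)) <=
  Rmax (exp (lev (S i) (lab i))) (A i (lab i)) + A i (lab (S i)).
Proof.
  intros H. unfold cst, mult.
  fold (A i (lab i)) (A i (lab (S i))). set (x := Rmax _ _).
  destruct (archimed (x / A i (lab (S i)))) as [H1 H2].
  assert (E : x / A i (lab (S i)) * A i (lab (S i)) = x) by (field; lra).
  split; nra.
Qed.

(** The new size is at most the maximum in [mult] plus the two old sizes. Each of these three terms
    is at most [3 ^ i] times the exponential of the new level, by [lev_incr] and [lev_next]; this is
    the factor 3 per step. *)
Lemma sz_bounds i l : (l < N)%nat -> exp (lev i l) <= A i l <= 3 ^ i * exp (lev i l).
Proof.
  revert l; induction i as [|i IH]; intros l Hl.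
  - rewrite (lev_0 _ _ _ HS) by exact Hl. unfold sz; simpl; lra.
  - destruct (Nat.eq_dec l (lab i)) as [->|E].
    + assert (Ha := IH _ (lab_lt _ _ _ HS i)). assert (Hb := IH _ (lab_lt _ _ _ HS (S i))).
      assert (Hb0 := exp_pos (lev i (lab (S i)))).
      assert (H3 : 1 <= 3 ^ i) by (apply pow_R1_Rle; lra).
      destruct (cst_bounds i) as [C1 C2]; [lra|].
      assert (M1 := Rmax_l (exp (lev (S i) (lab i))) (A i (lab i))).
      assert (M2 := Rmax_r (exp (lev (S i) (lab i))) (A i (lab i))).
      assert (E1 : exp (lev i (lab i)) <= exp (lev (S i) (lab i))).
      { destruct (lev_incr _ _ _ HS i) as [h|h]; [left; now apply exp_increasing|rewrite h; lra]. }
      assert (E2 : exp (lev i (lab (S i))) <= exp (lev (S i) (lab i))).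
      { destruct (lev_next _ _ _ HS i) as [h|h]; [left; now apply exp_increasing|rewrite h; lra]. }
      assert (M3 : Rmax (exp (lev (S i) (lab i))) (A i (lab i)) <= 3 ^ i * exp (lev (S i) (lab i))).
      { apply Rmax_lub; [|nra]. assert (0 < exp (lev (S i) (lab i))) by apply exp_pos. nra. }
      rewrite sz_cur. assert (0 < exp (lev i (lab i))) by apply exp_pos.
      simpl pow. split; nra.
    + rewrite sz_other, (lev_other _ _ _ HS) by assumption.
      destruct (IH l Hl) as [H1 H2]. split; [exact H1|].
      assert (0 < exp (lev i l)) by apply exp_pos.
      assert (1 <= 3 ^ i) by (apply pow_R1_Rle; lra). simpl pow; nra.
Qed.

Lemma sz_pos i l : (l < N)%nat -> 0 < A i l.
Proof. intros Hl; destruct (sz_bounds i l Hl); assert (0 < exp (lev i l)) by apply exp_pos; lra. Qed.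

Lemma cst_spec i :
  A i (lab i) <= c i * A i (lab (S i)) /\ 1 <= c i.
Proof.
  assert (Hb := sz_pos i _ (lab_lt _ _ _ HS (S i))).
  destruct (cst_bounds i Hb) as [C1 _].
  assert (M1 := Rmax_l (exp (lev (S i) (lab i))) (A i (lab i))).
  assert (M2 := Rmax_r (exp (lev (S i) (lab i))) (A i (lab i))).
  split; [lra|].
  assert (0 < c i). { assert (0 < exp (lev (S i) (lab i))) by apply exp_pos. nra. }
  unfold cst in *. apply lt_0_IZR in H. apply IZR_le. lia.
Qed.

Lemma sz_incr i l : (l < N)%nat -> A i l <= A (S i) l.
Proof.
  intros Hl; destruct (Nat.eq_dec l (lab i)) as [->|E].
  - rewrite sz_cur. destruct (cst_spec i).
    assert (0 < A i (lab (S i))) by apply (sz_pos i _ (lab_lt _ _ _ HS (S i))). nra.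
  - rewrite sz_other by exact E; lra.
Qed.

Lemma szprod_pos i : 0 < P i.
Proof. apply exp_pos. Qed.

Lemma szprod_S i : P (S i) * A i (lab i) = P i * A (S i) (lab i).
Proof.
  unfold szprod. rewrite (sumN_update N (lab i) (fun l => ln (A i l))).
  - rewrite exp_plus. unfold Rminus. rewrite exp_plus, exp_Ropp, !exp_ln by
      (apply sz_pos; apply (lab_lt _ _ _ HS)).
    field. apply Rgt_not_eq, sz_pos, (lab_lt _ _ _ HS).
  - apply (lab_lt _ _ _ HS).
  - intros l _ Hl; rewrite sz_other by exact Hl; reflexivity.
Qed.

Lemma szprod_incr i : P i <= P (S i).
Proof.
  assert (Ha := sz_pos i _ (lab_lt _ _ _ HS i)).
  assert (H := szprod_S i). assert (Hi := sz_incr i _ (lab_lt _ _ _ HS i)).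
  assert (Hp := szprod_pos i). apply (Rmult_le_reg_r (A i (lab i))); [lra|nra].
Qed.

Lemma dual_forms_points i l k : (l < N)%nat -> (k < N)%nat ->
  sumN N (fun t => f i l t * y i k t) = kron l k.
Proof.
  revert l k; induction i as [|i IH]; intros l k Hl Hk.
  - rewrite (sumN_ext _ _ (fun t => kron t k * kron l t)).
    + rewrite sumN_kron by exact Hk; reflexivity.
    + intros t _; rewrite fm_0, pt_0. unfold kron.
      rewrite (Nat.eqb_sym t k); ring.
  - assert (Ha := lab_lt _ _ _ HS i). assert (Hb := lab_lt _ _ _ HS (S i)).
    assert (Hab := lab_S _ _ _ HS i).
    destruct (Nat.eq_dec l (lab i)) as [->|El]; destruct (Nat.eq_dec k (lab (S i))) as [->|Ek].
    + rewrite (sumN_ext _ _ (fun t => f i (lab i) t * y i (lab (S i)) t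
        + (c i * (f i (lab i) t * y i (lab i) t)
        + (- c i * (f i (lab (S i)) t * y i (lab (S i)) t)
        + - c i * (c i * (f i (lab (S i)) t * y i (lab i) t))))))
        by (intros; rewrite fm_cur, pt_next; ring).
      rewrite !sumN_plus, !sumN_scal, !IH by assumption.
      rewrite !kron_refl, !kron_neq by congruence. ring.
    + rewrite (sumN_ext _ _ (fun t => f i (lab i) t * y i k t
        + - c i * (f i (lab (S i)) t * y i k t)))
        by (intros; rewrite fm_cur, pt_other by exact Ek; ring).
      rewrite !sumN_plus, !sumN_scal, !IH by assumption.
      rewrite (kron_neq (lab (S i)) k) by congruence. ring.
    + rewrite (sumN_ext _ _ (fun t => f i l t * y i (lab (S i)) t
        + c i * (f i l t * y i (lab i) t)))
        by (intros; rewrite pt_next, fm_other by exact El; ring).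
      rewrite !sumN_plus, !sumN_scal, !IH by assumption.
      rewrite (kron_neq l (lab i)) by congruence. ring.
    + rewrite (sumN_ext _ _ (fun t => f i l t * y i k t))
        by (intros; rewrite pt_other, fm_other by assumption; ring).
      apply IH; assumption.
Qed.

Lemma sumN_two (F G : nat -> R) a b : (a < N)%nat -> (b < N)%nat -> a <> b ->
  (forall l, (l < N)%nat -> l <> a -> l <> b -> G l = F l) ->
  G a + G b = F a + F b -> sumN N G = sumN N F.
Proof.
  intros Ha Hb Hab H E.
  rewrite (sumN_update N a (fun l => if Nat.eqb l b then G b else F l) G Ha).
  - rewrite (sumN_update N b F _ Hb).
    + rewrite Nat.eqb_refl. destruct (Nat.eqb_spec a b); [contradiction|lra].
    + intros l _ Hl; destruct (Nat.eqb_spec l b); [contradiction|reflexivity].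
  - intros l Hl Hl'; destruct (Nat.eqb_spec l b) as [->|]; [reflexivity|now apply H].
Qed.

Lemma dual_points_forms i t s : (t < N)%nat -> (s < N)%nat ->
  sumN N (fun l => y i l t * f i l s) = kron t s.
Proof.
  intros Ht Hs; induction i as [|i IH].
  - rewrite (sumN_ext _ _ (fun l => kron l t * kron l s)).
    + rewrite sumN_kron by exact Ht; reflexivity.
    + intros l _; rewrite fm_0, pt_0; reflexivity.
  - rewrite <- IH.
    assert (Ha := lab_lt _ _ _ HS i). assert (Hb := lab_lt _ _ _ HS (S i)).
    assert (Hab := lab_S _ _ _ HS i).
    apply sumN_two with (a := lab i) (b := lab (S i)); auto.
    + intros l _ H1 H2; rewrite pt_other, fm_other by assumption; reflexivity.
    + rewrite fm_cur, pt_next, pt_other, fm_other by congruence. ring.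
Qed.

Lemma fm_le i l t : (l < N)%nat -> Rabs (f i l t) <= A i l.
Proof.
  revert l; induction i as [|i IH]; intros l Hl.
  - rewrite fm_0. unfold sz, kron; simpl.
    assert (1 < exp 1) by (generalize (exp_ineq1 1); lra).
    destruct (Nat.eqb l t); [rewrite Rabs_R1|rewrite Rabs_R0]; lra.
  - destruct (Nat.eq_dec l (lab i)) as [->|E].
    + rewrite fm_cur, sz_cur. destruct (cst_spec i) as [_ C].
      assert (H1 := IH _ (lab_lt _ _ _ HS i)). assert (H2 := IH _ (lab_lt _ _ _ HS (S i))).
      unfold Rminus. eapply Rle_trans; [apply Rabs_triang|].
      rewrite Rabs_Ropp, Rabs_mult, (Rabs_pos_eq (c i)) by lra. nra.
    + rewrite fm_other, sz_other by exact E. now apply IH.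
Qed.

Lemma pt_nonneg i l t : 0 <= y i l t.
Proof.
  revert l; induction i as [|i IH]; intros l.
  - rewrite pt_0; unfold kron; destruct (Nat.eqb l t); lra.
  - destruct (Nat.eq_dec l (lab (S i))) as [->|E].
    + rewrite pt_next. destruct (cst_spec i) as [_ C].
      generalize (IH (lab (S i))) (IH (lab i)); nra.
    + rewrite pt_other by exact E; apply IH.
Qed.

Lemma szprod_0 : P 0 = exp (INR N).
Proof.
  unfold szprod, sz; simpl. f_equal. rewrite ln_exp, sumN_const; ring.
Qed.

(** A point of the dual basis is made of cofactors of the forms, so it should be bounded by the
    product of the other sizes. Induction on the steps proves this without the factorial of a
    determinant estimate, because the product of the sizes grows by exactly the factor
    [(A_a + c A_b) / A_a]. *)
Lemma pt_le i l t : (l < N)%nat -> y i l t * A i l <= P i.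
Proof.
  revert l; induction i as [|i IH]; intros l Hl.
  - rewrite pt_0, szprod_0. unfold sz; simpl.
    assert (H1 : 1 <= INR N) by (apply (le_INR 1); lia).
    assert (H2 : exp 1 <= exp (INR N)).
    { destruct H1 as [H1|H1]; [left; now apply exp_increasing|rewrite <- H1; lra]. }
    assert (0 < exp 1) by apply exp_pos.
    unfold kron; destruct (Nat.eqb l t); lra.
  - assert (Ha := lab_lt _ _ _ HS i). assert (Hb := lab_lt _ _ _ HS (S i)).
    assert (Hab := lab_S _ _ _ HS i). assert (HP := szprod_S i).
    assert (Aa := sz_pos i _ Ha). assert (Ab := sz_pos i _ Hb). assert (Hp := szprod_pos i).
    destruct (cst_spec i) as [C1 C2]. assert (Ai := sz_incr i _ Ha).
    assert (Y := pt_nonneg i l t).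
    destruct (Nat.eq_dec l (lab (S i))) as [->|Eb].
    + rewrite pt_next, sz_other by exact Hab.
      assert (H1 := IH _ Ha). assert (H2 := IH _ Hb).
      rewrite sz_cur in HP.
      apply (Rmult_le_reg_r (A i (lab i))); [exact Aa|]. rewrite HP.
      assert (0 <= c i * A i (lab (S i))) by nra.
      nra.
    + rewrite pt_other by exact Eb. assert (H1 := IH _ Hl).
      destruct (Nat.eq_dec l (lab i)) as [->|Ea].
      * apply (Rmult_le_reg_r (A i (lab i))); [exact Aa|]. rewrite HP. nra.
      * rewrite sz_other by exact Ea. generalize (szprod_incr i); lra.
Qed.

(** The analogue of [pt_le] for pairs of points: two-by-two minors are bounded by the product of the
    other sizes. They measure the angle between two points and drive the convergence. *)
Lemma minor2_le i l k t s : (l < N)%nat -> (k < N)%nat -> l <> k ->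
  Rabs (y i l t * y i k s - y i l s * y i k t) * (A i l * A i k) <= P i.
Proof.
  revert l k; induction i as [|i IH]; intros l k Hl Hk Hlk.
  - rewrite !pt_0, szprod_0. unfold sz; simpl. rewrite <- exp_plus.
    assert (H1 : 2 <= INR N) by (apply (le_INR 2); lia).
    assert (H2 : exp (1 + 1) <= exp (INR N)).
    { destruct H1 as [H1|H1]; [left; apply exp_increasing; lra|rewrite <- H1; right; f_equal; lra]. }
    assert (0 < exp (1 + 1)) by apply exp_pos.
    assert (Rabs (kron l t * kron k s - kron l s * kron k t) <= 1).
    { unfold kron; destruct (Nat.eqb l t), (Nat.eqb k s), (Nat.eqb l s), (Nat.eqb k t);
        apply Rabs_le; split; lra. }
    nra.
  - assert (Ha := lab_lt _ _ _ HS i). assert (Hb := lab_lt _ _ _ HS (S i)).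
    assert (Hab := lab_S _ _ _ HS i). assert (HP := szprod_S i).
    assert (Aa := sz_pos i _ Ha). assert (Ab := sz_pos i _ Hb). assert (Hp := szprod_pos i).
    destruct (cst_spec i) as [C1 C2]. assert (Ai := sz_incr i _ Ha).
    assert (Hi := szprod_incr i).
    assert (same : forall l k, (l < N)%nat -> (k < N)%nat -> l <> k -> k <> lab i ->
      Rabs (y i l t * y i k s - y i l s * y i k t) * (A (S i) l * A (S i) k) <= P (S i)).
    { clear l k Hl Hk Hlk. intros l k Hl Hk Hlk Hka. rewrite (sz_other i k) by exact Hka.
      assert (H := IH l k Hl Hk Hlk).
      assert (Ak := sz_pos i _ Hk).
      assert (R0 := Rabs_pos (y i l t * y i k s - y i l s * y i k t)).
      destruct (Nat.eq_dec l (lab i)) as [->|E].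
      - apply (Rmult_le_reg_r (A i (lab i))); [exact Aa|]. rewrite HP.
        assert (0 < A (S i) (lab i)) by lra. nra.
      - rewrite sz_other by exact E. lra. }
    assert (same' : forall l k, (l < N)%nat -> (k < N)%nat -> l <> k ->
      Rabs (y i l t * y i k s - y i l s * y i k t) * (A (S i) l * A (S i) k) <= P (S i)).
    { clear l k Hl Hk Hlk. intros l k Hl Hk Hlk.
      destruct (Nat.eq_dec k (lab i)) as [->|E]; [|now apply same].
      rewrite Rabs_minus_sym, (Rmult_comm (A (S i) l)).
      replace (y i l s * y i (lab i) t - y i l t * y i (lab i) s) with
        (y i (lab i) t * y i l s - y i (lab i) s * y i l t) by ring.
      apply same; auto. }
    assert (new : forall k, (k < N)%nat -> k <> lab (S i) ->
      Rabs (y (S i) (lab (S i)) t * y i k s - y (S i) (lab (S i)) s * y i k t)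
        * (A (S i) (lab (S i)) * A (S i) k) <= P (S i)).
    { clear l k Hl Hk Hlk. intros k Hk Hkb. rewrite !pt_next.
      destruct (Nat.eq_dec k (lab i)) as [->|E].
      - replace ((y i (lab (S i)) t + c i * y i (lab i) t) * y i (lab i) s -
          (y i (lab (S i)) s + c i * y i (lab i) s) * y i (lab i) t) with
          (y i (lab (S i)) t * y i (lab i) s - y i (lab (S i)) s * y i (lab i) t) by ring.
        now apply same'.
      - rewrite !sz_other by auto.
        assert (H1 := IH _ _ Hb Hk (not_eq_sym Hkb)).
        assert (H2 := IH _ _ Ha Hk (not_eq_sym E)).
        assert (Ak := sz_pos i _ Hk).
        replace ((y i (lab (S i)) t + c i * y i (lab i) t) * y i k s -
          (y i (lab (S i)) s + c i * y i (lab i) s) * y i k t) with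
          ((y i (lab (S i)) t * y i k s - y i (lab (S i)) s * y i k t) +
           c i * (y i (lab i) t * y i k s - y i (lab i) s * y i k t)) by ring.
        eapply Rle_trans; [apply Rmult_le_compat_r; [nra|apply Rabs_triang]|].
        rewrite Rabs_mult, (Rabs_pos_eq (c i)) by lra.
        revert H1 H2.
        generalize (Rabs_pos (y i (lab (S i)) t * y i k s - y i (lab (S i)) s * y i k t))
                   (Rabs_pos (y i (lab i) t * y i k s - y i (lab i) s * y i k t)).
        generalize (Rabs (y i (lab (S i)) t * y i k s - y i (lab (S i)) s * y i k t))
                   (Rabs (y i (lab i) t * y i k s - y i (lab i) s * y i k t)).
        intros u v Hu Hv H1 H2. rewrite sz_cur in HP.
        apply (Rmult_le_reg_r (A i (lab i))); [exact Aa|]. rewrite HP.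
        assert (0 <= c i * A i (lab (S i))) by nra. nra. }
    destruct (Nat.eq_dec l (lab (S i))) as [->|El]; [|destruct (Nat.eq_dec k (lab (S i))) as [->|Ek]].
    + rewrite !(pt_other i k) by auto. apply new; auto.
    + rewrite !(pt_other i l) by auto.
      rewrite Rabs_minus_sym, (Rmult_comm (A (S i) l)).
      replace (y i l s * y (S i) (lab (S i)) t - y i l t * y (S i) (lab (S i)) s) with
        (y (S i) (lab (S i)) t * y i l s - y (S i) (lab (S i)) s * y i l t) by ring.
      apply new; auto.
    + rewrite !pt_other by auto. now apply same'.
Qed.

(** A converse of [pt_le] for the label in use. Since [c A_b] is at least [A_a], the product of the
    sizes grows at most by the factor [2 c A_b / A_a], and the new point contains [c] copies of the
    previous one. *)
Lemma szprod_le_pt i : P i <= 2 ^ i * exp (INR N) * (y i (lab i) 0 * A i (lab i)).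
Proof.
  induction i as [|i IH].
  - rewrite szprod_0, (lab_0 _ _ _ HS), pt_0, kron_refl. unfold sz; simpl.
    assert (1 < exp 1) by (generalize (exp_ineq1 1); lra).
    generalize (exp_pos (INR N)); nra.
  - assert (Ha := lab_lt _ _ _ HS i). assert (Hb := lab_lt _ _ _ HS (S i)).
    assert (Hab := lab_S _ _ _ HS i). assert (HP := szprod_S i).
    assert (Aa := sz_pos i _ Ha). assert (Ab := sz_pos i _ Hb). assert (Hp := szprod_pos i).
    destruct (cst_spec i) as [C1 C2].
    rewrite pt_next, sz_other by exact Hab. rewrite sz_cur in HP.
    assert (Y1 := pt_nonneg i (lab i) 0). assert (Y2 := pt_nonneg i (lab (S i)) 0).
    assert (E : 0 < 2 ^ i * exp (INR N)) by (apply Rmult_lt_0_compat; [apply pow_lt; lra|apply exp_pos]).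
    simpl pow. rewrite (Rmult_assoc 2 (2 ^ i)). set (K := 2 ^ i * exp (INR N)) in *.
    apply (Rmult_le_reg_r (A i (lab i))); [exact Aa|]. rewrite HP.
    assert (H1 : A i (lab i) + c i * A i (lab (S i)) <= 2 * (c i * A i (lab (S i)))) by lra.
    apply Rle_trans with (K * (y i (lab i) 0 * A i (lab i)) * (2 * (c i * A i (lab (S i))))).
    + apply Rmult_le_compat; [lra| |exact IH|exact H1]. generalize (Rmult_le_pos (c i) (A i (lab (S i)))); lra.
    + replace (K * (y i (lab i) 0 * A i (lab i)) * (2 * (c i * A i (lab (S i))))) with
        (2 * (K * (c i * y i (lab i) 0 * A i (lab (S i)))) * A i (lab i)) by ring.
      replace (2 * K * ((y i (lab (S i)) 0 + c i * y i (lab i) 0) * A i (lab (S i))) * A i (lab i))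
        with (2 * (K * ((y i (lab (S i)) 0 + c i * y i (lab i) 0) * A i (lab (S i)))) * A i (lab i)) by ring.
      apply Rmult_le_compat_r; [lra|]. apply Rmult_le_compat_l; [lra|].
      apply Rmult_le_compat_l; [lra|]. apply Rmult_le_compat_r; lra.
Qed.

Lemma pt_lab_ge1 i : 1 <= y i (lab i) 0.
Proof.
  assert (H := szprod_le_pt i). assert (Hp := szprod_pos i).
  assert (Aa := sz_pos i _ (lab_lt _ _ _ HS i)).
  assert (E : 0 < 2 ^ i * exp (INR N)) by (apply Rmult_lt_0_compat; [apply pow_lt; lra|apply exp_pos]).
  assert (Y := pt_nonneg i (lab i) 0).
  assert (0 < y i (lab i) 0).
  { destruct Y as [Y|Y]; [exact Y|]. rewrite <- Y in H. lra. }
  unfold pt in *. apply lt_0_IZR in H0. apply IZR_le. lia.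
Qed.

(* The sum is the coefficient of a later point on the [l]-th point of step [i]. *)
Lemma forms_later_nonneg i j l k : (i <= j)%nat -> (l < N)%nat -> (k < N)%nat ->
  0 <= sumN N (fun t => f i l t * y j k t).
Proof.
  intros Hij Hl; revert k; induction Hij as [|j Hij IH]; intros k Hk.
  - rewrite dual_forms_points by assumption.
    unfold kron; destruct (Nat.eqb l k); lra.
  - destruct (Nat.eq_dec k (lab (S j))) as [->|E].
    + rewrite (sumN_ext _ _ (fun t => f i l t * y j (lab (S j)) t +
        c j * (f i l t * y j (lab j) t))) by (intros; rewrite pt_next; ring).
      rewrite sumN_plus, sumN_scal.
      assert (H1 := IH _ Hk). assert (H2 := IH _ (lab_lt _ _ _ HS j)).
      destruct (cst_spec j). nra.
    + rewrite (sumN_ext _ _ (fun t => f i l t * y j k t))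
        by (intros; rewrite pt_other by exact E; ring).
      now apply IH.
Qed.

Lemma expand_in_points i (v : nat -> R) s : (s < N)%nat ->
  v s = sumN N (fun l => sumN N (fun t => f i l t * v t) * y i l s).
Proof.
  intros Hs. rewrite (sumN_ext _ (fun l => _ * _)
    (fun l => sumN N (fun t => y i l s * f i l t * v t))).
  - rewrite sumN_exchange.
    rewrite (sumN_ext _ _ (fun t => kron t s * v t)).
    + now rewrite sumN_kron.
    + intros t Ht. rewrite (sumN_ext _ _ (fun l => v t * (y i l s * f i l t))) by (intros; ring).
      rewrite sumN_scal, dual_points_forms by assumption.
      unfold kron; rewrite (Nat.eqb_sym t s); ring.
  - intros l _. rewrite Rmult_comm, <- sumN_scal. apply sumN_ext; intros; ring.
Qed.

(** A later point is a nonnegative combination of the nonnegative points of step [i], so a single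
    term of the combination cannot exceed the sum. *)
Lemma forms_later_le i j l k : (i <= j)%nat -> (l < N)%nat -> (k < N)%nat ->
  sumN N (fun t => f i l t * y j k t) * y i l 0 <= y j k 0.
Proof.
  intros Hij Hl Hk.
  assert (HN : (0 < N)%nat) by lia.
  rewrite (expand_in_points i (y j k) 0 HN).
  rewrite <- (sumN_single N l (fun l => sumN N (fun t => f i l t * y j k t) * y i l 0) Hl).
  apply sumN_le. intros m Hm.
  assert (H1 := forms_later_nonneg i j m k Hij Hm Hk). assert (H2 := pt_nonneg i m 0).
  destruct (Nat.eqb m l); [lra|nra].
Qed.

Lemma forms_unchanged i j l : (i <= j)%nat ->
  (forall s, (i <= s)%nat -> (s < j)%nat -> lab s <> l) ->
  forall t, f j l t = f i l t.
Proof.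
  intros Hij; induction Hij as [|j Hij IH]; intros H t; [reflexivity|].
  rewrite fm_other by (apply not_eq_sym, H; lia). apply IH. intros; apply H; lia.
Qed.

Lemma sz_unchanged i j l : (i <= j)%nat ->
  (forall s, (i <= s)%nat -> (s < j)%nat -> lab s <> l) -> A j l = A i l.
Proof.
  intros Hij; induction Hij as [|j Hij IH]; intros H; [reflexivity|].
  rewrite sz_other by (apply not_eq_sym, H; lia). apply IH. intros; apply H; lia.
Qed.

Lemma szprod_mono i j : (i <= j)%nat -> P i <= P j.
Proof.
  intros Hij; induction Hij as [|j Hij IH]; [lra|]. generalize (szprod_incr j); lra.
Qed.

Lemma szprod_ge_lev i : exp (sumN N (lev i)) <= P i.
Proof.
  unfold szprod. assert (H : sumN N (lev i) <= sumN N (fun l => ln (A i l))).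
  { apply sumN_le. intros l Hl. rewrite <- (ln_exp (lev i l)).
    apply ln_le; [apply exp_pos|]. apply sz_bounds; exact Hl. }
  destruct H as [H|H]; [left; now apply exp_increasing|rewrite H; lra].
Qed.

Lemma szprod_le_lev i : P i <= exp (INR N * INR i * ln 3 + sumN N (lev i)).
Proof.
  unfold szprod.
  assert (H : sumN N (fun l => ln (A i l)) <= INR N * INR i * ln 3 + sumN N (lev i)).
  { apply Rle_trans with (sumN N (fun l => INR i * ln 3 + lev i l)).
    - apply sumN_le. intros l Hl.
      replace (INR i * ln 3 + lev i l) with (ln (3 ^ i * exp (lev i l))).
      + apply ln_le; [now apply sz_pos|]. apply sz_bounds; exact Hl.
      + rewrite ln_mult by (try apply pow_lt; try apply exp_pos; lra).
        rewrite ln_pow by lra. rewrite ln_exp; ring.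
    - rewrite sumN_plus, sumN_const. right; ring. }
  destruct H as [H|H]; [left; now apply exp_increasing|rewrite H; lra].
Qed.

End Expansion.

(** * The limit point *)

Lemma geometric_increments_cv (r : nat -> R) (C : R) :
  (forall j, Rabs (r (S j) - r j) <= C * / 2 ^ j) -> { l : R | Un_cv r l }.
Proof.
  intros H.
  assert (C0 : 0 <= C) by (generalize (H 0%nat) (Rabs_pos (r 1%nat - r 0%nat)); simpl; lra).
  assert (D : forall j p, Rabs (r (j + p)%nat - r j) <= 2 * C * / 2 ^ j).
  { assert (D' : forall p j, Rabs (r (j + p)%nat - r j) <= 2 * C * / 2 ^ j * (1 - / 2 ^ p)).
    { induction p as [|p IH]; intros j.
      - rewrite Nat.add_0_r, Rminus_diag, Rabs_R0; simpl; lra.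
      - replace (j + S p)%nat with (S j + p)%nat by lia.
        replace (r (S j + p)%nat - r j) with ((r (S j + p)%nat - r (S j)) + (r (S j) - r j)) by ring.
        eapply Rle_trans; [apply Rabs_triang|].
        generalize (IH (S j)) (H j). simpl pow. rewrite !Rinv_mult.
        assert (0 < / 2 ^ j) by (apply Rinv_0_lt_compat, pow_lt; lra).
        assert (0 < / 2 ^ p) by (apply Rinv_0_lt_compat, pow_lt; lra). nra. }
    intros j p. eapply Rle_trans; [apply D'|].
    assert (0 < / 2 ^ j) by (apply Rinv_0_lt_compat, pow_lt; lra).
    assert (0 < / 2 ^ p) by (apply Rinv_0_lt_compat, pow_lt; lra).
    rewrite <- (Rmult_1_r (2 * C * / 2 ^ j)) at 2. apply Rmult_le_compat_l; [|lra].
    apply Rmult_le_pos; lra. }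
  apply Rcomplete.R_complete. intros eps He.
  destruct (pow_lt_1_zero (/ 2)) with (y := eps / (4 * C + 1)) as [n0 Hn0].
  - rewrite Rabs_pos_eq; lra.
  - apply Rdiv_lt_0_compat; lra.
  - assert (K : forall n, (n >= n0)%nat -> Rabs (r n - r n0) < eps / 2).
    { intros n Hn. replace n with (n0 + (n - n0))%nat by lia.
      eapply Rle_lt_trans; [apply D|]. specialize (Hn0 n0 (Nat.le_refl _)).
      rewrite pow_inv in Hn0.
      assert (Hp : 0 < / 2 ^ n0) by (apply Rinv_0_lt_compat, pow_lt; lra).
      rewrite Rabs_pos_eq in Hn0 by lra.
      apply Rmult_lt_compat_r with (r := 4 * C + 1) in Hn0; [|lra].
      replace (eps / (4 * C + 1) * (4 * C + 1)) with eps in Hn0 by (field; lra). nra. }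
    exists n0. intros n m Hn Hm. unfold Rdist.
    replace (r n - r m) with ((r n - r n0) + - (r m - r n0)) by ring.
    eapply Rle_lt_trans; [apply Rabs_triang|]. rewrite Rabs_Ropp.
    generalize (K n Hn) (K m Hm); lra.
Qed.

Lemma sumN_is_lim_seq (N : nat) (a : nat -> R) (r : nat -> nat -> R) (u : nat -> R) :
  (forall t, is_lim_seq (fun j => r j t) (u t)) ->
  is_lim_seq (fun j => sumN N (fun t => a t * r j t)) (sumN N (fun t => a t * u t)).
Proof.
  intros H; induction N as [|N IH]; [apply is_lim_seq_const|].
  apply is_lim_seq_ext with (fun j => sumN N (fun t => a t * r j t) + a N * r j N).
  - intros j; now rewrite sumN_S.
  - rewrite sumN_S. apply is_lim_seq_plus'; [exact IH|].
    apply (is_lim_seq_scal_l _ (a N) (u N)). apply H.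
Qed.

Section Limit.
Context (N : nat) (lab : nat -> nat) (lev : nat -> nat -> R).
Context (HS : schedule N lab lev).
Context (C : R) (HC : forall j, INR j * ln 8 <= sumN N (lev j) + C).

Local Notation y := (pt lab lev).
Local Notation f := (fm lab lev).
Local Notation A := (sz lab lev).
Local Notation P := (szprod N lab lev).

Definition ratio j t : R := y j (lab j) t / y j (lab j) 0.

(** The increment is a two-by-two minor divided by the two first coordinates. By [minor2_le] and the
    lower bounds of [szprod_le_pt] at [j] and [S j] it is at most a constant times [4 ^ j] over the
    product of the sizes. The hypothesis [HC] makes that product at least of order [8 ^ j], which
    leaves [2 ^ j] to spare. *)
Lemma ratio_increment t j :
  Rabs (ratio (S j) t - ratio j t) <= exp (2 * INR N + C) * / 2 ^ j.
Proof.
  unfold ratio.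
  assert (Ha := lab_lt _ _ _ HS j). assert (Hb := lab_lt _ _ _ HS (S j)).
  assert (Hab := lab_S _ _ _ HS j).
  assert (Z1 := pt_lab_ge1 _ _ _ HS j). assert (Z2 := pt_lab_ge1 _ _ _ HS (S j)).
  assert (H1 := szprod_le_pt _ _ _ HS j). assert (H2 := szprod_le_pt _ _ _ HS (S j)).
  assert (M := minor2_le _ _ _ HS j _ _ t 0 Hb Ha Hab).
  assert (Aa := sz_pos _ _ _ HS j _ Ha). assert (Ab := sz_pos _ _ _ HS j _ Hb).
  assert (Hp := szprod_pos N lab lev j).
  assert (G := szprod_ge_lev _ _ _ HS (S j)).
  rewrite sz_other in H2 by exact Hab.
  assert (e8 : 8 ^ S j <= exp (sumN N (lev (S j)) + C)).
  { rewrite <- Rpower_pow by lra. unfold Rpower.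
    destruct (HC (S j)) as [h|h]; [left; now apply exp_increasing|rewrite h; lra]. }
  rewrite exp_plus in e8.
  set (za := y j (lab j) 0) in *. set (zb := y (S j) (lab (S j)) 0) in *.
  replace (y (S j) (lab (S j)) t / zb - y j (lab j) t / za) with
    ((y j (lab (S j)) t * y j (lab j) 0 - y j (lab (S j)) 0 * y j (lab j) t) / (za * zb)).
  2:{ rewrite (pt_next lab lev j t).
      assert (Ez : y j (lab (S j)) 0 = zb - cst lab lev j * za)
        by (unfold zb; rewrite pt_next; fold za; ring).
      rewrite Ez. fold za. field. split; lra. }
  unfold Rdiv. rewrite Rabs_mult. set (m := Rabs (_ - _)) in *.
  rewrite Rabs_pos_eq by (left; apply Rinv_0_lt_compat; nra).
  assert (Hm : 0 <= m) by apply Rabs_pos.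
  assert (Hj : 0 < 2 ^ j) by (apply pow_lt; lra).
  assert (HN := exp_pos (INR N)). assert (HCp := exp_pos C).
  replace (2 * INR N + C) with (INR N + INR N + C) by ring. rewrite !exp_plus.
  set (E := exp (INR N)) in *. set (X := exp C) in *. set (Q := exp (sumN N (lev (S j)))) in *.
  assert (HQ : 0 < Q) by apply exp_pos.
  simpl pow in H2, e8.
  replace (8 ^ j) with (2 ^ j * 2 ^ j * 2 ^ j) in e8
    by (rewrite <- !Rpow_mult_distr; f_equal; lra).
  set (T := 2 ^ j) in *.
  set (a := A j (lab j)) in *. set (b := A j (lab (S j))) in *.
  assert (S1 : m * b <= T * E * za).
  { apply (Rmult_le_reg_r a); [exact Aa|]. lra. }
  assert (S2 : m * (b * zb) <= T * E * za * zb).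
  { rewrite <- Rmult_assoc. apply Rmult_le_compat_r; lra. }
  assert (S3 : 4 * T * T <= E * (b * zb) * X).
  { apply (Rmult_le_reg_r (2 * T)); [lra|].
    apply Rle_trans with (Q * X); [lra|].
    replace (E * (b * zb) * X * (2 * T)) with ((2 * T * E * (zb * b)) * X) by ring.
    apply Rmult_le_compat_r; lra. }
  assert (S4 : m * (4 * T) <= E * E * X * (za * zb)).
  { apply (Rmult_le_reg_r T); [exact Hj|].
    apply Rle_trans with (m * (E * (b * zb) * X)).
    - replace (m * (4 * T) * T) with (m * (4 * T * T)) by ring. apply Rmult_le_compat_l; lra.
    - replace (m * (E * (b * zb) * X)) with (E * X * (m * (b * zb))) by ring.
      replace (E * E * X * (za * zb) * T) with (E * X * (T * E * za * zb)) by ring.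
      apply Rmult_le_compat_l; [|exact S2]. left; now apply Rmult_lt_0_compat. }
  assert (Hz : 0 < za * zb) by (apply Rmult_lt_0_compat; lra).
  apply (Rmult_le_reg_r (za * zb)); [exact Hz|].
  rewrite Rmult_assoc, Rinv_l, Rmult_1_r by lra.
  apply (Rmult_le_reg_r T); [exact Hj|].
  replace (E * E * X * / T * (za * zb) * T) with (E * E * X * (za * zb)) by (field; lra).
  assert (0 <= m * T) by (apply Rmult_le_pos; lra). lra.
Qed.

Definition limit_point (t : nat) : R :=
  proj1_sig (geometric_increments_cv (fun j => ratio j t) _ (ratio_increment t)).

Local Notation u := limit_point.

Lemma ratio_cv t : is_lim_seq (fun j => ratio j t) (u t).
Proof. apply is_lim_seq_Reals. exact (proj2_sig (geometric_increments_cv _ _ (ratio_increment t))). Qed.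

Lemma limit_point_0 : u 0 = 1.
Proof.
  assert (H := ratio_cv 0). apply is_lim_seq_unique in H.
  rewrite (Lim_seq_ext _ (fun _ => 1)), Lim_seq_const in H.
  - now inversion H.
  - intros j; unfold ratio. assert (Z := pt_lab_ge1 _ _ _ HS j). field; lra.
Qed.

Definition form_value i l : R := sumN N (fun t => f i l t * u t).
Local Notation F := form_value.

Lemma form_value_cv i l : is_lim_seq (fun j => sumN N (fun t => f i l t * ratio j t)) (F i l).
Proof. apply sumN_is_lim_seq, ratio_cv. Qed.

Lemma form_ratio i l j :
  sumN N (fun t => f i l t * ratio j t) = sumN N (fun t => f i l t * y j (lab j) t) * / y j (lab j) 0.
Proof.
  rewrite Rmult_comm, <- sumN_scal. apply sumN_ext; intros; unfold ratio, Rdiv; ring.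
Qed.

Lemma form_value_nonneg i l : (l < N)%nat -> 0 <= F i l.
Proof.
  intros Hl.
  apply (is_lim_seq_le_loc (fun _ => 0) (fun j => sumN N (fun t => f i l t * ratio j t)) 0 (F i l)).
  - exists i. intros j Hj. rewrite form_ratio. apply Rmult_le_pos.
    + apply (forms_later_nonneg _ _ _ HS); auto. apply (lab_lt _ _ _ HS).
    + left; apply Rinv_0_lt_compat. generalize (pt_lab_ge1 _ _ _ HS j); lra.
  - apply is_lim_seq_const.
  - apply form_value_cv.
Qed.

Lemma form_value_le i l : (l < N)%nat -> F i l * y i l 0 <= 1.
Proof.
  intros Hl.
  apply (is_lim_seq_le_loc (fun j => sumN N (fun t => f i l t * ratio j t) * y i l 0)
     (fun _ => 1) (F i l * y i l 0) 1).
  - exists i. intros j Hj. rewrite form_ratio.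
    assert (Z := pt_lab_ge1 _ _ _ HS j).
    assert (H := forms_later_le _ _ _ HS i j l _ Hj Hl (lab_lt _ _ _ HS j)).
    apply (Rmult_le_reg_r (y j (lab j) 0)); [lra|].
    replace (sumN N (fun t => f i l t * y j (lab j) t) * / y j (lab j) 0 * y i l 0 * y j (lab j) 0)
      with (sumN N (fun t => f i l t * y j (lab j) t) * y i l 0) by (field; lra).
    lra.
  - apply (is_lim_seq_scal_r _ (y i l 0) (F i l)), form_value_cv.
  - apply is_lim_seq_const.
Qed.

(** The value at [u] is at most the inverse of the first coordinate of the dual point, and for the
    label in use that coordinate is bounded below by [szprod_le_pt]. *)
Lemma form_value_cur i :
  F i (lab i) * P i <= 2 ^ i * exp (INR N) * A i (lab i).
Proof.
  assert (Hl := lab_lt _ _ _ HS i).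
  assert (H1 := form_value_nonneg i _ Hl). assert (H2 := form_value_le i _ Hl).
  assert (H3 := szprod_le_pt _ _ _ HS i). assert (Aa := sz_pos _ _ _ HS i _ Hl).
  assert (E : 0 < 2 ^ i * exp (INR N)) by (apply Rmult_lt_0_compat; [apply pow_lt; lra|apply exp_pos]).
  set (K := 2 ^ i * exp (INR N)) in *.
  apply Rle_trans with (F i (lab i) * (K * (y i (lab i) 0 * A i (lab i)))).
  - apply Rmult_le_compat_l; assumption.
  - replace (F i (lab i) * (K * (y i (lab i) 0 * A i (lab i)))) with
      ((F i (lab i) * y i (lab i) 0) * (K * A i (lab i))) by ring.
    assert (0 < K * A i (lab i)) by now apply Rmult_lt_0_compat.
    rewrite <- (Rmult_1_l (K * A i (lab i))) at 2. apply Rmult_le_compat_r; lra.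
Qed.

Lemma next_use i J l : lab i <> l -> (exists j, (i < j <= J)%nat /\ lab j = l) ->
  exists j, (i < j <= J)%nat /\ lab j = l /\ forall s, (i <= s)%nat -> (s < j)%nat -> lab s <> l.
Proof.
  intros Hi (j & Hj & E). revert j Hj E.
  induction j as [j IH] using lt_wf_ind. intros Hj E.
  destruct (Classical_Prop.classic (exists s, (i < s < j)%nat /\ lab s = l)) as [(s & Hs & Es)|Hn].
  - apply (IH s); [lia|lia|exact Es].
  - exists j. split; [exact Hj|split; [exact E|]]. intros s H1 H2 Es.
    destruct (Nat.eq_dec i s) as [->|]; [contradiction|].
    apply Hn; exists s; split; [lia|exact Es].
Qed.

(** A form stays frozen until its label is next in use, and there [form_value_cur] applies. The
    product of the sizes is then at least that of step [S i]; the price is the exponent [J] of 2. *)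
Lemma form_value_other i J l : (l < N)%nat -> l <> lab i ->
  (exists j, (i < j <= J)%nat /\ lab j = l) ->
  F i l * P (S i) <= 2 ^ J * exp (INR N) * A i l.
Proof.
  intros Hl Hli Hj. destruct (next_use i J l (not_eq_sym Hli) Hj) as (j & Hj' & Ej & Hn).
  assert (EF : F j l = F i l).
  { apply sumN_ext; intros t _; rewrite (forms_unchanged lab lev i j l); auto; lia. }
  assert (EA : A j l = A i l) by (apply sz_unchanged; auto; lia).
  assert (H := form_value_cur j). rewrite Ej, EF, EA in H.
  assert (HP := szprod_mono _ _ _ HS (S i) j ltac:(lia)).
  assert (H0 := form_value_nonneg i l Hl). assert (Aa := sz_pos _ _ _ HS i _ Hl).
  apply Rle_trans with (F i l * P j); [apply Rmult_le_compat_l; assumption|].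
  eapply Rle_trans; [exact H|]. apply Rmult_le_compat_r; [lra|].
  apply Rmult_le_compat_r; [left; apply exp_pos|]. apply Rle_pow; [lra|lia].
Qed.

Lemma szprod_ge_other i l : (l < N)%nat -> A i l * exp (sumN N (lev i) - lev i l) <= P i.
Proof.
  intros Hl. assert (Aa := sz_pos _ _ _ HS i _ Hl).
  rewrite <- (exp_ln (A i l)) by exact Aa. rewrite <- exp_plus. unfold szprod.
  assert (H : ln (A i l) - lev i l <= sumN N (fun k => ln (A i k) + - lev i k)).
  { unfold sumN. apply (sumR_map_In (fun k => ln (A i k) + - lev i k)).
    - intros k Hk. apply in_seq in Hk.
      assert (lev i k <= ln (A i k)); [|lra].
      rewrite <- (ln_exp (lev i k)). apply ln_le; [apply exp_pos|].
      apply (sz_bounds _ _ _ HS); lia.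
    - apply in_seq; lia. }
  rewrite sumN_plus in H.
  assert (H2 : sumN N (fun k => - lev i k) = - sumN N (lev i)).
  { rewrite (sumN_ext _ _ (fun k => -1 * lev i k)) by (intros; ring). rewrite sumN_scal; ring. }
  rewrite H2 in H.
  assert (H3 : ln (A i l) + (sumN N (lev i) - lev i l) <= sumN N (fun k => ln (A i k))) by lra.
  destruct H3 as [H3|H3]; [left; now apply exp_increasing|rewrite H3; lra].
Qed.

(** * Bounds at an intermediate time of one step *)

Section Stage.
Context (i J : nat) (s : R).
Context (Huse : forall l, (l < N)%nat -> exists j, (i < j <= J)%nat /\ lab j = l).
Context (Hs : lev i (lab i) <= s <= lev (S i) (lab i)).

(** During a step the level of the label in use takes every value [s] between its old and its new
    one, so the sum [q] runs through an interval. The bases of step [i] serve for all these [s]. *)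
Definition levels (l : nat) : R := if Nat.eqb l (lab i) then s else lev i l.
Local Notation L := levels.
Local Notation q := (sumN N levels).

Lemma levels_ge l : lev i l <= L l.
Proof. unfold levels. destruct (Nat.eqb_spec l (lab i)) as [->|]; lra. Qed.

Lemma levels_le l : (l < N)%nat -> L l <= lev (S i) l.
Proof.
  intros Hl; unfold levels. destruct (Nat.eqb_spec l (lab i)) as [->|E]; [lra|].
  rewrite (lev_other _ _ _ HS); auto; lra.
Qed.

Lemma levels_sum_cur l : (l < N)%nat -> sumN N (lev i) - lev i l <= q - L l.
Proof.
  intros Hl.
  assert (H : lev i l + - L l <= 0) by (generalize (levels_ge l); lra).
  assert (L l + - lev i l <= sumN N (fun k => L k + - lev i k)).
  { apply (sumR_map_In (fun k => L k + - lev i k)); [|apply in_seq; lia].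
    intros k _; generalize (levels_ge k); lra. }
  rewrite sumN_plus in H0.
  rewrite (sumN_ext N (fun k => - lev i k) (fun k => -1 * lev i k)), sumN_scal in H0 by (intros; ring).
  lra.
Qed.

Lemma levels_sum_next l : (l < N)%nat -> q - L l <= sumN N (lev (S i)) - lev (S i) l.
Proof.
  intros Hl.
  assert (lev (S i) l + - L l <= sumN N (fun k => lev (S i) k + - L k)).
  { apply (sumR_map_In (fun k => lev (S i) k + - L k)); [|apply in_seq; lia].
    intros k Hk; apply in_seq in Hk; generalize (levels_le k ltac:(lia)); lra. }
  rewrite sumN_plus in H.
  rewrite (sumN_ext N (fun k => - L k) (fun k => -1 * L k)), sumN_scal in H by (intros; ring).
  lra.
Qed.

Lemma stage_lt : (i < J)%nat.
Proof. destruct (Huse (lab i) (lab_lt _ _ _ HS i)) as (j & Hj & _); lia. Qed.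

Lemma exp_le x z : x <= z -> exp x <= exp z.
Proof. intros [H|H]; [left; now apply exp_increasing|rewrite H; lra]. Qed.

Lemma form_bound l t : (l < N)%nat -> Rabs (f i l t) <= 3 ^ J * exp (L l).
Proof.
  intros Hl. eapply Rle_trans; [now apply (fm_le _ _ _ HS)|].
  eapply Rle_trans; [now apply (sz_bounds _ _ _ HS)|].
  assert (H := stage_lt).
  apply Rmult_le_compat; try (left; apply exp_pos).
  - apply pow_le; lra.
  - apply Rle_pow; [lra|lia].
  - apply exp_le, levels_ge.
Qed.

(** For the label in use, [q - L l] is the sum of the other levels, which does not involve [s]. For
    another label, [q] may contain the raised level; the bound of [form_value_other] involves the
    product of the sizes after the step and so covers it. *)
Lemma form_value_bound l : (l < N)%nat ->
  F i l <= 2 ^ J * exp (INR N) * exp (L l - q).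
Proof.
  intros Hl. assert (H := stage_lt).
  assert (E : 0 < 2 ^ J * exp (INR N)) by (apply Rmult_lt_0_compat; [apply pow_lt; lra|apply exp_pos]).
  assert (Aa := sz_pos _ _ _ HS i _ Hl).
  assert (F0 := form_value_nonneg i l Hl).
  assert (G : exists X, A i l * X <= 2 ^ J * exp (INR N) * A i l /\ F i l * exp (q - L l) <= X).
  { destruct (Nat.eq_dec l (lab i)) as [->|El].
    - exists (F i (lab i) * exp (sumN N (lev i) - lev i (lab i))). split.
      + eapply Rle_trans; [|eapply Rle_trans; [apply form_value_cur|]].
        * replace (A i (lab i) * (F i (lab i) * exp (sumN N (lev i) - lev i (lab i)))) with
            (F i (lab i) * (A i (lab i) * exp (sumN N (lev i) - lev i (lab i)))) by ring.
          apply Rmult_le_compat_l; [exact F0|now apply szprod_ge_other].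
        * apply Rmult_le_compat_r; [lra|]. apply Rmult_le_compat_r; [left; apply exp_pos|].
          apply Rle_pow; [lra|lia].
      + apply Rmult_le_compat_l; [exact F0|]. apply exp_le.
        unfold levels at 2. rewrite Nat.eqb_refl.
        rewrite (sumN_update N (lab i) (lev i) levels).
        * unfold levels. rewrite Nat.eqb_refl. lra.
        * exact Hl.
        * intros k _ Hk; unfold levels. destruct (Nat.eqb_spec k (lab i)); [contradiction|reflexivity].
    - exists (F i l * exp (q - L l)). split; [|lra].
      eapply Rle_trans; [|apply (form_value_other i J l Hl El (Huse l Hl))].
      replace (A i l * (F i l * exp (q - L l))) with (F i l * (A i l * exp (q - L l))) by ring.
      apply Rmult_le_compat_l; [exact F0|].
      eapply Rle_trans; [|apply (szprod_ge_other (S i) l Hl)].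
      rewrite (sz_other lab lev i l El). apply Rmult_le_compat_l; [lra|].
      apply exp_le. now apply levels_sum_next. }
  destruct G as (X & G1 & G2).
  assert (X <= 2 ^ J * exp (INR N)).
  { apply (Rmult_le_reg_l (A i l)); [exact Aa|]. lra. }
  replace (L l - q) with (- (q - L l)) by ring. rewrite exp_Ropp.
  assert (0 < exp (q - L l)) by apply exp_pos.
  apply (Rmult_le_reg_r (exp (q - L l))); [assumption|].
  rewrite (Rmult_assoc (2 ^ J * exp (INR N))), Rinv_l by lra. lra.
Qed.

Lemma point_bound_0 l : (l < N)%nat ->
  y i l 0 <= exp (INR N * INR J * ln 3) * exp (q - L l).
Proof.
  intros Hl. assert (H := stage_lt).
  assert (Aa := sz_pos _ _ _ HS i _ Hl).
  assert (H1 := pt_le _ _ _ HS i l 0 Hl). assert (H2 := szprod_le_lev _ _ _ HS i).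
  assert (H3 := proj1 (sz_bounds _ _ _ HS i l Hl)).
  assert (Y := pt_nonneg _ _ _ HS i l 0). assert (E := exp_pos (lev i l)).
  apply (Rmult_le_reg_r (exp (lev i l))); [exact E|].
  rewrite <- !exp_plus.
  apply Rle_trans with (y i l 0 * A i l); [now apply Rmult_le_compat_l|].
  eapply Rle_trans; [exact H1|]. eapply Rle_trans; [exact H2|]. apply exp_le.
  assert (H4 := levels_sum_cur l Hl).
  assert (INR i <= INR J) by (apply le_INR; lia).
  assert (0 < ln 3) by (rewrite <- ln_1; apply ln_increasing; lra).
  assert (0 <= INR N) by apply pos_INR.
  assert (INR N * INR i * ln 3 <= INR N * INR J * ln 3).
  { apply Rmult_le_compat_r; [lra|]. now apply Rmult_le_compat_l. }
  lra.
Qed.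

(** Up to constants, [F k] is at most [A k / P] and the minor at most [P / (A l * A k)], so their
    product is at most [1 / A l]. If [l] is the label in use, its level may already have risen; then
    [k] is another label, [F k] is at most [A k / P (S i)], and the quotient of the two products
    turns [A i l] into [A (S i) l]. *)
Lemma value_minor_bound l k t : (l < N)%nat -> (k < N)%nat -> l <> k ->
  F i k * Rabs (y i l t * y i k 0 - y i l 0 * y i k t) <= 2 ^ J * exp (INR N) * exp (- L l).
Proof.
  intros Hl Hk Hlk. assert (H := stage_lt).
  assert (M := minor2_le _ _ _ HS i l k t 0 Hl Hk Hlk).
  set (m := Rabs _) in *. assert (Hm : 0 <= m) by apply Rabs_pos.
  assert (F0 := form_value_nonneg i k Hk).
  assert (Al := sz_pos _ _ _ HS i _ Hl). assert (Ak := sz_pos _ _ _ HS i _ Hk).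
  assert (Hp := szprod_pos N lab lev i). assert (Hp' := szprod_pos N lab lev (S i)).
  assert (E : 0 < 2 ^ J * exp (INR N)) by (apply Rmult_lt_0_compat; [apply pow_lt; lra|apply exp_pos]).
  assert (G : F i k * m * exp (L l) <= 2 ^ J * exp (INR N)).
  { assert (Hfm : 0 <= F i k * m) by now apply Rmult_le_pos.
    destruct (Nat.eq_dec k (lab i)) as [Ek|Ek].
    - assert (HF := form_value_cur i). rewrite <- Ek in HF.
      assert (E2 : 2 ^ i * exp (INR N) <= 2 ^ J * exp (INR N)).
      { apply Rmult_le_compat_r; [left; apply exp_pos|]. apply Rle_pow; [lra|lia]. }
      assert (HL : exp (L l) <= A i l).
      { unfold levels. destruct (Nat.eqb_spec l (lab i)); [congruence|].
        now apply (sz_bounds _ _ _ HS). }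
      apply Rle_trans with (F i k * m * A i l); [now apply Rmult_le_compat_l|].
      apply (Rmult_le_reg_r (A i k * P i)); [now apply Rmult_lt_0_compat|].
      apply Rle_trans with ((F i k * P i) * (m * (A i l * A i k))); [right; ring|].
      apply Rle_trans with ((2 ^ i * exp (INR N) * A i k) * P i).
      + apply Rmult_le_compat; try lra; apply Rmult_le_pos; try lra.
        left; now apply Rmult_lt_0_compat.
      + rewrite <- Rmult_assoc. apply Rmult_le_compat_r; [lra|]. apply Rmult_le_compat_r; lra.
    - assert (HF := form_value_other i J k Hk Ek (Huse k Hk)).
      assert (Hi := szprod_incr _ _ _ HS i).
      set (K := 2 ^ J * exp (INR N)) in *.
      assert (G1 : F i k * m * A i l * P (S i) <= K * P i).
      { apply (Rmult_le_reg_r (A i k)); [exact Ak|].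
        apply Rle_trans with ((F i k * P (S i)) * (m * (A i l * A i k))); [right; ring|].
        apply Rle_trans with ((K * A i k) * P i); [|right; ring].
        apply Rmult_le_compat; try lra; apply Rmult_le_pos; try lra.
        left; now apply Rmult_lt_0_compat. }
      destruct (Nat.eq_dec l (lab i)) as [El|El].
      + assert (HP := szprod_S _ _ _ HS i). rewrite <- El in HP.
        assert (HL : exp (L l) <= A (S i) l).
        { eapply Rle_trans; [apply exp_le, levels_le; exact Hl|]. now apply (sz_bounds _ _ _ HS). }
        apply Rle_trans with (F i k * m * A (S i) l); [now apply Rmult_le_compat_l|].
        apply (Rmult_le_reg_r (P i)); [exact Hp|].
        apply Rle_trans with (F i k * m * (P i * A (S i) l)); [right; ring|].
        rewrite <- HP. lra.
      + assert (HL : exp (L l) <= A i l).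
        { unfold levels. destruct (Nat.eqb_spec l (lab i)); [congruence|].
          now apply (sz_bounds _ _ _ HS). }
        apply Rle_trans with (F i k * m * A i l); [now apply Rmult_le_compat_l|].
        apply (Rmult_le_reg_r (P (S i))); [exact Hp'|].
        eapply Rle_trans; [exact G1|]. apply Rmult_le_compat_l; lra. }
  rewrite exp_Ropp. assert (X := exp_pos (L l)).
  apply (Rmult_le_reg_r (exp (L l))); [exact X|].
  rewrite (Rmult_assoc (2 ^ J * exp (INR N))), Rinv_l by lra. lra.
Qed.

(** Expanding [u] in the points, with [u 0 = 1], turns the error of [y l] into the sum over [k] of
    [F k] times the two-by-two minor of [y l] and [y k]. *)
Lemma point_bound l t : (l < N)%nat -> (t < N)%nat ->
  Rabs (y i l t - y i l 0 * u t) <= INR N * (2 ^ J * exp (INR N)) * exp (- L l).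
Proof.
  intros Hl Ht.
  assert (E1 : 1 = sumN N (fun k => F i k * y i k 0)).
  { rewrite <- limit_point_0. apply (expand_in_points _ _ _ HS i u 0); lia. }
  assert (Et : u t = sumN N (fun k => F i k * y i k t)).
  { apply (expand_in_points _ _ _ HS i u t); lia. }
  replace (y i l t - y i l 0 * u t) with
    (sumN N (fun k => F i k * (y i l t * y i k 0 - y i l 0 * y i k t))).
  - eapply Rle_trans; [apply sumN_abs|].
    rewrite Rmult_assoc, <- sumN_const. apply sumN_le. intros k Hk.
    rewrite Rabs_mult, (Rabs_pos_eq (F i k)) by now apply form_value_nonneg.
    destruct (Nat.eq_dec l k) as [->|E]; [|now apply value_minor_bound].
    replace (y i k t * y i k 0 - y i k 0 * y i k t) with 0 by ring. rewrite Rabs_R0, Rmult_0_r.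
    left. apply Rmult_lt_0_compat; [|apply exp_pos].
    apply Rmult_lt_0_compat; [apply pow_lt; lra|apply exp_pos].
  - rewrite (sumN_ext _ _ (fun k => y i l t * (F i k * y i k 0) + - y i l 0 * (F i k * y i k t)))
      by (intros; ring).
    rewrite sumN_plus, !sumN_scal, <- E1, <- Et. ring.
Qed.

End Stage.

End Limit.

(** * From levels to exponents *)

(** With [q] the sum of the levels, [f l] has length about [exp (L l)] in the norm
    [max(|x|, exp q |x.u|)], and the [y l] form the dual basis of the lattice of integer points. *)
Definition adapted (n : nat) (u : vec) (L : nat -> R) (K : R) : Prop :=
  exists y f : nat -> nat -> Z,
  (forall l k, (l <= n)%nat -> (k <= n)%nat ->
     sumN (S n) (fun t => IZR (f l t) * IZR (y k t)) = kron l k) /\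
  (forall t s, (t <= n)%nat -> (s <= n)%nat ->
     sumN (S n) (fun l => IZR (y l t) * IZR (f l s)) = kron t s) /\
  (forall l t, (l <= n)%nat -> (t <= n)%nat -> Rabs (IZR (f l t)) <= K * exp (L l)) /\
  (forall l, (l <= n)%nat ->
     Rabs (sumN (S n) (fun t => IZR (f l t) * u t)) <= K * exp (L l) * exp (- sumN (S n) L)) /\
  (forall l, (l <= n)%nat -> Rabs (IZR (y l 0%nat)) <= K * exp (- L l) * exp (sumN (S n) L)) /\
  (forall l t, (l <= n)%nat -> (t <= n)%nat ->
     Rabs (IZR (y l t) - IZR (y l 0%nat) * u t) <= K * exp (- L l)).

Lemma ln3_lt_2 : ln 3 < 2.
Proof.
  rewrite <- (ln_exp 2). apply ln_increasing; [lra|].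
  replace 2 with (1 + 1) by ring. rewrite exp_plus.
  generalize (exp_ineq1 1); intros; nra.
Qed.

Lemma pow_le_exp (x c : R) (k : nat) : 0 < x -> ln x <= c -> x ^ k <= exp (c * INR k).
Proof.
  intros Hx Hc. rewrite <- Rpower_pow by exact Hx. unfold Rpower.
  apply exp_le. rewrite Rmult_comm. apply Rmult_le_compat_r; [apply pos_INR|exact Hc].
Qed.

(** The exponent [5 * INR (S n) * (INR J + 1)] absorbs the constants [3 ^ J], [N * 2 ^ J * exp N]
    and [exp (N * J * ln 3)] of section [Stage], where [N = S n]. *)
Lemma stage_adapted (n : nat) lab lev (HS : schedule (S n) lab lev) C
    (HC : forall j, INR j * ln 8 <= sumN (S n) (lev j) + C) (i J : nat) (s : R) :
  (forall l, (l <= n)%nat -> exists j, (i < j <= J)%nat /\ lab j = l) ->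
  lev i (lab i) <= s <= lev (S i) (lab i) ->
  adapted n (limit_point (S n) lab lev HS C HC) (levels lab lev i s)
    (exp (5 * INR (S n) * (INR J + 1))).
Proof.
  intros Huse' Hs.
  assert (Huse : forall l, (l < S n)%nat -> exists j, (i < j <= J)%nat /\ lab j = l)
    by (intros; apply Huse'; lia).
  exists (pts (run lab lev i)), (forms (run lab lev i)).
  assert (N1 : 1 <= INR (S n)) by (apply (le_INR 1); lia).
  assert (J0 := pos_INR J). assert (L3 := ln3_lt_2).
  assert (NJ : INR J <= INR (S n) * INR J) by (rewrite <- (Rmult_1_l (INR J)) at 1; apply Rmult_le_compat_r; lra).
  assert (Hge : forall z, z <= 5 * INR (S n) * (INR J + 1) -> exp z <= exp (5 * INR (S n) * (INR J + 1)))
    by (intros; now apply exp_le).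
  assert (K3 : 3 ^ J <= exp (5 * INR (S n) * (INR J + 1))).
  { eapply Rle_trans; [apply pow_le_exp with (c := 2); lra|]. apply Hge. lra. }
  assert (K2 : INR (S n) * (2 ^ J * exp (INR (S n))) <= exp (5 * INR (S n) * (INR J + 1))).
  { apply Rle_trans with (exp (INR (S n)) * (exp (1 * INR J) * exp (INR (S n)))).
    - apply Rmult_le_compat; [lra| | |].
      + apply Rmult_le_pos; [apply pow_le; lra|left; apply exp_pos].
      + generalize (exp_ineq1_le (INR (S n))); lra.
      + apply Rmult_le_compat_r; [left; apply exp_pos|]. apply pow_le_exp; [lra|].
        rewrite <- (ln_exp 1). apply ln_le; [lra|]. generalize (exp_ineq1 1); lra.
    - rewrite <- !exp_plus. apply Hge. lra. }
  assert (K2' : 2 ^ J * exp (INR (S n)) <= exp (5 * INR (S n) * (INR J + 1))).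
  { eapply Rle_trans; [|exact K2]. rewrite <- (Rmult_1_l (2 ^ J * exp (INR (S n)))) at 1.
    apply Rmult_le_compat_r; [|lra].
    apply Rmult_le_pos; [apply pow_le; lra|left; apply exp_pos]. }
  split; [|split; [|split; [|split; [|split]]]].
  - intros l k Hl Hk. apply (dual_forms_points _ _ _ HS i l k); lia.
  - intros t k Ht Hk. apply (dual_points_forms _ _ _ HS i t k); lia.
  - intros l t Hl Ht.
    eapply Rle_trans; [apply (form_bound _ _ _ HS i J s Huse Hs l t); lia|].
    apply Rmult_le_compat_r; [left; apply exp_pos|exact K3].
  - intros l Hl.
    assert (F0 := form_value_nonneg _ _ _ HS C HC i l ltac:(lia)).
    assert (F1 := form_value_bound _ _ _ HS C HC i J s Huse Hs l ltac:(lia)).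
    unfold form_value, fm in F0, F1. rewrite Rabs_pos_eq by exact F0.
    eapply Rle_trans; [exact F1|]. unfold Rminus. rewrite exp_plus, <- Rmult_assoc.
    apply Rmult_le_compat_r; [left; apply exp_pos|].
    apply Rmult_le_compat_r; [left; apply exp_pos|exact K2'].
  - intros l Hl.
    assert (F0 := pt_nonneg _ _ _ HS i l 0).
    assert (F1 := point_bound_0 _ _ _ HS i J s Huse Hs l ltac:(lia)).
    unfold pt in F0, F1. rewrite Rabs_pos_eq by exact F0.
    eapply Rle_trans; [exact F1|]. unfold Rminus. rewrite exp_plus.
    rewrite (Rmult_comm (exp (sumN _ _))), <- Rmult_assoc.
    apply Rmult_le_compat_r; [left; apply exp_pos|].
    apply Rmult_le_compat_r; [left; apply exp_pos|]. apply Hge.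
    assert (INR (S n) * INR J * ln 3 <= INR (S n) * INR J * 2) by (apply Rmult_le_compat_l; lra). lra.
  - intros l t Hl Ht.
    eapply Rle_trans; [apply (point_bound _ _ _ HS C HC i J s Huse Hs l t); lia|].
    apply Rmult_le_compat_r; [left; apply exp_pos|exact K2].
Qed.

Lemma vnorm_ge1 (n : nat) (u : vec) : u 0%nat = 1 -> 1 <= vnorm n u.
Proof.
  intros H. unfold vnorm. rewrite <- sqrt_1 at 1. apply sqrt_le_1_alt.
  replace 1 with (u 0%nat ^ 2) by (rewrite H; ring).
  apply (sumR_map_In (fun i => u i ^ 2)); [intros; apply pow2_ge_0|apply in_seq; lia].
Qed.

(** One error term for both directions: the first logarithm comes from [not_approx_of_adapted], the
    second from [approx_of_adapted], and the last summand from at most [S n] factors [exp kappa]. *)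
Definition loss (n : nat) (u : vec) (kappa : R) : R :=
  ln (INR (S n) ^ S n * (vnorm n u + 1)) +
  ln (2 ^ S n * (INR (fact (S (S n))) * (1 + sumN (S n) (fun t => Rabs (u t))))) +
  INR (S n) * kappa.

Lemma loss_terms (n : nat) (u : vec) : u 0%nat = 1 ->
  1 <= INR (S n) ^ S n * (vnorm n u + 1) /\
  1 <= 2 ^ S n * (INR (fact (S (S n))) * (1 + sumN (S n) (fun t => Rabs (u t)))).
Proof.
  intros Hu. assert (V := vnorm_ge1 n u Hu).
  assert (N1 : 1 <= INR (S n)) by (apply (le_INR 1); lia).
  assert (P1 : 1 <= INR (S n) ^ S n) by now apply pow_R1_Rle.
  assert (P2 : 1 <= 2 ^ S n) by (apply pow_R1_Rle; lra).
  assert (P3 : 1 <= INR (fact (S (S n)))) by (apply (le_INR 1); generalize (lt_O_fact (S (S n))); lia).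
  assert (P4 : 0 <= sumN (S n) (fun t => Rabs (u t))) by (apply sumN_nonneg; intros; apply Rabs_pos).
  split; [nra|]. set (x := INR (fact _)) in *. set (z := sumN _ _) in *.
  assert (1 <= x * (1 + z)) by nra. nra.
Qed.

(** The choice [Q = exp (q / (1 + w))] balances the two conditions: [h <= Q] says that
    [exp (- q) * h] is at most [exp (- w q / (1 + w))], the bound imposed on [h * d]. These are the
    two summands of [wedge_norm_lower_exp], and their sum would be too small for an integer. *)
Lemma not_approx_of_adapted (n : nat) (u : vec) (L : nat -> R) (kappa w T : R) (j : nat) :
  u 0%nat = 1 -> 0 <= kappa -> -1 < w -> (j <= n)%nat ->
  adapted n u L (exp kappa) ->
  (forall I, NoDup I -> length I = (j + 1)%nat -> (forall l, In l I -> (l <= n)%nat) ->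
     sumR (map L I) <= T) ->
  T + loss n u kappa < w * sumN (S n) L / (1 + w) ->
  ~ approx n u j w (exp (sumN (S n) L / (1 + w))).
Proof.
  intros Hu Hk Hw Hj (y & f & D1 & D2 & B1 & B2 & _ & _) HT Hlt
    (V & HV & Hdim & h & d & (xs & HZ & ->) & (bs & Hbs & ->) & Hh & Hhd).
  destruct (Minors.wedge_norm_basis_change n u V xs bs HV HZ Hbs) as (Hlen & Hind & Heq).
  destruct (loss_terms n u Hu) as [P1 P2].
  set (q := sumN (S n) L) in *.
  assert (Hk1 : length xs = (j + 1)%nat).
  { destruct Hdim as (cs & Hc & Hcb).
    destruct (Minors.wedge_norm_basis_change n u V xs cs HV HZ Hcb) as (E & _). lia. }
  assert (Vn := vnorm_ge1 n u Hu).
  rewrite Heq in Hhd.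
  assert (Hint : List.Forall (integer_vec n) xs) by apply HZ.
  assert (low := Minors.wedge_norm_lower_exp n xs u f y L q (exp kappa) T Hint Hind Hu).
  assert (H1 : 1 <= (INR (S n) * exp kappa) ^ length xs * exp T *
       (wedge_norm n (u :: xs) + exp (- q) * wedge_norm n xs)).
  { apply low.
    - intros l k Hl Hk'. exact (D1 l k Hl Hk').
    - left; apply exp_pos.
    - exact B1.
    - exact B2.
    - intros I H H' H''. apply HT; auto; lia. }
  clear low. rewrite Hk1 in H1.
  unfold Rpower in Hhd. rewrite ln_exp in Hhd.
  assert (Eq1 : - w * (q / (1 + w)) = - (w * q / (1 + w))) by (field; lra).
  assert (Eq2 : - q + q / (1 + w) = - (w * q / (1 + w))) by (field; lra).
  rewrite Eq1 in Hhd. set (Y := exp (- (w * q / (1 + w)))) in *.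
  assert (HY : 0 < Y) by apply exp_pos.
  assert (W1 : wedge_norm n (u :: xs) <= vnorm n u * Y).
  { apply (Rmult_le_reg_r (/ vnorm n u)); [apply Rinv_0_lt_compat; lra|].
    replace (vnorm n u * Y * / vnorm n u) with Y by (field; lra). exact Hhd. }
  assert (W2 : exp (- q) * wedge_norm n xs <= Y).
  { unfold Y. rewrite <- Eq2, exp_plus. apply Rmult_le_compat_l; [left; apply exp_pos|exact Hh]. }
  assert (N1 : 1 <= INR (S n)) by (apply (le_INR 1); lia).
  assert (Hpow : (INR (S n) * exp kappa) ^ (j + 1) <= INR (S n) ^ S n * exp (kappa * INR (S n))).
  { rewrite Rpow_mult_distr. apply Rmult_le_compat.
    - apply pow_le; lra.
    - apply pow_le; left; apply exp_pos.
    - apply Rle_pow; [exact N1|lia].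
    - eapply Rle_trans; [apply pow_le_exp with (c := kappa); [apply exp_pos|rewrite ln_exp; lra]|].
      apply exp_le. apply Rmult_le_compat_l; [exact Hk|]. apply le_INR; lia. }
  assert (H2 : 1 <= INR (S n) ^ S n * exp (kappa * INR (S n)) * exp T * ((vnorm n u + 1) * Y)).
  { eapply Rle_trans; [exact H1|]. apply Rmult_le_compat.
    - apply Rmult_le_pos; [|left; apply exp_pos]. apply pow_le.
      apply Rmult_le_pos; [lra|left; apply exp_pos].
    - generalize (wedge_norm_nonneg n (u :: xs)) (wedge_norm_nonneg n xs) (exp_pos (- q)).
      intros; nra.
    - apply Rmult_le_compat_r; [left; apply exp_pos|exact Hpow].
    - lra. }
  assert (H3 : 1 <= exp (loss n u kappa + T - w * q / (1 + w))).
  { eapply Rle_trans; [exact H2|].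
    replace (INR (S n) ^ S n * exp (kappa * INR (S n)) * exp T * ((vnorm n u + 1) * Y)) with
      ((INR (S n) ^ S n * (vnorm n u + 1)) * (exp (kappa * INR (S n)) * exp T * Y)) by ring.
    unfold Y. rewrite <- !exp_plus.
    rewrite <- (exp_ln (INR (S n) ^ S n * (vnorm n u + 1))) by lra.
    rewrite <- exp_plus. apply exp_le. unfold loss.
    assert (0 <= ln (2 ^ S n * (INR (fact (S (S n))) * (1 + sumN (S n) (fun t : nat => Rabs (u t)))))).
    { rewrite <- ln_1. apply ln_le; lra. }
    lra. }
  assert (exp (loss n u kappa + T - w * q / (1 + w)) < exp 0) by (apply exp_increasing; lra).
  rewrite exp_0 in H. lra.
Qed.

(** * Lattices spanned by part of a dual basis *)

Section DualBasis.
Context (n : nat) (y f : nat -> nat -> Z).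
Context (Hdual : forall l k, (l <= n)%nat -> (k <= n)%nat ->
     sumN (S n) (fun t => IZR (f l t) * IZR (y k t)) = kron l k).

Let pv (l : nat) : vec := fun t => IZR (y l t).

Lemma form_lincomb l (cs : list R) (I : list nat) :
  (l <= n)%nat -> (forall k, In k I -> (k <= n)%nat) ->
  sumN (S n) (fun t => IZR (f l t) * lincomb cs (map pv I) t) =
  sumR (map (fun p => fst p * kron l (snd p)) (combine cs I)).
Proof.
  intros Hl; revert cs; induction I as [|k I IH]; intros [|c cs] HI;
    try (simpl; rewrite (sumN_ext _ _ (fun _ => 0)) by (intros; unfold lincomb; simpl; ring);
         rewrite sumN_const; ring).
  simpl. rewrite <- IH by (intros; apply HI; now right).
  rewrite <- (Hdual l k Hl (HI k (or_introl eq_refl))), <- sumN_scal, <- sumN_plus.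
  apply sumN_ext; intros t _. unfold lincomb; simpl. unfold pv at 1. ring.
Qed.

Lemma sum_kron_notin l (cs : list R) (I : list nat) : ~ In l I ->
  sumR (map (fun p => fst p * kron l (snd p)) (combine cs I)) = 0.
Proof.
  revert cs; induction I as [|k I IH]; intros [|c cs] H; simpl; try reflexivity.
  rewrite IH by (intros H'; apply H; now right).
  rewrite kron_neq by (intros ->; apply H; now left). ring.
Qed.

Lemma sum_kron_nth a (cs : list R) (I : list nat) : NoDup I -> length cs = length I ->
  (a < length I)%nat ->
  sumR (map (fun p => fst p * kron (nth a I 0%nat) (snd p)) (combine cs I)) = nth a cs 0.
Proof.
  revert a cs; induction I as [|k I IH]; intros a [|c cs] HN Hl Ha; simpl in *; try lia.
  inversion HN as [|? ? Hk HN']; subst. destruct a as [|a].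
  - rewrite kron_refl, sum_kron_notin by exact Hk. ring.
  - rewrite IH by (auto; lia). rewrite kron_neq; [ring|].
    intros E; apply Hk; rewrite <- E; apply nth_In; lia.
Qed.

Lemma coefficient_of_lincomb (I : list nat) (cs : list R) a : NoDup I ->
  (forall k, In k I -> (k <= n)%nat) -> length cs = length I -> (a < length I)%nat ->
  nth a cs 0 = sumN (S n) (fun t => IZR (f (nth a I 0%nat) t) * lincomb cs (map pv I) t).
Proof.
  intros HN HI Hl Ha. rewrite form_lincomb by (auto; apply HI, nth_In; exact Ha).
  now rewrite sum_kron_nth.
Qed.

Lemma dual_lin_indep (I : list nat) : NoDup I -> (forall k, In k I -> (k <= n)%nat) ->
  lin_indep n (map pv I).
Proof.
  intros HN HI cs Hl H0. rewrite length_map in Hl.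
  apply Forall_nth. intros a d Ha. rewrite (nth_indep _ d 0) by exact Ha.
  rewrite (coefficient_of_lincomb I cs a) by (auto; lia).
  rewrite (sumN_ext _ _ (fun _ => 0)), sumN_const; [ring|].
  intros t Ht; rewrite H0 by lia; ring.
Qed.

Lemma sumN_integer (N : nat) (g : nat -> R) :
  (forall t, (t < N)%nat -> exists z : Z, g t = IZR z) -> exists z : Z, sumN N g = IZR z.
Proof.
  intros H; induction N as [|N IH]; [now exists 0%Z|].
  destruct IH as [z Hz]; [intros; apply H; lia|]. destruct (H N ltac:(lia)) as [z' Hz'].
  exists (z + z')%Z. rewrite sumN_S, plus_IZR, Hz, Hz'; reflexivity.
Qed.

Lemma integer_list (cs : list R) : (forall a, (a < length cs)%nat -> exists z : Z, nth a cs 0 = IZR z) ->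
  exists zs, length zs = length cs /\ cs = map IZR zs.
Proof.
  induction cs as [|c cs IH]; intros H; [now exists nil|].
  destruct (H 0%nat ltac:(simpl; lia)) as [z Hz].
  destruct IH as (zs & E1 & E2); [intros a Ha; apply (H (S a)); simpl; lia|].
  exists (z :: zs); simpl in *; split; congruence.
Qed.

(** The coefficients of an integral vector are its values under integral forms, hence integers. *)
Lemma dual_Z_basis (I : list nat) : NoDup I -> (forall k, In k I -> (k <= n)%nat) ->
  Z_basis n (in_span n (map pv I)) (map pv I).
Proof.
  intros HN HI. split; [|split; [|split]].
  - apply Forall_map, Forall_forall. intros l _ t _. now exists (y l t).
  - apply Forall_forall. intros x Hx. apply in_map_iff in Hx as (l & <- & Hl).
    exists (map (fun k => kron l k) I). rewrite !length_map; split; [reflexivity|].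
    intros t _. clear HI. induction I as [|k I IH]; [destruct Hl|].
    inversion HN as [|? ? Hk HN']; subst. unfold lincomb in *; simpl.
    destruct Hl as [->|Hl].
    + rewrite kron_refl. replace (sumR _) with 0; [unfold pv; ring|].
      clear IH HN HN'. induction I as [|k' I IH]; [reflexivity|]. simpl.
      rewrite kron_neq by (intros ->; apply Hk; now left).
      rewrite <- IH by (intros H; apply Hk; now right). ring.
    + rewrite kron_neq by (intros ->; contradiction). rewrite <- IH by assumption. ring.
  - intros cs Hl H0. apply Forall_forall. intros z Hz.
    assert (HF := dual_lin_indep I HN HI (map IZR cs)).
    rewrite length_map in HF. specialize (HF Hl H0).
    rewrite Forall_forall in HF. apply eq_IZR. apply HF, in_map, Hz.
  - intros v (cs & Hl & Hv) Hint. rewrite length_map in Hl.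
    destruct (integer_list cs) as (zs & E1 & E2).
    + intros a Ha. rewrite (coefficient_of_lincomb I cs a) by (auto; lia).
      apply sumN_integer. intros t Ht. rewrite <- Hv by lia.
      destruct (Hint t ltac:(lia)) as [z Hz].
      exists (f (nth a I 0%nat) t * z)%Z. rewrite mult_IZR, Hz; reflexivity.
    + exists zs. rewrite length_map. split; [congruence|]. intros t Ht. rewrite <- E2. now apply Hv.
Qed.

End DualBasis.

(** The subspace is the span of the points [y l] with [l] in [I]. Their error vectors multiply to
    about [exp (- sum of L over I)], which bounds the product with [u], and the height is larger by
    at most [exp q]. The same [Q] as in [not_approx_of_adapted] makes both conditions read alike. *)
Lemma approx_of_adapted (n : nat) (u : vec) (L : nat -> R) (kappa w : R) (j : nat) (I : list nat) :
  u 0%nat = 1 -> 0 <= kappa -> -1 < w -> (j <= n)%nat -> 0 <= sumN (S n) L ->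
  adapted n u L (exp kappa) ->
  NoDup I -> length I = (j + 1)%nat -> (forall l, In l I -> (l <= n)%nat) ->
  w * sumN (S n) L / (1 + w) + loss n u kappa <= sumR (map L I) ->
  approx n u j w (exp (sumN (S n) L / (1 + w))).
Proof.
  intros Hu Hk Hw Hj Hq (y & f & D1 & D2 & _ & _ & B1 & B2) HN HI HIn Hle.
  set (q := sumN (S n) L) in *.
  destruct (loss_terms n u Hu) as [P1 P2].
  set (U := 1 + sumN (S n) (fun t => Rabs (u t))) in *.
  assert (HU : 1 <= U).
  { assert (0 <= sumN (S n) (fun t => Rabs (u t))) by (apply sumN_nonneg; intros; apply Rabs_pos).
    unfold U; lra. }
  assert (HuU : forall t, (t <= n)%nat -> Rabs (u t) <= U).
  { intros t Ht. assert (Rabs (u t) <= sumN (S n) (fun t => Rabs (u t))); [|unfold U; lra].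
    apply (sumR_map_In (fun t => Rabs (u t))); [intros; apply Rabs_pos|apply in_seq; lia]. }
  set (xs := map (fun l t => IZR (y l t)) I).
  destruct (Minors.wedge_norm_upper_exp n I u y L q (exp kappa) U HU Hq HuU) as [W1 W2].
  { intros l Hl; apply B1; auto. }
  { intros l t Hl Ht; apply B2; auto. }
  fold xs in W1, W2. rewrite HI in W1, W2.
  set (B := 2 ^ S n * _) in W1, W2.
  assert (HB : B <= exp (- (w * q / (1 + w)))).
  { apply Rle_trans with ((2 ^ S n * (INR (fact (S (S n))) * U)) * (exp (kappa * INR (S n)) * exp (- sumR (map L I)))).
    - unfold B. rewrite !Rmult_assoc. apply Rmult_le_compat_l; [apply pow_le; lra|].
      apply Rmult_le_compat.
      + apply pos_INR.
      + apply Rmult_le_pos; [lra|]. apply Rmult_le_pos; [|left; apply exp_pos].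
        apply pow_le; left; apply exp_pos.
      + apply le_INR, fact_le; lia.
      + apply Rmult_le_compat_l; [lra|]. apply Rmult_le_compat_r; [left; apply exp_pos|].
        eapply Rle_trans; [apply pow_le_exp with (c := kappa); [apply exp_pos|rewrite ln_exp; lra]|].
        apply exp_le. apply Rmult_le_compat_l; [exact Hk|]. apply le_INR; lia.
    - rewrite <- (exp_ln (2 ^ S n * (INR (fact (S (S n))) * U))) by lra.
      rewrite <- !exp_plus. apply exp_le. unfold loss in Hle. fold U in Hle.
      assert (0 <= ln (INR (S n) ^ S n * (vnorm n u + 1))) by (rewrite <- ln_1; apply ln_le; lra).
      lra. }
  assert (Eq1 : - w * (q / (1 + w)) = - (w * q / (1 + w))) by (field; lra).
  assert (Eq2 : q / (1 + w) = - (w * q / (1 + w)) + q) by (field; lra).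
  assert (Vn := vnorm_ge1 n u Hu).
  exists (in_span n xs). split; [|split].
  - exists xs. split; [|tauto]. apply Forall_map, Forall_forall. intros l _ t _.
    exists (inject_Z (y l t)). unfold Q2R, inject_Z; simpl. field.
  - exists xs. split; [unfold xs; now rewrite length_map|].
    split; [|tauto]. now apply (dual_lin_indep n y f).
  - exists (wedge_norm n xs), (wedge_norm n (u :: xs) / (vnorm n u * wedge_norm n xs)).
    split; [|split; [|split]].
    + exists xs. split; [|reflexivity]. now apply (dual_Z_basis n y f).
    + exists xs. split; [|reflexivity]. split; [|tauto]. now apply (dual_lin_indep n y f).
    + eapply Rle_trans; [exact W1|]. rewrite Eq2, exp_plus.
      apply Rmult_le_compat_r; [left; apply exp_pos|exact HB].
    + unfold Rpower. rewrite ln_exp, Eq1.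
      apply Rle_trans with (wedge_norm n (u :: xs)); [|lra].
      assert (X0 := wedge_norm_nonneg n (u :: xs)).
      destruct (wedge_norm_nonneg n xs) as [X|X].
      * apply Rle_trans with (wedge_norm n (u :: xs) / vnorm n u).
        { right. field. lra. }
        apply (Rmult_le_reg_r (vnorm n u)); [lra|].
        replace (wedge_norm n (u :: xs) / vnorm n u * vnorm n u) with (wedge_norm n (u :: xs)) by (field; lra).
        nra.
      * rewrite <- X at 1. rewrite Rmult_0_l. exact X0.
Qed.

(** If an integral form [a] vanishes at [u], its value at [y l] equals its value at the error vector
    of [y l]. This is an integer of absolute value below 1, so [a] vanishes on the whole basis. *)
Lemma adapted_Q_indep (n : nat) (u : vec) :
  u 0%nat = 1 ->
  (forall eps, 0 < eps -> exists L K, adapted n u L K /\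
     forall l, (l <= n)%nat -> K * exp (- L l) <= eps) ->
  Q_indep_coords n u.
Proof.
  intros Hu H c Hc.
  destruct (Minors.integer_multiple_nonzero n (fun i => Q2R (c i))) as (d & Hd & Hint).
  { intros i _; now exists (c i). }
  set (a := fun t => d * Q2R (c t)).
  assert (Ha0 : sumN (S n) (fun t => a t * u t) = 0).
  { rewrite (sumN_ext _ _ (fun t => d * (Q2R (c t) * u t))) by (intros; unfold a; ring).
    rewrite sumN_scal. unfold sumN. rewrite Hc; ring. }
  set (M := sumN (S n) (fun t => Rabs (a t))).
  assert (HM : 0 <= M) by (apply sumN_nonneg; intros; apply Rabs_pos).
  destruct (H (/ (M + 1))) as (L & K & (y & f & D1 & D2 & _ & _ & _ & B2) & HK).
  { apply Rinv_0_lt_compat; lra. }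
  assert (Hz : forall l, (l <= n)%nat -> sumN (S n) (fun t => a t * IZR (y l t)) = 0).
  { intros l Hl.
    destruct (sumN_integer (S n) (fun t => a t * IZR (y l t))) as [z Hz].
    { intros t Ht. destruct (Hint t ltac:(lia)) as [z Hz]. exists (z * y l t)%Z.
      rewrite mult_IZR. unfold a. rewrite Hz; reflexivity. }
    assert (Hlt : Rabs (IZR z) < 1).
    { rewrite <- Hz.
      replace (sumN (S n) (fun t => a t * IZR (y l t))) with
        (sumN (S n) (fun t => a t * (IZR (y l t) - IZR (y l 0%nat) * u t))).
      - eapply Rle_lt_trans; [apply sumN_abs|].
        apply Rle_lt_trans with (sumN (S n) (fun t => / (M + 1) * Rabs (a t))).
        + apply sumN_le. intros t Ht. rewrite Rabs_mult, Rmult_comm.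
          apply Rmult_le_compat_r; [apply Rabs_pos|].
          eapply Rle_trans; [apply B2; lia|]. apply HK; exact Hl.
        + rewrite sumN_scal. fold M. apply (Rmult_lt_reg_l (M + 1)); [lra|].
          rewrite <- Rmult_assoc, Rinv_r by lra. lra.
      - rewrite (sumN_ext _ _ (fun t => a t * IZR (y l t) + - IZR (y l 0%nat) * (a t * u t)))
          by (intros; ring).
        rewrite sumN_plus, sumN_scal, Ha0; ring. }
    rewrite Hz. rewrite <- abs_IZR in Hlt. apply lt_IZR in Hlt. f_equal. lia. }
  intros s Hs.
  assert (Es : a s = 0).
  { rewrite <- (sumN_kron (S n) s a) by lia.
    rewrite (sumN_ext _ _ (fun t => sumN (S n) (fun l => IZR (f l s) * (a t * IZR (y l t))))).
    - rewrite sumN_exchange.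
      rewrite (sumN_ext _ _ (fun _ => 0)), sumN_const; [ring|].
      intros l Hl. rewrite sumN_scal, Hz by lia. ring.
    - intros t Ht. rewrite <- (D2 t s) by lia.
      rewrite Rmult_comm, <- sumN_scal. apply sumN_ext; intros; ring. }
  unfold a in Es. apply Rmult_integral in Es as [Es|Es]; [contradiction|].
  apply eqR_Qeq. rewrite Es. unfold Q2R; simpl; lra.
Qed.

(** * The trajectory *)

(** Number of [o' < o] congruent to [l] modulo [g]. *)
Definition turns (o g l : nat) : nat := (o / g + if l <? o mod g then 1 else 0)%nat.

Lemma turns_S (o g l : nat) : (l < g)%nat ->
  turns (S o) g l = (turns o g l + if l =? o mod g then 1 else 0)%nat.
Proof.
  intros Hl. unfold turns.
  assert (E := Nat.div_mod_eq o g). assert (Hm := Nat.mod_upper_bound o g ltac:(lia)).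
  destruct (Nat.eq_dec (S (o mod g)) g) as [Hg|Hg].
  - assert (D : (S o / g = S (o / g))%nat).
    { symmetry. apply (Nat.div_unique (S o) g (S (o / g)) 0); lia. }
    assert (M : (S o mod g = 0)%nat).
    { symmetry. apply (Nat.mod_unique (S o) g (S (o / g)) 0); lia. }
    rewrite D, M. destruct (Nat.ltb_spec l 0), (Nat.ltb_spec l (o mod g)), (Nat.eqb_spec l (o mod g)); lia.
  - assert (D : (S o / g = o / g)%nat).
    { symmetry. apply (Nat.div_unique (S o) g (o / g) (S (o mod g))); lia. }
    assert (M : (S o mod g = S (o mod g))%nat).
    { symmetry. apply (Nat.mod_unique (S o) g (o / g) (S (o mod g))); lia. }
    rewrite D, M. destruct (Nat.ltb_spec l (S (o mod g))), (Nat.ltb_spec l (o mod g)), (Nat.eqb_spec l (o mod g)); lia.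
Qed.

Lemma turns_bounds (o g l : nat) : (o / g <= turns o g l <= o / g + 1)%nat.
Proof. unfold turns; destruct (l <? o mod g); lia. Qed.

Lemma turns_1 (o : nat) : turns o 1 0 = o.
Proof. unfold turns. rewrite Nat.mod_1_r, Nat.div_1_r; simpl; lia. Qed.

Lemma turns_mul (s g l : nat) : (0 < g)%nat -> turns (g * s) g l = s.
Proof.
  intros Hg. unfold turns. rewrite (Nat.mul_comm g s), Nat.Div0.mod_mul, Nat.div_mul by lia.
  simpl; lia.
Qed.

Lemma turns_0 (g l : nat) : (0 < g)%nat -> turns 0 g l = 0%nat.
Proof. intros Hg. rewrite <- (turns_mul 0 g l Hg) at 2. now rewrite Nat.mul_0_r. Qed.

Lemma turns_le (o s g l : nat) : (l < g)%nat -> (o <= g * s)%nat -> (turns o g l <= s)%nat.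
Proof.
  intros Hl H. rewrite <- (turns_mul s g l) by lia.
  clear -Hl H. induction H as [|m H IH]; [lia|]. rewrite turns_S by exact Hl. lia.
Qed.

Lemma mod_succ_neq (o g : nat) : (2 <= g)%nat -> (S o mod g <> o mod g)%nat.
Proof.
  intros Hg E. assert (E1 := Nat.div_mod_eq o g). assert (E2 := Nat.div_mod_eq (S o) g). rewrite E in E2.
  assert ((S o / g <= o / g)%nat \/ (S o / g >= S (o / g))%nat) as [H|H] by lia; nia.
Qed.

(** An excursion [t] starts with all levels equal to [base t]. The labels below
    [tops t] then rise in turn, in [rounds] rounds, to [base t * rise t], and after them
    the other labels do the same; a group with a single label rises at once, since the same label
    cannot be used twice in a row. *)
Section Path.
Context (n : nat) (Hn : (1 <= n)%nat) (psi : nat -> R).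
Context (psi_range : forall j, (j <= n)%nat -> 0 <= psi j < 1).
Context (psi_last : psi n = 0).
Context (psi_low : forall j k, (k <= j)%nat -> (j <= n)%nat ->
  psi j * INR (n - k) <= psi k * INR (n - j)).
Context (psi_high : forall j k, (j <= k)%nat -> (k <= n)%nat ->
  (1 - psi k) * INR (S j) <= (1 - psi j) * INR (S k)).

Local Notation N := (S n).

Definition tops (t : nat) : nat := S (t mod N).
(** The ratio [r] for which [n - j] levels [c] and [j + 1] levels [c r] give the low ones the share
    [psi j] of the total; see [rise_equation]. *)
Definition slope (j : nat) : R := INR (n - j) * (1 - psi j) / (INR (S j) * psi j).
(** When [psi] vanishes no finite ratio is exact. The ratio [t + 2] makes the share of the low
    levels tend to 0, and for [t mod N = n] it makes the base at least double. *)
Definition rise (t : nat) : R :=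
  if Rlt_dec 0 (psi (t mod N)) then slope (t mod N) else INR t + 2.
Fixpoint base (t : nat) : R := match t with O => 1 | S t' => base t' * rise t' end.
(** With [(t + 1)^2] rounds a single increment is [base t * (rise t - 1) / (t + 1)^2]. As [rise t]
    grows at most linearly, this is [O(base t / (t + 1))], while the number of steps remains
    polynomial in [t]. *)
Definition rounds (t g : nat) : nat := if (g =? 1)%nat then 1%nat else (S t * S t)%nat.
Definition lenU (t : nat) : nat := (tops t * rounds t (tops t))%nat.
Definition lenB (t : nat) : nat := ((N - tops t) * rounds t (N - tops t))%nat.
Definition len (t : nat) : nat := (lenU t + lenB t)%nat.

Fixpoint loc (i : nat) : nat * nat :=
  match i with
  | O => (0, 0)%nat
  | S i' => let (t, o) := loc i' in if (S o <? len t)%nat then (t, S o) else (S t, 0%nat)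
  end.

Definition plabel (t o : nat) : nat :=
  if (o <? lenU t)%nat then (o mod tops t)%nat
  else (tops t + (o - lenU t) mod (N - tops t))%nat.

Definition plevel (t o l : nat) : R :=
  if (l <? tops t)%nat then
    base t * (1 + (rise t - 1) * (INR (turns (Nat.min o (lenU t)) (tops t) l) / INR (rounds t (tops t))))
  else
    base t * (1 + (rise t - 1) *
      (INR (turns (o - lenU t) (N - tops t) (l - tops t)) / INR (rounds t (N - tops t)))).

Definition lab (i : nat) : nat := let (t, o) := loc i in plabel t o.
Definition lev (i l : nat) : R := let (t, o) := loc i in plevel t o l.

Fixpoint first (t : nat) : nat := match t with O => 0%nat | S t' => (first t' + len t')%nat end.

Lemma tops_range t : (1 <= tops t <= N)%nat.
Proof. unfold tops. generalize (Nat.mod_upper_bound t N); lia. Qed.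

Lemma rounds_pos t g : (1 <= rounds t g)%nat.
Proof. unfold rounds; destruct (g =? 1)%nat; lia. Qed.

Lemma lenU_pos t : (tops t <= lenU t)%nat.
Proof. unfold lenU. generalize (tops_range t) (rounds_pos t (tops t)); nia. Qed.

Lemma lenB_ge t : (N - tops t <= lenB t)%nat.
Proof. unfold lenB. generalize (rounds_pos t (N - tops t)); nia. Qed.

Lemma len_pos t : (1 <= len t)%nat.
Proof. unfold len. generalize (tops_range t) (lenU_pos t); lia. Qed.

Lemma loc_lt i : (snd (loc i) < len (fst (loc i)))%nat.
Proof.
  induction i as [|i IH]; simpl; [generalize (len_pos 0); lia|].
  destruct (loc i) as [t o]; simpl in *.
  destruct (Nat.ltb_spec (S o) (len t)); simpl; [assumption|generalize (len_pos (S t)); lia].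
Qed.

Lemma loc_index i : i = (first (fst (loc i)) + snd (loc i))%nat.
Proof.
  induction i as [|i IH]; simpl; [reflexivity|].
  assert (H := loc_lt i). destruct (loc i) as [t o]; simpl in *.
  destruct (Nat.ltb_spec (S o) (len t)); simpl; lia.
Qed.

Lemma loc_first t o : (o < len t)%nat -> loc (first t + o) = (t, o).
Proof.
  revert o; induction t as [|t IHt]; intros o.
  - induction o as [|o IHo]; intros Ho; [reflexivity|].
    rewrite Nat.add_succ_r; simpl. simpl in IHo. rewrite IHo by lia.
    destruct (Nat.ltb_spec (S o) (len 0)); [reflexivity|lia].
  - induction o as [|o IHo]; intros Ho.
    + rewrite Nat.add_0_r; simpl. assert (H := len_pos t).
      replace (first t + len t)%nat with (S (first t + (len t - 1))) by lia.
      simpl. rewrite IHt by lia.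
      destruct (Nat.ltb_spec (S (len t - 1)) (len t)); [lia|reflexivity].
    + rewrite Nat.add_succ_r. cbn [loc]. rewrite IHo by lia.
      destruct (Nat.ltb_spec (S o) (len (S t))); [reflexivity|lia].
Qed.

Lemma mod_range t : (t mod N <= n)%nat.
Proof. generalize (Nat.mod_upper_bound t N); lia. Qed.

Lemma psi_le_average j : (j <= n)%nat -> psi j * INR N <= INR (n - j).
Proof.
  intros Hj. assert (H := psi_high j n Hj (Nat.le_refl _)). rewrite psi_last in H.
  rewrite minus_INR by exact Hj. rewrite !S_INR in *. lra.
Qed.

Lemma rise_equation j : (j <= n)%nat -> 0 < psi j ->
  psi j * (INR (n - j) + INR (S j) * slope j) = INR (n - j).
Proof.
  intros Hj Hp. unfold slope. rewrite S_INR. assert (H := pos_INR j). field. split; lra.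
Qed.

(** [slope j >= 1] amounts to [psi j <= (n - j) / (n + 1)], the share that the low levels have on
    the diagonal. *)
Lemma rise_ge1 t : 1 <= rise t.
Proof.
  unfold rise. destruct (Rlt_dec 0 (psi (t mod N))) as [H|H]; [|generalize (pos_INR t); lra].
  assert (Hj := mod_range t). set (j := (t mod N)%nat) in *.
  assert (E := rise_equation j Hj H). assert (A := psi_le_average j Hj).
  assert (B : INR N = INR (n - j) + INR (S j)).
  { rewrite <- plus_INR. f_equal; lia. }
  rewrite B in A. assert (J := pos_INR j). rewrite (S_INR j) in *.
  apply (Rmult_le_reg_l (psi j * (INR j + 1))); [nra|]. nra.
Qed.

Lemma rise_key t : psi (t mod N) * (INR (n - t mod N) + INR (tops t) * rise t) <= INR (n - t mod N).
Proof.
  unfold rise, tops. destruct (Rlt_dec 0 (psi (t mod N))) as [H|H].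
  - rewrite rise_equation; [lra|apply mod_range|exact H].
  - assert (P := psi_range _ (mod_range t)). replace (psi (t mod N)) with 0 by lra.
    rewrite Rmult_0_l. apply pos_INR.
Qed.

Lemma base_pos t : 0 < base t.
Proof. induction t as [|t IH]; simpl; [lra|]. generalize (rise_ge1 t); nra. Qed.

Lemma rounds_INR t g : 0 < INR (rounds t g).
Proof. apply lt_0_INR. generalize (rounds_pos t g); lia. Qed.

Lemma plevel_0 t l : (l < N)%nat -> plevel t 0 l = base t.
Proof.
  intros Hl. unfold plevel. assert (H := tops_range t).
  destruct (Nat.ltb_spec l (tops t)).
  - rewrite Nat.min_0_l, turns_0 by lia. simpl INR. unfold Rdiv; ring.
  - rewrite Nat.sub_0_l, turns_0 by lia. simpl INR. unfold Rdiv; ring.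
Qed.

Lemma plevel_top_end t o l : (l < tops t)%nat -> (lenU t <= o)%nat ->
  plevel t o l = base t * rise t.
Proof.
  intros Hl Ho. unfold plevel. destruct (Nat.ltb_spec l (tops t)); [|lia].
  rewrite Nat.min_r by exact Ho. unfold lenU. rewrite turns_mul by lia.
  field. apply Rgt_not_eq, rounds_INR.
Qed.

Lemma plevel_bottom_start t o l : (tops t <= l < N)%nat -> (o <= lenU t)%nat ->
  plevel t o l = base t.
Proof.
  intros Hl Ho. unfold plevel. destruct (Nat.ltb_spec l (tops t)); [lia|].
  replace (o - lenU t)%nat with 0%nat by lia. rewrite turns_0 by lia. simpl INR. unfold Rdiv; ring.
Qed.

Lemma plevel_end t l : (l < N)%nat -> plevel t (len t) l = base (S t).
Proof.
  intros Hl. destruct (Nat.lt_ge_cases l (tops t)).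
  - rewrite plevel_top_end; [reflexivity|exact H|unfold len; lia].
  - unfold plevel. destruct (Nat.ltb_spec l (tops t)); [lia|].
    assert (E : (len t - lenU t = lenB t)%nat) by (unfold len; lia).
    rewrite E. unfold lenB. rewrite turns_mul by lia. simpl base. field. apply Rgt_not_eq, rounds_INR.
Qed.

Lemma affine_mono t (a b : R) : a <= b ->
  base t * (1 + (rise t - 1) * a) <= base t * (1 + (rise t - 1) * b).
Proof.
  intros H. apply Rmult_le_compat_l; [left; apply base_pos|].
  apply Rplus_le_compat_l, Rmult_le_compat_l; [generalize (rise_ge1 t); lra|exact H].
Qed.

Lemma affine_frac_mono t (k k' s : nat) : (k <= k')%nat -> 0 < INR s ->
  base t * (1 + (rise t - 1) * (INR k / INR s)) <= base t * (1 + (rise t - 1) * (INR k' / INR s)).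
Proof.
  intros Hk Hs. apply affine_mono. apply Rmult_le_compat_r.
  - left; now apply Rinv_0_lt_compat.
  - now apply le_INR.
Qed.

Lemma affine_frac_range t (k s : nat) : (k <= s)%nat -> 0 < INR s ->
  base t <= base t * (1 + (rise t - 1) * (INR k / INR s)) <= base t * rise t.
Proof.
  intros Hk Hs. apply le_INR in Hk. split.
  - rewrite <- (Rmult_1_r (base t)) at 1.
    replace 1 with (1 + (rise t - 1) * 0) at 1 by ring. apply affine_mono.
    apply Rdiv_le_0_compat; [apply pos_INR|exact Hs].
  - replace (base t * rise t) with (base t * (1 + (rise t - 1) * 1)) by ring.
    apply affine_mono. apply (Rmult_le_reg_r (INR s)); [exact Hs|].
    unfold Rdiv; rewrite Rmult_assoc, Rinv_l by lra. lra.
Qed.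

Lemma plevel_range t o l : (l < N)%nat -> (o <= len t)%nat ->
  base t <= plevel t o l <= base t * rise t.
Proof.
  intros Hl Ho. unfold plevel.
  destruct (Nat.ltb_spec l (tops t)); apply affine_frac_range; try apply rounds_INR.
  - apply turns_le; [assumption|]. change (Nat.min o (lenU t) <= lenU t)%nat. lia.
  - apply turns_le; [lia|]. change (o - lenU t <= lenB t)%nat. unfold len in Ho; lia.
Qed.

Lemma loc_S i t o : loc i = (t, o) ->
  loc (S i) = (t, S o) /\ (S o < len t)%nat \/ loc (S i) = (S t, 0%nat) /\ S o = len t.
Proof.
  intros E. assert (H := loc_lt i). simpl. rewrite E in H |- *; simpl in H.
  destruct (Nat.ltb_spec (S o) (len t)); [left|right]; split; auto; lia.
Qed.

Lemma lev_S i t o l : loc i = (t, o) -> (l < N)%nat -> lev (S i) l = plevel t (S o) l.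
Proof.
  intros E Hl. unfold lev. destruct (loc_S i t o E) as [[-> _]|[-> H]]; [reflexivity|].
  rewrite H, plevel_0, plevel_end by exact Hl. reflexivity.
Qed.

Lemma plabel_lt t o : (o < len t)%nat -> (plabel t o < N)%nat.
Proof.
  intros Ho. unfold plabel. assert (H := tops_range t).
  destruct (Nat.ltb_spec o (lenU t)).
  - generalize (Nat.mod_upper_bound o (tops t)); lia.
  - assert (0 < N - tops t)%nat by (unfold len, lenB in Ho; nia).
    generalize (Nat.mod_upper_bound (o - lenU t) (N - tops t)); lia.
Qed.

Lemma plevel_S_other t o l : (o < len t)%nat -> (l < N)%nat -> l <> plabel t o ->
  plevel t (S o) l = plevel t o l.
Proof.
  intros Ho Hl. unfold plabel, plevel. assert (H := tops_range t).
  destruct (Nat.ltb_spec o (lenU t)); destruct (Nat.ltb_spec l (tops t)); intros Hne.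
  - rewrite !Nat.min_l by lia. rewrite turns_S by assumption.
    destruct (Nat.eqb_spec l (o mod tops t)); [contradiction|]. now rewrite Nat.add_0_r.
  - now replace (S o - lenU t)%nat with (o - lenU t)%nat by lia.
  - now rewrite !Nat.min_r by lia.
  - replace (S o - lenU t)%nat with (S (o - lenU t)) by lia. rewrite turns_S by lia.
    destruct (Nat.eqb_spec (l - tops t) ((o - lenU t) mod (N - tops t))); [lia|]. now rewrite Nat.add_0_r.
Qed.

Lemma plevel_S_label t o : (o < len t)%nat -> plevel t o (plabel t o) <= plevel t (S o) (plabel t o).
Proof.
  intros Ho. assert (Hl := plabel_lt t o Ho). assert (H := tops_range t).
  revert Hl. unfold plabel, plevel.
  destruct (Nat.ltb_spec o (lenU t)); intros Hl.
  - assert (o mod tops t < tops t)%nat by (apply Nat.mod_upper_bound; lia).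
    destruct (Nat.ltb_spec (o mod tops t) (tops t)); [|lia].
    rewrite !Nat.min_l by lia. apply affine_frac_mono; [|apply rounds_INR]. rewrite turns_S by assumption. lia.
  - destruct (Nat.ltb_spec (tops t + (o - lenU t) mod (N - tops t)) (tops t)); [lia|].
    replace (S o - lenU t)%nat with (S (o - lenU t)) by lia.
    apply affine_frac_mono; [|apply rounds_INR]. rewrite turns_S by lia. lia.
Qed.

Lemma plabel_S_neq t o : (S o < len t)%nat -> plabel t (S o) <> plabel t o.
Proof.
  intros Ho. assert (H := tops_range t). unfold plabel.
  destruct (Nat.ltb_spec (S o) (lenU t)); destruct (Nat.ltb_spec o (lenU t)); try lia.
  - apply mod_succ_neq. destruct (Nat.eq_dec (tops t) 1) as [E|E]; [|lia].
    unfold lenU, rounds in *. rewrite E in *; simpl in *; lia.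
  - generalize (Nat.mod_upper_bound o (tops t)); lia.
  - replace (S o - lenU t)%nat with (S (o - lenU t)) by lia.
    intros E'. apply (mod_succ_neq (o - lenU t) (N - tops t)); [|lia].
    assert (0 < N - tops t)%nat by (unfold len, lenB in Ho; nia).
    destruct (Nat.eq_dec (N - tops t) 1) as [E|E]; [|lia].
    unfold len, lenB, rounds in Ho. rewrite E in Ho; simpl in Ho; lia.
Qed.

(** The next excursion begins with label 0, which must differ from the label before it. If all
    levels rise together, the last label is [n], which is at least 1. *)
Lemma plabel_last t : plabel t (len t - 1) <> 0%nat.
Proof.
  assert (H := tops_range t). assert (L := len_pos t). unfold plabel.
  destruct (Nat.ltb_spec (len t - 1) (lenU t)); [|lia].
  assert (E : tops t = N).
  { generalize (lenB_ge t); unfold len in *; lia. }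
  assert (EB : lenB t = 0%nat) by (unfold lenB; rewrite E; lia).
  replace (len t - 1)%nat with (N * (rounds t N - 1) + n)%nat.
  - rewrite E, Nat.add_comm, Nat.mul_comm, Nat.Div0.mod_add, Nat.mod_small; lia.
  - unfold len; rewrite EB; unfold lenU; rewrite E. generalize (rounds_pos t N); nia.
Qed.

(** Within a group the labels take turns, so the next one has had at most as many turns as the
    present one including its current rise. *)
Lemma plevel_next t o : (S o < len t)%nat ->
  plevel t o (plabel t (S o)) <= plevel t (S o) (plabel t o).
Proof.
  intros Ho. assert (H := tops_range t).
  assert (R0 := plevel_range t (S o) (plabel t o) (plabel_lt t o ltac:(lia)) ltac:(lia)).
  assert (R1 := plabel_lt t (S o) Ho). assert (R2 := plabel_lt t o ltac:(lia)).
  destruct (Nat.lt_ge_cases (S o) (lenU t)) as [HU|HU]; [|destruct (Nat.lt_ge_cases o (lenU t)) as [HU'|HU']].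
  - unfold plabel, plevel. destruct (Nat.ltb_spec (S o) (lenU t)); [|lia].
    destruct (Nat.ltb_spec o (lenU t)); [|lia].
    assert (o mod tops t < tops t)%nat by (apply Nat.mod_upper_bound; lia).
    assert (S o mod tops t < tops t)%nat by (apply Nat.mod_upper_bound; lia).
    destruct (Nat.ltb_spec (S o mod tops t) (tops t)); [|lia].
    destruct (Nat.ltb_spec (o mod tops t) (tops t)); [|lia].
    rewrite !Nat.min_l by lia. apply affine_frac_mono; [|apply rounds_INR].
    rewrite (turns_S o (tops t) (o mod tops t)) by assumption. rewrite Nat.eqb_refl.
    generalize (turns_bounds o (tops t) (S o mod tops t)) (turns_bounds o (tops t) (o mod tops t)); lia.
  (* Change of group: the first label of the second group is still at [base t]. *)
  - rewrite (plevel_bottom_start t o (plabel t (S o))); [lra| |lia].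
    revert R1. unfold plabel. destruct (Nat.ltb_spec (S o) (lenU t)); lia.
  - revert R1 R2. unfold plabel, plevel. destruct (Nat.ltb_spec (S o) (lenU t)); [lia|].
    destruct (Nat.ltb_spec o (lenU t)); [lia|].
    set (a := (S o - lenU t)%nat). set (b := (o - lenU t)%nat). assert (Eab : a = S b) by (unfold a, b; lia).
    intros R1 R2. assert (0 < N - tops t)%nat by (unfold len, lenB in Ho; nia).
    destruct (Nat.ltb_spec (tops t + a mod (N - tops t)) (tops t)); [lia|].
    destruct (Nat.ltb_spec (tops t + b mod (N - tops t)) (tops t)); [lia|].
    replace (tops t + a mod (N - tops t) - tops t)%nat with (a mod (N - tops t))%nat by lia.
    replace (tops t + b mod (N - tops t) - tops t)%nat with (b mod (N - tops t))%nat by lia.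
    apply affine_frac_mono; [|apply rounds_INR]. rewrite Eab at 2.
    rewrite turns_S by (apply Nat.mod_upper_bound; lia). rewrite Nat.eqb_refl.
    generalize (turns_bounds b (N - tops t) (a mod (N - tops t)))
               (turns_bounds b (N - tops t) (b mod (N - tops t))); lia.
Qed.

Lemma path_schedule : schedule N lab lev.
Proof.
  constructor.
  - intros i. unfold lab. assert (H := loc_lt i). destruct (loc i) as [t o]. now apply plabel_lt.
  - unfold lab; simpl. unfold plabel. assert (H := lenU_pos 0). assert (H' := tops_range 0).
    destruct (Nat.ltb_spec 0 (lenU 0)); [|lia]. apply Nat.Div0.mod_0_l.
  - intros i. assert (H := loc_lt i). unfold lab. destruct (loc i) as [t o] eqn:E. simpl in H.
    destruct (loc_S i t o E) as [[-> H']|[-> H']].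
    + now apply plabel_S_neq.
    + replace o with (len t - 1)%nat by lia. unfold plabel at 1.
      assert (L := lenU_pos (S t)). assert (H0 := tops_range (S t)).
      destruct (Nat.ltb_spec 0 (lenU (S t))); [|lia]. rewrite Nat.Div0.mod_0_l.
      apply not_eq_sym, plabel_last.
  - intros l Hl. unfold lev; simpl. now apply plevel_0.
  - intros i l Hl. assert (H := loc_lt i). unfold lab. destruct (loc i) as [t o] eqn:E. simpl in H.
    intros Hne. rewrite (lev_S i t o) by assumption. unfold lev; rewrite E.
    now apply plevel_S_other.
  - intros i. assert (H := loc_lt i). unfold lab. destruct (loc i) as [t o] eqn:E. simpl in H.
    rewrite (lev_S i t o) by (auto; now apply plabel_lt). unfold lev; rewrite E.
    now apply plevel_S_label.
  - intros i. assert (H := loc_lt i). unfold lab at 2. destruct (loc i) as [t o] eqn:E. simpl in H.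
    rewrite (lev_S i t o) by (auto; now apply plabel_lt).
    unfold lev; rewrite E. unfold lab.
    destruct (loc_S i t o E) as [[-> H']|[-> H']].
    + now apply plevel_next.
    + rewrite H', plevel_end by now apply plabel_lt.
      apply plevel_range; [|lia]. apply plabel_lt, len_pos.
Qed.

(** * Growth of the levels against the number of steps *)

Lemma len_le t : (len t <= N * (S t * S t))%nat.
Proof.
  assert (H := tops_range t).
  assert (G : forall g, (rounds t g <= S t * S t)%nat) by (intros g; unfold rounds; destruct (g =? 1)%nat; nia).
  assert (G1 := G (tops t)). assert (G2 := G (N - tops t)%nat).
  unfold len, lenU, lenB.
  apply Nat.le_trans with (tops t * (S t * S t) + (N - tops t) * (S t * S t))%nat.
  - apply Nat.add_le_mono; apply Nat.mul_le_mono_l; assumption.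
  - rewrite <- Nat.mul_add_distr_r. apply Nat.mul_le_mono_r. lia.
Qed.

Lemma first_le t : (first t <= N * (t * t * t))%nat.
Proof.
  induction t as [|t IH]; simpl first; [lia|]. assert (H := len_le t).
  apply Nat.le_trans with (N * (t * t * t) + N * (S t * S t))%nat; [lia|].
  rewrite <- Nat.mul_add_distr_l. apply Nat.mul_le_mono_l. nia.
Qed.

(** Only the excursions with [t mod N = n] are certain to double the base, since every other [rise]
    may equal 1; there is one of them in every [N]. *)
Lemma base_growth t : 2 ^ (t / N) <= base t.
Proof.
  induction t as [|t IH]; [rewrite Nat.Div0.div_0_l; simpl; lra|].
  assert (E := Nat.div_mod_eq t N). assert (M := mod_range t).
  assert (B := base_pos t). assert (R1 := rise_ge1 t). simpl base.
  destruct (Nat.eq_dec (t mod N) n) as [Hm|Hm].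
  - assert (D : (S t / N = S (t / N))%nat).
    { symmetry. apply (Nat.div_unique (S t) N (S (t / N)) 0); lia. }
    assert (R2 : 2 <= rise t).
    { unfold rise. rewrite Hm, psi_last. destruct (Rlt_dec 0 0); [lra|generalize (pos_INR t); lra]. }
    rewrite D, <- tech_pow_Rmult, (Rmult_comm 2).
    apply Rmult_le_compat; try lra. apply pow_le; lra.
  - assert (D : (S t / N = t / N)%nat).
    { symmetry. apply (Nat.div_unique (S t) N (t / N) (S (t mod N))); lia. }
    rewrite D. rewrite <- (Rmult_1_r (2 ^ (t / N))).
    apply Rmult_le_compat; try lra. apply pow_le; lra.
Qed.

Lemma pow4_le_exp2 a : (INR a + 1) ^ 4 <= 200 * 2 ^ a.
Proof.
  induction a as [|a IH]; [simpl; lra|].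
  destruct (Nat.le_gt_cases 5 a) as [Ha|Ha].
  - rewrite S_INR. apply le_INR in Ha. simpl INR in Ha.
    replace (200 * 2 ^ S a) with (2 * (200 * 2 ^ a)) by (simpl; ring).
    apply Rle_trans with (2 * (INR a + 1) ^ 4); [|lra].
    (* From [b = 6] on, [(b + 1) ^ 4] is at most [2 * b ^ 4]; the factor 200 covers the smaller
       cases. *)
    set (b := INR a + 1) in *. assert (Hb : 6 <= b) by (unfold b; lra).
    assert (6 * (b * b * b) <= b * (b * b * b)).
    { apply Rmult_le_compat_r; [|lra]. repeat apply Rmult_le_pos; lra. }
    assert (6 * (b * b) <= b * (b * b)) by (apply Rmult_le_compat_r; [apply Rmult_le_pos|]; lra).
    assert (6 * b <= b * b) by (apply Rmult_le_compat_r; lra).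
    replace ((b + 1) ^ 4) with (b * (b * b * b) + 4 * (b * (b * b)) + 6 * (b * b) + 4 * b + 1) by ring.
    replace (2 * b ^ 4) with (b * (b * b * b) + b * (b * b * b)) by ring. lra.
  - do 5 (destruct a as [|a]; [simpl; lra|]). lia.
Qed.

(** The cube is the growth of [first], and the factor [INR t + 1] is the gain that makes errors
    negligible against the base. The constant is 9 times the 200 of [pow4_le_exp2]. *)
Lemma base_growth_poly t :
  ((INR t + 2) ^ 3 + 1) * (INR t + 1) <= 1800 * INR N ^ 4 * base t.
Proof.
  assert (G := base_growth t). assert (P := pow4_le_exp2 (t / N)).
  assert (Ht : INR t + 1 <= INR N * (INR (t / N) + 1)).
  { rewrite <- !S_INR, <- mult_INR. apply le_INR.
    generalize (Nat.div_mod_eq t N) (mod_range t). nia. }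
  assert (N1 : 1 <= INR N) by (apply (le_INR 1); lia).
  assert (T0 := pos_INR t). assert (A0 := pos_INR (t / N)).
  set (m := INR N * (INR (t / N) + 1)) in *.
  assert (Hm : 1 <= m) by lra.
  apply Rle_trans with (9 * m ^ 4).
  - apply Rle_trans with ((8 * m ^ 3 + m ^ 3) * m); [|right; ring].
    assert (K1 : (INR t + 2) ^ 3 <= (2 * m) ^ 3) by (apply pow_incr; lra).
    assert (K2 : 1 <= m ^ 3) by now apply pow_R1_Rle.
    assert (K3 : 0 <= (INR t + 2) ^ 3) by (apply pow_le; lra).
    replace ((2 * m) ^ 3) with (8 * m ^ 3) in K1 by ring.
    apply Rmult_le_compat; lra.
  - unfold m. rewrite Rpow_mult_distr.
    assert (0 < INR N ^ 4) by (apply pow_lt; lra). nra.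
Qed.

Lemma rise_le t : rise t <= INR t + 2 + sumN N (fun j => Rabs (slope j)).
Proof.
  assert (H := mod_range t). assert (T0 := pos_INR t).
  assert (A : Rabs (slope (t mod N)) <= sumN N (fun j => Rabs (slope j))).
  { apply (sumR_map_In (fun j => Rabs (slope j))); [intros; apply Rabs_pos|apply in_seq; lia]. }
  assert (A0 := Rabs_pos (slope (t mod N))).
  unfold rise. destruct (Rlt_dec 0 (psi (t mod N))); [generalize (Rle_abs (slope (t mod N)))|]; lra.
Qed.

(** * Levels inside an excursion *)

Definition width (t : nat) : R := base t * (rise t - 1) / ((INR t + 1) * (INR t + 1)).

Lemma width_nonneg t : 0 <= width t.
Proof.
  unfold width. assert (T0 := pos_INR t). apply Rdiv_le_0_compat.
  - apply Rmult_le_pos; [left; apply base_pos|generalize (rise_ge1 t); lra].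
  - nra.
Qed.

Lemma turns_width t o g l : (l < g)%nat ->
  base t * (1 + (rise t - 1) * (INR (o / g) / INR (rounds t g))) <=
  base t * (1 + (rise t - 1) * (INR (turns o g l) / INR (rounds t g))) <=
  base t * (1 + (rise t - 1) * (INR (o / g) / INR (rounds t g))) + width t.
Proof.
  intros Hl. assert (T := turns_bounds o g l). assert (W := width_nonneg t).
  assert (Hr := rounds_INR t g). split.
  - apply affine_mono. apply Rmult_le_compat_r; [left; now apply Rinv_0_lt_compat|]. apply le_INR; lia.
  - destruct (Nat.eq_dec g 1) as [->|Hg].
    + replace l with 0%nat by lia. rewrite turns_1, Nat.div_1_r. lra.
    + assert (E : INR (rounds t g) = (INR t + 1) * (INR t + 1)).
      { unfold rounds. destruct (Nat.eqb_spec g 1); [contradiction|]. rewrite mult_INR, S_INR; reflexivity. }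
      apply Rle_trans with (base t * (1 + (rise t - 1) * (INR (o / g + 1) / INR (rounds t g)))).
      * apply affine_mono. apply Rmult_le_compat_r; [left; now apply Rinv_0_lt_compat|]. apply le_INR; lia.
      * unfold width. rewrite <- E, plus_INR. simpl INR. right. field. lra.
Qed.

Lemma plevel_shape t o : (o < len t)%nat -> exists x y,
  base t <= y /\ y <= x /\ x <= rise t * y /\
  (forall l, (l < tops t)%nat -> x <= plevel t o l <= x + width t) /\
  (forall l, (tops t <= l < N)%nat -> y <= plevel t o l <= y + width t).
Proof.
  intros Ho. assert (H := tops_range t). assert (B := base_pos t). assert (R1 := rise_ge1 t).
  assert (W := width_nonneg t).
  destruct (Nat.lt_ge_cases o (lenU t)) as [HU|HU].
  - set (x := base t * (1 + (rise t - 1) * (INR (o / tops t) / INR (rounds t (tops t))))).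
    exists x, (base t).
    assert (Hx : base t <= x <= base t * rise t).
    { apply affine_frac_range; [|apply rounds_INR]. apply Nat.lt_le_incl, Nat.Div0.div_lt_upper_bound. exact HU. }
    repeat split; try lra.
    + unfold plevel. destruct (Nat.ltb_spec l (tops t)); [|lia]. rewrite Nat.min_l by lia. now apply turns_width.
    + unfold plevel. destruct (Nat.ltb_spec l (tops t)); [|lia]. rewrite Nat.min_l by lia. now apply turns_width.
    + rewrite plevel_bottom_start by lia; lra.
    + rewrite plevel_bottom_start by lia; lra.
  - set (y := base t * (1 + (rise t - 1) * (INR ((o - lenU t) / (N - tops t)) / INR (rounds t (N - tops t))))).
    exists (base t * rise t), y.
    assert (HB : (o - lenU t < lenB t)%nat) by (unfold len in Ho; lia).
    assert (Hy : base t <= y <= base t * rise t).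
    { apply affine_frac_range; [|apply rounds_INR]. apply Nat.lt_le_incl, Nat.Div0.div_lt_upper_bound. exact HB. }
    repeat split; try lra.
    + nra.
    + rewrite plevel_top_end by assumption; lra.
    + rewrite plevel_top_end by assumption; lra.
    + unfold plevel. destruct (Nat.ltb_spec l (tops t)); [lia|]. apply turns_width; lia.
    + unfold plevel. destruct (Nat.ltb_spec l (tops t)); [lia|]. apply turns_width; lia.
Qed.

Lemma sumN_two_values (M g : nat) (x y : R) : (g <= M)%nat ->
  sumN M (fun l => if (l <? g)%nat then x else y) = INR g * x + INR (M - g) * y.
Proof.
  intros Hg. induction Hg as [|M Hg IH].
  - rewrite Nat.sub_diag. simpl. rewrite (sumN_ext _ _ (fun _ => x)), sumN_const; [ring|].
    intros l Hl; destruct (Nat.ltb_spec l g); [reflexivity|lia].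
  - rewrite sumN_S, IH. destruct (Nat.ltb_spec M g); [lia|].
    replace (S M - g)%nat with (S (M - g)) by lia. rewrite S_INR; ring.
Qed.

Lemma subset_sum_le (M : nat) (F : nat -> R) (I : list nat) : NoDup I ->
  (forall l, In l I -> (l < M)%nat) -> (forall l, (l < M)%nat -> 0 <= F l) ->
  sumR (map F I) <= sumN M F.
Proof.
  intros HN; revert F; induction HN as [|a I Ha HN IH]; intros F HI HF; [now apply sumN_nonneg|].
  simpl. set (G := fun l => if Nat.eqb l a then 0 else F l).
  assert (Ga : G a = 0) by (unfold G; now rewrite Nat.eqb_refl).
  assert (Gl : forall l, l <> a -> G l = F l)
    by (intros l Hl; unfold G; destruct (Nat.eqb_spec l a); [contradiction|reflexivity]).
  rewrite (sumR_map_eq F G).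
  - assert (H := IH G). rewrite (sumN_update M a F G) in H.
    + rewrite Ga in H. enough (sumR (map G I) <= sumN M F + (0 - F a)) by lra. apply H.
      * intros; apply HI; now right.
      * intros l Hl; unfold G; destruct (Nat.eqb_spec l a); [lra|now apply HF].
    + apply HI; now left.
    + intros; now apply Gl.
  - intros l Hl. symmetry; apply Gl. intros ->; contradiction.
Qed.

(* If the levels are [x] on the top labels and [y] below, the choice of [rise] gives
   [psi k * q <= INR (n - k) * y] for the sum [q] of all levels, [k] being the index of the
   excursion; [psi_low] and [psi_high] transport this bound to the other indices. *)
Lemma plevel_subset_sum t o j I : (o < len t)%nat -> (j < n)%nat ->
  NoDup I -> length I = (j + 1)%nat -> (forall l, In l I -> (l <= n)%nat) ->
  sumR (map (plevel t o) I) <= (1 - psi j) * sumN N (plevel t o) + INR N * width t.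
Proof.
  intros Ho Hj HN HI HIn.
  destruct (plevel_shape t o Ho) as (x & y & Hy & Hyx & Hxr & Htop & Hbot).
  assert (H := tops_range t). assert (B := base_pos t). assert (W := width_nonneg t).
  assert (key := rise_key t). assert (Hk := mod_range t).
  assert (Eg : tops t = S (t mod N)) by reflexivity.
  set (k := (t mod N)%nat) in *. set (g := tops t) in *. set (w := width t) in *.
  assert (Pj := psi_range j ltac:(lia)). assert (Pk := psi_range k Hk).
  set (Q := sumN N (plevel t o)).
  assert (Q1 : INR g * x + INR (n - k) * y <= Q).
  { replace (n - k)%nat with (N - g)%nat by lia. rewrite <- sumN_two_values by lia.
    apply sumN_le. intros l Hl. destruct (Nat.ltb_spec l g); [now apply Htop|apply Hbot; lia]. }
  assert (Q2 : Q <= INR g * x + INR (n - k) * y + INR N * w).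
  { replace (n - k)%nat with (N - g)%nat by lia. rewrite <- sumN_two_values, <- sumN_const, <- sumN_plus by lia.
    apply sumN_le. intros l Hl. destruct (Nat.ltb_spec l g); [now apply Htop|apply Hbot; lia]. }
  set (S0 := INR g * x + INR (n - k) * y) in *.
  assert (g0 : 0 < INR g) by (apply lt_0_INR; lia).
  assert (k0 := pos_INR (n - k)).
  assert (KY : psi k * S0 <= INR (n - k) * y).
  { apply Rle_trans with (psi k * (INR (n - k) + INR g * rise t) * y).
    - rewrite Rmult_assoc. apply Rmult_le_compat_l; [lra|]. unfold S0. nra.
    - apply Rmult_le_compat_r; [lra|exact key]. }
  assert (S00 : 0 < S0) by (unfold S0; nra).
  assert (N0 : 0 < INR N) by (apply lt_0_INR; lia).
  assert (Nw : 0 <= INR N * w) by nra.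
  destruct (Nat.le_gt_cases k j) as [Hkj|Hkj].
  (* Case [k <= j]: the [n - j] labels left out have levels at least [y], and [psi_low] compares [j]
     with [k]. *)
  - assert (HS : sumR (map (plevel t o) I) <= Q - INR (n - j) * y).
    { assert (A := subset_sum_le N (fun l => plevel t o l + - y) I HN).
      rewrite sumN_plus, sumN_const, sumR_map_plus, sumR_map_const, HI in A.
      assert (E : INR N = INR (n - j) + INR (j + 1)) by (rewrite <- plus_INR; f_equal; lia).
      rewrite E in A. fold Q in A.
      change (map (fun x0 : nat => plevel t o x0) I) with (map (plevel t o) I) in A.
      enough (sumR (map (plevel t o) I) + INR (j + 1) * - y <=
        Q + (INR (n - j) + INR (j + 1)) * - y) by lra.
      apply A.
      - intros l Hl; apply HIn in Hl; lia.
      - intros l Hl. destruct (Nat.lt_ge_cases l g) as [h|h]; [specialize (Htop l h)|specialize (Hbot l ltac:(lia))]; lra. }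
    assert (L := psi_low j k Hkj ltac:(lia)).
    assert (kp : 0 < INR (n - k)) by (apply lt_0_INR; lia).
    assert (nj := pos_INR (n - j)).
    assert (F : psi j * S0 <= INR (n - j) * y).
    { apply (Rmult_le_reg_r (INR (n - k))); [exact kp|].
      apply Rle_trans with (INR (n - j) * (psi k * S0)).
      - replace (psi j * S0 * INR (n - k)) with (psi j * INR (n - k) * S0) by ring.
        replace (INR (n - j) * (psi k * S0)) with (psi k * INR (n - j) * S0) by ring.
        apply Rmult_le_compat_r; lra.
      - replace (INR (n - j) * y * INR (n - k)) with (INR (n - j) * (INR (n - k) * y)) by ring.
        apply Rmult_le_compat_l; lra. }
    assert (psi j * Q <= psi j * (S0 + INR N * w)) by (apply Rmult_le_compat_l; lra).
    assert (psi j * (INR N * w) <= 1 * (INR N * w)) by (apply Rmult_le_compat_r; lra).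
    lra.
  (* Case [j < k]: each chosen level is at most [x + w], and [psi_high] compares [j] with [k]. *)
  - assert (HS : sumR (map (plevel t o) I) <= INR (j + 1) * (x + w)).
    { rewrite <- HI, <- sumR_map_const. apply sumR_map_le. intros l Hl. apply HIn in Hl.
      destruct (Nat.lt_ge_cases l g) as [h|h]; [specialize (Htop l h)|specialize (Hbot l ltac:(lia))]; lra. }
    assert (L := psi_high j k ltac:(lia) Hk).
    assert (EJ : INR (j + 1) = INR (S j)) by (f_equal; lia).
    assert (J0 : 0 < INR (S j)) by (apply lt_0_INR; lia).
    assert (F : INR (S j) * x <= (1 - psi j) * S0).
    { apply (Rmult_le_reg_r (INR g)); [exact g0|].
      apply Rle_trans with ((1 - psi k) * INR (S j) * S0).
      - assert (INR g * x <= (1 - psi k) * S0) by (unfold S0 in *; lra).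
        replace ((1 - psi k) * INR (S j) * S0) with (INR (S j) * ((1 - psi k) * S0)) by ring.
        rewrite Rmult_assoc. apply Rmult_le_compat_l; lra.
      - replace ((1 - psi j) * S0 * INR g) with ((1 - psi j) * INR g * S0) by ring.
        apply Rmult_le_compat_r; [lra|]. rewrite Eg. exact L. }
    assert (JN : INR (S j) <= INR N) by (apply le_INR; lia).
    assert (INR (S j) * w <= INR N * w) by (apply Rmult_le_compat_r; lra).
    assert ((1 - psi j) * S0 <= (1 - psi j) * Q) by (apply Rmult_le_compat_l; lra).
    rewrite EJ in HS. lra.
Qed.

(** At offset [lenU t] the top group has finished and the other has not begun, so there are exactly
    two values. The low ones have the share [psi k] when it is positive; otherwise [rise t = t + 2]
    bounds their share by [N / (t + 1)]. *)
Lemma plevel_extremal t : (t mod N < n)%nat ->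
  (lenU t < len t)%nat /\
  (1 - psi (t mod N) - INR N / (INR t + 1)) * sumN N (plevel t (lenU t)) <=
    sumR (map (plevel t (lenU t)) (seq 0 (S (t mod N)))).
Proof.
  intros Hk. assert (H := tops_range t). assert (LB := lenB_ge t).
  assert (Eg : tops t = S (t mod N)) by reflexivity.
  split; [unfold len; lia|].
  assert (B := base_pos t). assert (R1 := rise_ge1 t). assert (T0 := pos_INR t).
  set (k := (t mod N)%nat) in *.
  rewrite (sumN_ext N (plevel t (lenU t)) (fun l => if (l <? S k)%nat then base t * rise t else base t)).
  2:{ intros l Hl. destruct (Nat.ltb_spec l (S k)).
      - apply plevel_top_end; lia.
      - apply plevel_bottom_start; lia. }
  rewrite sumN_two_values by lia.
  rewrite (sumR_map_eq _ (fun _ => base t * rise t)).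
  2:{ intros l Hl. apply in_seq in Hl. apply plevel_top_end; lia. }
  rewrite sumR_map_const, length_seq.
  replace (N - S k)%nat with (n - k)%nat by lia.
  assert (Pk := psi_range k ltac:(lia)).
  set (c := base t) in *. set (r := rise t) in *.
  assert (g0 : 1 <= INR (S k)) by (apply (le_INR 1); lia).
  assert (k0 := pos_INR (n - k)).
  assert (kN : INR (n - k) <= INR N) by (apply le_INR; lia).
  assert (Q0 : 0 <= INR (S k) * (c * r) + INR (n - k) * c).
  { apply Rplus_le_le_0_compat; apply Rmult_le_pos; try lra; nra. }
  enough (INR (n - k) * c <= (psi k + INR N / (INR t + 1)) * (INR (S k) * (c * r) + INR (n - k) * c)) by lra.
  destruct (Rlt_dec 0 (psi k)) as [Hp|Hp].
  - assert (Er : r = slope k).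
    { unfold r, rise. fold k. destruct (Rlt_dec 0 (psi k)); [reflexivity|contradiction]. }
    assert (E := rise_equation k ltac:(lia) Hp). rewrite <- Er in E.
    replace (INR (n - k) * c) with (psi k * (INR (S k) * (c * r) + INR (n - k) * c)) at 1
      by (rewrite <- E at 2; ring).
    apply Rmult_le_compat_r; [exact Q0|].
    assert (0 <= INR N / (INR t + 1)) by (apply Rdiv_le_0_compat; lra). lra.
  - assert (Er : r = INR t + 2).
    { unfold r, rise. fold k. destruct (Rlt_dec 0 (psi k)); [contradiction|reflexivity]. }
    replace (psi k) with 0 by lra. rewrite Rplus_0_l.
    apply Rle_trans with (INR N / (INR t + 1) * (c * (INR t + 1))).
    + replace (INR N / (INR t + 1) * (c * (INR t + 1))) with (INR N * c) by (field; lra).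
      apply Rmult_le_compat_r; lra.
    + apply Rmult_le_compat_l; [apply Rdiv_le_0_compat; lra|]. rewrite Er.
      assert (0 <= INR (n - k) * c) by (apply Rmult_le_pos; lra).
      assert (1 * (c * (INR t + 2)) <= INR (S k) * (c * (INR t + 2))) by (apply Rmult_le_compat_r; nra).
      nra.
Qed.

(** * Time scales and errors along the trajectory *)

Local Notation Q i := (sumN N (lev i)).
Local Notation exc i := (fst (loc i)).

Lemma index_range i : (first (exc i) <= i < first (S (exc i)))%nat.
Proof. assert (H := loc_lt i). assert (E := loc_index i). cbn [first]. lia. Qed.

Lemma exc_S i : exc (S i) = exc i \/ exc (S i) = S (exc i).
Proof.
  destruct (loc i) as [t o] eqn:E. destruct (loc_S i t o E) as [[-> _]|[-> _]]; simpl; auto.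
Qed.

Lemma exc_ge i t : (first t <= i)%nat -> (t <= exc i)%nat.
Proof.
  intros H. destruct (Nat.le_gt_cases t (exc i)) as [h|h]; [exact h|].
  assert (M : (first (S (exc i)) <= first t)%nat).
  { clear -h. induction h as [|t h IH]; [lia|]. change (first (S t)) with (first t + len t)%nat. lia. }
  generalize (index_range i); lia.
Qed.

Lemma base_le_sum i : INR N * base (exc i) <= Q i.
Proof.
  rewrite <- sumN_const. apply sumN_le. intros l Hl. assert (H := loc_lt i).
  unfold lev. destruct (loc i) as [t o]. simpl in H. apply plevel_range; [exact Hl|simpl; lia].
Qed.

Lemma label_in_excursion t l : (l < N)%nat ->
  exists j, (first t <= j < first (S t))%nat /\ lab j = l.
Proof.
  intros Hl. assert (H := tops_range t). assert (LU := lenU_pos t). assert (LB := lenB_ge t).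
  cbn [first]. destruct (Nat.lt_ge_cases l (tops t)) as [h|h].
  - exists (first t + l)%nat. split; [unfold len; lia|].
    unfold lab. rewrite loc_first by (unfold len; lia). unfold plabel.
    destruct (Nat.ltb_spec l (lenU t)); [|lia]. now apply Nat.mod_small.
  - exists (first t + (lenU t + (l - tops t)))%nat. split; [unfold len; lia|].
    unfold lab. rewrite loc_first by (unfold len; lia). unfold plabel.
    destruct (Nat.ltb_spec (lenU t + (l - tops t)) (lenU t)); [lia|].
    replace (lenU t + (l - tops t) - lenU t)%nat with (l - tops t)%nat by lia.
    rewrite Nat.mod_small by lia. lia.
Qed.

(** Every excursion uses all labels, so the end of the next one serves as the waiting time [J] of
    section [Stage]. *)
Lemma label_recurs i l : (l <= n)%nat ->
  exists j, (i < j <= first (S (S (exc i))))%nat /\ lab j = l.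
Proof.
  intros Hl. destruct (label_in_excursion (S (exc i)) l ltac:(lia)) as (j & Hj & E).
  exists j. split; [|exact E]. generalize (index_range i); lia.
Qed.

Definition spread : R := 1800 * INR N ^ 4.

Lemma spread_pos : 0 < spread.
Proof. unfold spread. assert (0 < INR N ^ 4) by (apply pow_lt, lt_0_INR; lia). lra. Qed.

Lemma cube_le_base t : (INR t + 2) ^ 3 + 1 <= spread * (base t / (INR t + 1)).
Proof.
  assert (H := base_growth_poly t). assert (T0 := pos_INR t). fold spread in H.
  apply (Rmult_le_reg_r (INR t + 1)); [lra|].
  replace (spread * (base t / (INR t + 1)) * (INR t + 1)) with (spread * base t) by (field; lra).
  exact H.
Qed.

Lemma N_ge1 : 1 <= INR N.
Proof. apply (le_INR 1); lia. Qed.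

Lemma first_INR_le t : INR (first (S (S t))) <= INR N * (INR t + 2) ^ 3.
Proof.
  assert (H := first_le (S (S t))). apply le_INR in H. rewrite !mult_INR, !S_INR in H.
  rewrite S_INR. simpl pow. eapply Rle_trans; [exact H|]. right; ring.
Qed.

(** This is the growth hypothesis [HC] of section [Limit]. The number of steps is cubic in [t],
    hence below the base once [t + 1 >= W]; the finitely many earlier excursions go into the
    constant. *)
Lemma step_count_le : exists C, forall i, INR i * ln 8 <= Q i + C.
Proof.
  set (c := INR N * ln 8). set (W := c * spread).
  assert (c0 : 0 < c).
  { apply Rmult_lt_0_compat; [generalize N_ge1; lra|]. rewrite <- ln_1. apply ln_increasing; lra. }
  assert (SP := spread_pos).
  exists (c * (W + 2) ^ 3). intros i.
  assert (Hb := base_le_sum i). assert (Hi := index_range i).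
  set (t := exc i) in *. assert (B := base_pos t). assert (T0 := pos_INR t). assert (N1 := N_ge1).
  assert (HbQ : base t <= Q i) by nra.
  assert (Hj : INR i * ln 8 <= c * (INR t + 2) ^ 3).
  { unfold c. replace (INR N * ln 8 * (INR t + 2) ^ 3) with (INR N * (INR t + 2) ^ 3 * ln 8) by ring.
    apply Rmult_le_compat_r; [rewrite <- ln_1; apply ln_le; lra|].
    eapply Rle_trans; [|apply first_INR_le]. apply le_INR.
    cbn [first] in *. lia. }
  assert (P3 : 0 <= (W + 2) ^ 3) by (apply pow_le; unfold W; nra).
  destruct (Rle_lt_dec W (INR t + 1)) as [h|h].
  - assert (G := cube_le_base t).
    assert (c * (INR t + 2) ^ 3 <= W * (base t / (INR t + 1))).
    { unfold W. rewrite Rmult_assoc. apply Rmult_le_compat_l; lra. }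
    assert (W * (base t / (INR t + 1)) <= base t).
    { apply (Rmult_le_reg_r (INR t + 1)); [lra|].
      replace (W * (base t / (INR t + 1)) * (INR t + 1)) with (base t * W) by (field; lra).
      apply Rmult_le_compat_l; lra. }
    assert (0 <= c * (W + 2) ^ 3) by (apply Rmult_le_pos; lra). lra.
  - assert ((INR t + 2) ^ 3 <= (W + 2) ^ 3) by (apply pow_incr; lra).
    assert (c * (INR t + 2) ^ 3 <= c * (W + 2) ^ 3) by (apply Rmult_le_compat_l; lra). lra.
Qed.

Definition kappa (t : nat) : R := 5 * INR N * (INR (first (S (S t))) + 1).

Lemma kappa_nonneg t : 0 <= kappa t.
Proof. unfold kappa. generalize (pos_INR (first (S (S t)))) N_ge1; intros; nra. Qed.

Lemma loss_le (u : vec) : u 0%nat = 1 -> exists M, 0 <= M /\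
  forall t, loss n u (kappa t) <= M * (base t / (INR t + 1)).
Proof.
  intros Hu. destruct (loss_terms n u Hu) as [P1 P2].
  set (a := ln (INR N ^ N * (vnorm n u + 1)) +
    ln (2 ^ N * (INR (fact (S N)) * (1 + sumN N (fun t => Rabs (u t)))))).
  assert (a0 : 0 <= a).
  { apply Rplus_le_le_0_compat; rewrite <- ln_1; apply ln_le; lra. }
  assert (N1 := N_ge1). assert (SP := spread_pos).
  assert (N3 : 0 <= 5 * INR N ^ 3) by (assert (0 <= INR N ^ 3) by (apply pow_le; lra); lra).
  exists ((a + 5 * INR N ^ 3) * spread). split; [nra|]. intros t.
  assert (G := cube_le_base t). assert (F := first_INR_le t). assert (T0 := pos_INR t).
  rewrite Rmult_assoc. apply Rle_trans with ((a + 5 * INR N ^ 3) * ((INR t + 2) ^ 3 + 1)).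
  2:{ apply Rmult_le_compat_l; [lra|exact G]. }
  unfold loss. fold a. unfold kappa.
  assert (X : 0 <= (INR t + 2) ^ 3) by (apply pow_le; lra). set (x := (INR t + 2) ^ 3) in *.
  assert (a <= a * (x + 1)) by nra.
  assert (INR N * (5 * INR N * (INR (first (S (S t))) + 1)) <= 5 * INR N ^ 3 * (x + 1)).
  { replace (INR N * (5 * INR N * (INR (first (S (S t))) + 1))) with
      (5 * INR N ^ 2 * (INR (first (S (S t))) + 1)) by ring.
    replace (5 * INR N ^ 3 * (x + 1)) with (5 * INR N ^ 2 * (INR N * x + INR N)) by ring.
    apply Rmult_le_compat_l; [|lra]. assert (0 <= INR N ^ 2) by (apply pow_le; lra). lra. }
  lra.
Qed.

Lemma width_le : exists M, 0 <= M /\ forall t, INR N * width t <= M * (base t / (INR t + 1)).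
Proof.
  set (m := sumN N (fun j => Rabs (slope j))).
  assert (m0 : 0 <= m) by (apply sumN_nonneg; intros; apply Rabs_pos).
  assert (N1 := N_ge1).
  exists (INR N * (1 + m)). split; [nra|]. intros t. rewrite Rmult_assoc.
  apply Rmult_le_compat_l; [lra|].
  assert (R2 := rise_le t). fold m in R2. assert (T0 := pos_INR t). assert (B := base_pos t).
  unfold width. apply (Rmult_le_reg_r ((INR t + 1) * (INR t + 1))); [nra|].
  replace (base t * (rise t - 1) / ((INR t + 1) * (INR t + 1)) * ((INR t + 1) * (INR t + 1)))
    with (base t * (rise t - 1)) by (field; lra).
  replace ((1 + m) * (base t / (INR t + 1)) * ((INR t + 1) * (INR t + 1)))
    with (base t * ((1 + m) * (INR t + 1))) by (field; lra).
  apply Rmult_le_compat_l; [lra|]. nra.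
Qed.

Lemma sum_S i : Q (S i) = Q i + (lev (S i) (lab i) - lev i (lab i)).
Proof.
  apply sumN_update; [apply (lab_lt _ _ _ path_schedule)|].
  intros l Hl Hne. now apply (lev_other _ _ _ path_schedule).
Qed.

Lemma sum_incr i j : (i <= j)%nat -> Q i <= Q j.
Proof.
  intros H; induction H as [|j H IH]; [lra|].
  rewrite sum_S. generalize (lev_incr _ _ _ path_schedule j); lra.
Qed.

Lemma base_large (x : R) : exists t0, forall t, (t0 <= t)%nat -> x <= base t.
Proof.
  destruct (INR_unbounded (x * spread)) as [t0 Ht0]. exists t0. intros t Ht.
  assert (G := base_growth_poly t). fold spread in G. assert (T0 := pos_INR t).
  assert (SP := spread_pos). apply le_INR in Ht.
  assert (0 <= (INR t + 2) ^ 3) by (apply pow_le; lra).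
  apply (Rmult_le_reg_r spread); [exact SP|]. nra.
Qed.

Lemma small_fraction (M delta : R) : 0 <= M -> 0 < delta ->
  exists t0, forall t, (t0 <= t)%nat -> M / (INR t + 1) <= delta.
Proof.
  intros HM Hd. destruct (INR_unbounded (M / delta)) as [t0 Ht0]. exists t0. intros t Ht.
  apply le_INR in Ht. assert (T0 := pos_INR t).
  apply (Rmult_le_reg_r (INR t + 1)); [lra|]. unfold Rdiv at 1. rewrite Rmult_assoc, Rinv_l by lra.
  assert (M / delta * delta < INR t0 * delta) by (apply Rmult_lt_compat_r; lra).
  replace (M / delta * delta) with M in H by (field; lra). nra.
Qed.

Lemma stage_of_sum i0 q : Q i0 <= q -> exists i, (i0 <= i)%nat /\ Q i <= q <= Q (S i).
Proof.
  intros Hq. destruct (base_large q) as [t1 H1].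
  set (i1 := (i0 + first t1)%nat).
  assert (Hi1 : q <= Q i1).
  { assert (h := base_le_sum i1). assert (N1 := N_ge1).
    assert (E : (t1 <= exc i1)%nat) by (apply exc_ge; unfold i1; lia).
    specialize (H1 _ E). generalize (base_pos (exc i1)); nra. }
  assert (Hle : (i0 <= i1)%nat) by (unfold i1; lia). clearbody i1. clear H1.
  induction Hle as [|i1 Hle IH].
  - exists i0. split; [lia|]. generalize (sum_incr i0 (S i0) ltac:(lia)); lra.
  - destruct (Rle_lt_dec q (Q i1)) as [h|h]; [now apply IH|].
    exists i1. split; [exact Hle|lra].
Qed.

(** Intermediate levels are convex combinations of those at both ends of the step, so linear
    inequalities need checking at the ends only. *)
Lemma levels_interpolate i s : lev i (lab i) <= s <= lev (S i) (lab i) ->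
  exists th, 0 <= th <= 1 /\ forall l, (l < N)%nat ->
    levels lab lev i s l = (1 - th) * lev i l + th * lev (S i) l.
Proof.
  intros Hs. set (a := lev i (lab i)) in *. set (b := lev (S i) (lab i)) in *.
  assert (Hth : exists th, 0 <= th <= 1 /\ s = (1 - th) * a + th * b).
  { destruct (Req_dec a b) as [E|E].
    - exists 0. split; [lra|]. lra.
    - exists ((s - a) / (b - a)). split; [|field; lra]. split.
      + apply Rdiv_le_0_compat; lra.
      + apply (Rmult_le_reg_r (b - a)); [lra|]. unfold Rdiv. rewrite Rmult_assoc, Rinv_l by lra. lra. }
  destruct Hth as (th & H1 & H2). exists th. split; [exact H1|]. intros l Hl.
  unfold levels. destruct (Nat.eqb_spec l (lab i)) as [->|E]; [exact H2|].
  rewrite (lev_other _ _ _ path_schedule) by assumption. ring.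
Qed.

Lemma levels_sum i s : sumN N (levels lab lev i s) = Q i + (s - lev i (lab i)).
Proof.
  rewrite (sumN_update N (lab i) (lev i)).
  - unfold levels. rewrite Nat.eqb_refl; ring.
  - apply (lab_lt _ _ _ path_schedule).
  - intros l _ Hl. unfold levels. destruct (Nat.eqb_spec l (lab i)); [contradiction|reflexivity].
Qed.

Definition controlled (u : vec) (delta : R) (L : nat -> R) (k : R) : Prop :=
  0 <= k /\ adapted n u L (exp k) /\ loss n u k <= delta * sumN N L.

(** The first property holds at every large [q]: it bounds [omega_j] from above and, by averaging
    the levels, the uniform exponent from below. The second bounds [omega_j] from below. The third,
    on the diagonal, bounds the uniform exponent from above and gives the rational independence. *)
Theorem path_point : exists u : vec, u 0%nat = 1 /\
  (forall delta, 0 < delta -> exists q0, forall q, q0 <= q -> exists L k,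
     controlled u delta L k /\ sumN N L = q /\
     forall j I, (j < n)%nat -> NoDup I -> length I = (j + 1)%nat ->
       (forall l, In l I -> (l <= n)%nat) -> sumR (map L I) <= (1 - psi j + delta) * q) /\
  (forall j delta q0, (j < n)%nat -> 0 < delta -> exists L k,
     controlled u delta L k /\ q0 <= sumN N L /\
     (1 - psi j - delta) * sumN N L <= sumR (map L (seq 0 (j + 1)))) /\
  (forall delta q0, 0 < delta -> exists L k,
     controlled u delta L k /\ q0 <= sumN N L /\
     exists c, forall l, (l <= n)%nat -> L l = c).
Proof.
  destruct step_count_le as [C HC].
  set (u := limit_point N lab lev path_schedule C HC).
  assert (u0 : u 0%nat = 1) by apply limit_point_0.
  destruct (loss_le u u0) as (M1 & M10 & HM1). destruct width_le as (M2 & M20 & HM2).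
  assert (N1 := N_ge1).
  assert (good : forall delta i s, 0 < delta -> M1 / (INR (exc i) + 1) <= delta ->
    lev i (lab i) <= s <= lev (S i) (lab i) ->
    controlled u delta (levels lab lev i s) (kappa (exc i))).
  { intros delta i s Hd Hi Hs. split; [apply kappa_nonneg|]. split.
    - apply stage_adapted; [|exact Hs]. intros l Hl. now apply label_recurs.
    - eapply Rle_trans; [apply HM1|]. rewrite levels_sum.
      assert (B := base_le_sum i). assert (Bp := base_pos (exc i)).
      replace (M1 * (base (exc i) / (INR (exc i) + 1))) with (M1 / (INR (exc i) + 1) * base (exc i))
        by (field; generalize (pos_INR (exc i)); lra).
      apply Rmult_le_compat; try lra.
      + apply Rdiv_le_0_compat; [exact M10|generalize (pos_INR (exc i)); lra].
      + nra. }
  exists u. split; [exact u0|]. split; [|split].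
  - intros delta Hd.
    destruct (small_fraction (M1 + M2) delta ltac:(lra) Hd) as [t0 Ht0].
    exists (Q (first t0)). intros q Hq.
    destruct (stage_of_sum (first t0) q Hq) as (i & Hi & Hqi).
    set (s := lev i (lab i) + (q - Q i)).
    assert (Hs : lev i (lab i) <= s <= lev (S i) (lab i)).
    { rewrite sum_S in Hqi. unfold s; lra. }
    assert (Ht : (t0 <= exc i)%nat) by now apply exc_ge.
    assert (split_frac : forall t, (t0 <= t)%nat ->
      M1 / (INR t + 1) <= delta /\ M2 / (INR t + 1) <= delta).
    { intros t h. specialize (Ht0 t h). assert (T0 := pos_INR t).
      assert (0 <= M1 / (INR t + 1)) by (apply Rdiv_le_0_compat; lra).
      assert (0 <= M2 / (INR t + 1)) by (apply Rdiv_le_0_compat; lra).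
      replace ((M1 + M2) / (INR t + 1)) with (M1 / (INR t + 1) + M2 / (INR t + 1)) in Ht0
        by (field; lra). lra. }
    exists (levels lab lev i s), (kappa (exc i)). split; [|split].
    + apply good; [exact Hd|apply split_frac; exact Ht|exact Hs].
    + rewrite levels_sum. unfold s; ring.
    + intros j I Hj HN HI HIn.
      assert (state : forall i', (t0 <= exc i')%nat ->
        sumR (map (lev i') I) <= (1 - psi j + delta) * Q i').
      { intros i' Hi'. assert (Hl := loc_lt i'). destruct (split_frac _ Hi') as [_ Hf].
        assert (B := base_le_sum i'). assert (Bp := base_pos (exc i')). assert (T0 := pos_INR (exc i')).
        assert (A := plevel_subset_sum (exc i') (snd (loc i')) j I Hl Hj HN HI HIn).
        assert (E : forall l, lev i' l = plevel (exc i') (snd (loc i')) l).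
        { intros l; unfold lev; destruct (loc i'); reflexivity. }
        rewrite (sumN_ext N _ (plevel (exc i') (snd (loc i')))) in * by (intros; apply E).
        rewrite (sumR_map_eq _ (plevel (exc i') (snd (loc i')))) by (intros; apply E).
        specialize (HM2 (exc i')).
        replace (M2 * (base (exc i') / (INR (exc i') + 1))) with (M2 / (INR (exc i') + 1) * base (exc i'))
          in HM2 by (field; lra).
        assert (M2 / (INR (exc i') + 1) * base (exc i') <= delta * sumN N (plevel (exc i') (snd (loc i')))).
        { apply Rmult_le_compat; try lra; [apply Rdiv_le_0_compat; lra|nra]. }
        lra. }
      destruct (levels_interpolate i s Hs) as (th & Hth & HL).
      assert (A0 := state i Ht).
      assert (A1 : sumR (map (lev (S i)) I) <= (1 - psi j + delta) * Q (S i)).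
      { apply state. destruct (exc_S i); lia. }
      assert (Eq : q = (1 - th) * Q i + th * Q (S i)).
      { rewrite <- !sumN_scal, <- sumN_plus. rewrite <- (sumN_ext _ _ _ HL), levels_sum. unfold s; ring. }
      rewrite (sumR_map_eq _ (fun l => (1 - th) * lev i l + th * lev (S i) l))
        by (intros l Hl; apply HL; apply HIn in Hl; lia).
      rewrite sumR_map_plus, !sumR_map_scal, Eq.
      assert ((1 - th) * sumR (map (lev i) I) <= (1 - th) * ((1 - psi j + delta) * Q i))
        by (apply Rmult_le_compat_l; lra).
      assert (th * sumR (map (lev (S i)) I) <= th * ((1 - psi j + delta) * Q (S i)))
        by (apply Rmult_le_compat_l; lra).
      lra.
  - intros j delta q0 Hj Hd.
    destruct (small_fraction M1 delta M10 Hd) as [t1 H1].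
    destruct (small_fraction (INR N) delta ltac:(lra) Hd) as [t2 H2].
    destruct (base_large q0) as [t3 H3].
    (* A large index congruent to [j] modulo [N], so that this excursion is the one made for
       [omega_j]. *)
    set (t := ((t1 + t2 + t3) * N + j)%nat).
    assert (Hm : (t mod N = j)%nat).
    { unfold t. rewrite Nat.add_comm, Nat.Div0.mod_add. apply Nat.mod_small; lia. }
    assert (Htt : (t1 + t2 + t3 <= t)%nat) by (unfold t; nia).
    destruct (plevel_extremal t) as [Hlen Hext]; [lia|]. rewrite Hm in Hext.
    set (i := (first t + lenU t)%nat).
    assert (Ei : loc i = (t, lenU t)) by now apply loc_first.
    assert (Ee : exc i = t) by now rewrite Ei.
    assert (EL : forall l, levels lab lev i (lev i (lab i)) l = plevel t (lenU t) l).
    { intros l. unfold levels. destruct (Nat.eqb_spec l (lab i)) as [->|_]; unfold lev; now rewrite Ei. }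
    assert (EQ : sumN N (levels lab lev i (lev i (lab i))) = sumN N (plevel t (lenU t)))
      by (apply sumN_ext; intros; apply EL).
    assert (QB := base_le_sum i). rewrite Ee in QB. assert (Bp := base_pos t).
    rewrite (sumN_ext N (lev i) (plevel t (lenU t))) in QB by (intros; unfold lev; now rewrite Ei).
    exists (levels lab lev i (lev i (lab i))), (kappa t). split; [|split].
    + rewrite <- Ee. apply good; [exact Hd|rewrite Ee; apply H1; lia|].
      generalize (lev_incr _ _ _ path_schedule i); lra.
    + rewrite EQ. specialize (H3 t ltac:(lia)). nra.
    + rewrite EQ. rewrite (sumR_map_eq _ (plevel t (lenU t))) by (intros; apply EL).
      replace (j + 1)%nat with (S j) by lia. eapply Rle_trans; [|exact Hext].
      specialize (H2 t ltac:(lia)). apply Rmult_le_compat_r; [nra|lra].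
  - intros delta q0 Hd.
    destruct (small_fraction M1 delta M10 Hd) as [t1 H1].
    destruct (base_large q0) as [t3 H3].
    set (t := (t1 + t3)%nat). set (i := (first t + 0)%nat).
    assert (Ei : loc i = (t, 0%nat)) by (apply loc_first; generalize (len_pos t); lia).
    assert (Ee : exc i = t) by now rewrite Ei.
    assert (EL : forall l, (l < N)%nat -> levels lab lev i (lev i (lab i)) l = base t).
    { intros l Hl. unfold levels. destruct (Nat.eqb_spec l (lab i)) as [->|_]; unfold lev; rewrite Ei;
        apply plevel_0; exact Hl || apply (lab_lt _ _ _ path_schedule). }
    exists (levels lab lev i (lev i (lab i))), (kappa t). split; [|split].
    + rewrite <- Ee. apply good; [exact Hd|rewrite Ee; apply H1; unfold t; lia|].
      generalize (lev_incr _ _ _ path_schedule i); lra.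
    + rewrite (sumN_ext _ _ _ EL), sumN_const. specialize (H3 t ltac:(unfold t; lia)).
      generalize (base_pos t); nra.
    + exists (base t). intros l Hl. apply EL; lia.
Qed.

End Path.

(** * Exponents prescribed by the transference inequalities *)

(** The limit inferior of [(L_1 + ... + L_(n-j)) / q] that corresponds to the exponent [ws j]. *)
Definition psi_of (n : nat) (ws : nat -> ereal) (j : nat) : R :=
  if (j <? n)%nat then match ws j with EFin r => / (1 + r) | EInf => 0 end else 0.

Section Psi.
Context (n : nat) (ws : nat -> ereal) (Hn : (1 <= n)%nat).
Context (H0 : forall j, (j < n)%nat -> ele (EFin 0) (ws j)).
Context (H1 : ele (EFin (1 / INR n)) (ws 0%nat)).
Context (H2 : forall j, (1 <= j)%nat -> (j <= n - 1)%nat ->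
     ele (lower_bd j (ws j)) (ws (j - 1)%nat) /\
     ele (ws (j - 1)%nat) (upper_bd n j (ws j))).

Local Notation psi := (psi_of n ws).

Lemma psi_of_last : psi n = 0.
Proof. unfold psi_of. now rewrite Nat.ltb_irrefl. Qed.

Lemma psi_of_bounds j : (j <= n)%nat -> 0 <= psi j <= 1.
Proof.
  intros Hj. unfold psi_of. destruct (Nat.ltb_spec j n) as [h|h]; [|lra].
  specialize (H0 j h). destruct (ws j) as [r|]; [|lra]. simpl in H0.
  assert (0 < / (1 + r)) by (apply Rinv_0_lt_compat; lra).
  split; [lra|]. rewrite <- Rinv_1. apply Rinv_le_contravar; lra.
Qed.

Lemma psi_of_first : psi 0 * INR (S n) <= INR n.
Proof.
  unfold psi_of. destruct (Nat.ltb_spec 0 n); [|lia].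
  assert (n0 : 0 < INR n) by (apply lt_0_INR; lia). rewrite S_INR.
  destruct (ws 0%nat) as [r|]; [|lra]. simpl in H1.
  apply (Rmult_le_compat_r (INR n)) in H1; [|lra].
  unfold Rdiv in H1. rewrite Rmult_assoc, Rinv_l in H1 by lra.
  assert (r0 : 0 < r) by nra.
  apply (Rmult_le_reg_l (1 + r)); [lra|]. rewrite <- Rmult_assoc, Rinv_r by lra. lra.
Qed.

(** Cleared of its denominator and increased by [n - j] on both sides, the right transference
    inequality reads [(1 + omega_j) * (n - j) <= (1 + omega_(j+1)) * (n - j - 1)]. *)
Lemma psi_of_low_step j : (S j <= n)%nat -> psi (S j) * INR (n - j) <= psi j * INR (n - S j).
Proof.
  intros Hj. assert (B := psi_of_bounds j ltac:(lia)).
  destruct (Nat.eq_dec (S j) n) as [E|E].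
  - rewrite E, psi_of_last, Nat.sub_diag. simpl INR. lra.
  - destruct (H2 (S j) ltac:(lia) ltac:(lia)) as [_ U]. replace (S j - 1)%nat with j in U by lia.
    assert (A0 := H0 j ltac:(lia)). assert (A1 := H0 (S j) ltac:(lia)).
    assert (P := pos_INR (n - S j)).
    unfold psi_of in *. destruct (Nat.ltb_spec j n); [|lia]. destruct (Nat.ltb_spec (S j) n); [|lia].
    destruct (ws (S j)) as [r|]; [|rewrite Rmult_0_l; apply Rmult_le_pos; lra].
    destruct (ws j) as [r'|]; [|contradiction].
    unfold upper_bd, ele in U. simpl in A0, A1.
    replace (n - S j + 1)%nat with (n - j)%nat in U by lia.
    assert (p : 0 < INR (n - j)) by (apply lt_0_INR; lia).
    apply (Rmult_le_compat_r (INR (n - j))) in U; [|lra].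
    unfold Rdiv in U. rewrite Rmult_assoc, Rinv_l, Rmult_1_r in U by lra.
    assert (E2 : INR (n - j) = INR (n - S j) + 1) by (rewrite <- S_INR; f_equal; lia).
    apply (Rmult_le_reg_l ((1 + r) * (1 + r'))); [nra|].
    replace ((1 + r) * (1 + r') * (/ (1 + r) * INR (n - j))) with ((1 + r') * INR (n - j)) by (field; lra).
    replace ((1 + r) * (1 + r') * (/ (1 + r') * INR (n - S j))) with ((1 + r) * INR (n - S j)) by (field; lra).
    lra.
Qed.

Lemma psi_of_low j k : (k <= j)%nat -> (j <= n)%nat -> psi j * INR (n - k) <= psi k * INR (n - j).
Proof.
  intros Hkj; induction Hkj as [|j Hkj IH]; intros Hj; [lra|].
  assert (S1 := psi_of_low_step j Hj). specialize (IH ltac:(lia)).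
  assert (p : 0 < INR (n - j)) by (apply lt_0_INR; lia).
  assert (p1 := pos_INR (n - S j)). assert (p2 := pos_INR (n - k)).
  apply (Rmult_le_reg_r (INR (n - j))); [exact p|].
  apply Rle_trans with (psi j * INR (n - S j) * INR (n - k)).
  - replace (psi (S j) * INR (n - k) * INR (n - j)) with (psi (S j) * INR (n - j) * INR (n - k)) by ring.
    apply Rmult_le_compat_r; lra.
  - replace (psi j * INR (n - S j) * INR (n - k)) with (psi j * INR (n - k) * INR (n - S j)) by ring.
    replace (psi k * INR (n - S j) * INR (n - j)) with (psi k * INR (n - j) * INR (n - S j)) by ring.
    apply Rmult_le_compat_r; lra.
Qed.

(** The case [j = 0] is the hypothesis [omega_0 >= 1/n], and [psi_of_low] carries it to every
    [j]. *)
Lemma psi_of_average j : (j <= n)%nat -> psi j * INR (S n) <= INR (n - j).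
Proof.
  intros Hj. assert (L := psi_of_low j 0 ltac:(lia) Hj). assert (F := psi_of_first).
  rewrite Nat.sub_0_r in L. assert (n0 : 0 < INR n) by (apply lt_0_INR; lia).
  assert (p := pos_INR (n - j)). assert (q := pos_INR (S n)).
  apply (Rmult_le_reg_r (INR n)); [exact n0|].
  apply Rle_trans with (psi 0 * INR (n - j) * INR (S n)).
  - replace (psi j * INR (S n) * INR n) with (psi j * INR n * INR (S n)) by ring.
    apply Rmult_le_compat_r; lra.
  - replace (psi 0 * INR (n - j) * INR (S n)) with (psi 0 * INR (S n) * INR (n - j)) by ring.
    rewrite (Rmult_comm (INR (n - j))). apply Rmult_le_compat_r; lra.
Qed.

Lemma psi_of_range j : (j <= n)%nat -> 0 <= psi j < 1.
Proof.
  intros Hj. split; [now apply psi_of_bounds|].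
  assert (A := psi_of_average j Hj). assert (B := psi_of_bounds j Hj).
  assert (INR (n - j) < INR (S n)) by (apply lt_INR; lia). assert (p := pos_INR (n - j)). nra.
Qed.

(** For finite exponents and [r = omega_(j+1)], [r' = omega_j], the left transference inequality
    reads [r * (j + 1) <= r' * (r + j + 2)], which is the claim multiplied by [(1 + r) * (1 + r')].
    At [S j = n] there is no such hypothesis, and [psi_of_average] takes its place. *)
Lemma psi_of_high_step j : (S j <= n)%nat -> (1 - psi (S j)) * INR (S j) <= (1 - psi j) * INR (S (S j)).
Proof.
  intros Hj. assert (B := psi_of_bounds (S j) Hj). assert (J0 := pos_INR j).
  rewrite !S_INR.
  destruct (Nat.eq_dec (S j) n) as [E|E].
  - assert (A := psi_of_average j ltac:(lia)).
    replace (n - j)%nat with 1%nat in A by lia. replace (S n) with (S (S j)) in A by lia.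
    rewrite !S_INR in A. simpl INR in A. rewrite E, psi_of_last. lra.
  - destruct (H2 (S j) ltac:(lia) ltac:(lia)) as [U _]. replace (S j - 1)%nat with j in U by lia.
    assert (A0 := H0 j ltac:(lia)). assert (A1 := H0 (S j) ltac:(lia)).
    unfold psi_of in *. destruct (Nat.ltb_spec j n); [|lia]. destruct (Nat.ltb_spec (S j) n); [|lia].
    destruct (ws j) as [r'|].
    2:{ revert B. generalize (match ws (S j) with EFin r => / (1 + r) | EInf => 0 end).
        intros x B. assert (0 <= x * (INR j + 1)) by (apply Rmult_le_pos; lra). lra. }
    simpl in A0. assert (p' : 0 < / (1 + r')) by (apply Rinv_0_lt_compat; lra).
    apply (Rmult_le_reg_r (1 + r')); [lra|].
    replace ((1 - / (1 + r')) * (INR j + 1 + 1) * (1 + r')) with (r' * (INR j + 1 + 1)) by (field; lra).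
    destruct (ws (S j)) as [r|].
    + unfold lower_bd, ele in U. simpl in A1. rewrite S_INR in U.
      apply (Rmult_le_compat_r (r + (INR j + 1) + 1)) in U; [|lra].
      unfold Rdiv in U. rewrite Rmult_assoc, Rinv_l, Rmult_1_r in U by lra.
      apply (Rmult_le_reg_r (1 + r)); [lra|].
      replace ((1 - / (1 + r)) * (INR j + 1) * (1 + r') * (1 + r)) with (r * (INR j + 1) * (1 + r'))
        by (field; lra).
      nra.
    + unfold lower_bd, ele in U. rewrite S_INR in U. lra.
Qed.

Lemma psi_of_high j k : (j <= k)%nat -> (k <= n)%nat ->
  (1 - psi k) * INR (S j) <= (1 - psi j) * INR (S k).
Proof.
  intros Hjk; induction Hjk as [|k Hjk IH]; intros Hk; [lra|].
  assert (S1 := psi_of_high_step k Hk). specialize (IH ltac:(lia)).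
  assert (p : 0 < INR (S k)) by (apply lt_0_INR; lia).
  assert (p1 := pos_INR (S j)). assert (p2 := pos_INR (S (S k))).
  apply (Rmult_le_reg_r (INR (S k))); [exact p|].
  apply Rle_trans with ((1 - psi k) * INR (S (S k)) * INR (S j)).
  - replace ((1 - psi (S k)) * INR (S j) * INR (S k)) with ((1 - psi (S k)) * INR (S k) * INR (S j)) by ring.
    apply Rmult_le_compat_r; lra.
  - replace ((1 - psi k) * INR (S (S k)) * INR (S j)) with ((1 - psi k) * INR (S j) * INR (S (S k))) by ring.
    replace ((1 - psi j) * INR (S (S k)) * INR (S k)) with ((1 - psi j) * INR (S k) * INR (S (S k))) by ring.
    apply Rmult_le_compat_r; lra.
Qed.

End Psi.

(** * From the trajectory to the exponents *)

(** Removing a smallest element never lowers the average. At any time this yields [j + 1] levels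
    with at least the share [(j + 1) / (n + 1)] of [q], which is what the uniform exponent asks
    for. *)
Lemma sublist_above_average (L : nat -> R) (m : nat) (I : list nat) : NoDup I -> (1 <= m <= length I)%nat ->
  exists I', NoDup I' /\ length I' = m /\ incl I' I /\
    INR m * sumR (map L I) <= INR (length I) * sumR (map L I').
Proof.
  intros HN Hm. remember (length I - m)%nat as d eqn:Ed.
  revert I HN Hm Ed; induction d as [|d IH]; intros I HN Hm Ed.
  - assert (E : length I = m) by lia. exists I. rewrite E.
    split; [exact HN|split; [reflexivity|split; [apply incl_refl|lra]]].
  - assert (Hmin : exists a, In a I /\ forall b, In b I -> L a <= L b).
    { assert (HI : I <> nil) by (intros ->; simpl in Hm; lia). clear -HI.
      induction I as [|a I IH]; [contradiction|].
      destruct I as [|b I].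
      - exists a; split; [now left|]. intros c [->|[]]; lra.
      - destruct IH as (c & Hc & Hmin); [discriminate|].
        destruct (Rle_lt_dec (L a) (L c)) as [h|h].
        + exists a; split; [now left|]. intros e [->|He]; [lra|]. specialize (Hmin e He); lra.
        + exists c; split; [now right|]. intros e [->|He]; [lra|now apply Hmin]. }
    destruct Hmin as (a & Ha & Hmin). apply in_split in Ha as (I1 & I2 & ->).
    assert (HN' : NoDup (I1 ++ I2)) by now apply NoDup_remove_1 in HN.
    rewrite length_app in *. simpl in Hm, Ed.
    destruct (IH (I1 ++ I2) HN') as (I' & A1 & A2 & A3 & A4); [rewrite length_app; lia..|].
    exists I'. repeat split; auto.
    + intros x Hx. apply A3, in_app_or in Hx. apply in_or_app. simpl. tauto.
    + set (s := sumR (map L (I1 ++ I2))) in *.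
      assert (Es : sumR (map L (I1 ++ a :: I2)) = L a + s).
      { unfold s. rewrite !map_app. clear. generalize (map L I1) as l. intros l.
        induction l as [|x l IHl]; simpl in *; [reflexivity|rewrite IHl; ring]. }
      rewrite Es. rewrite length_app in A4.
      assert (Hs : INR (length I1 + length I2) * L a <= s).
      { rewrite <- length_app, <- sumR_map_const. apply sumR_map_le. intros b Hb. apply Hmin.
        apply in_app_or in Hb. apply in_or_app; simpl; tauto. }
      replace (length I1 + length (a :: I2))%nat with (S (length I1 + length I2)) by (simpl; lia).
      rewrite S_INR. set (p := INR (length I1 + length I2)) in *.
      assert (Hmp : 1 <= INR m <= p) by (split; [apply (le_INR 1)|apply le_INR]; lia).
      assert (X : sumR (map L I') * p >= INR m * s) by lra.
      set (z := sumR (map L I')) in *.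
      apply (Rmult_le_reg_r p); [lra|].
      assert (INR m * (p * L a) <= INR m * s) by (apply Rmult_le_compat_l; lra).
      replace ((p + 1) * z * p) with ((p + 1) * (z * p)) by ring.
      assert ((p + 1) * (INR m * s) <= (p + 1) * (z * p)) by (apply Rmult_le_compat_l; lra).
      lra.
Qed.

Lemma exp_unbounded (x y : R) : 0 < y -> exists q0, forall q, q0 <= q -> x <= exp (q * y) /\ 0 <= q * y.
Proof.
  intros Hy. exists (Rabs x / y). intros q Hq.
  assert (Rabs x <= q * y).
  { apply (Rmult_le_compat_r y) in Hq; [|lra].
    unfold Rdiv in Hq. rewrite Rmult_assoc, Rinv_l in Hq by lra. lra. }
  assert (0 <= Rabs x) by apply Rabs_pos.
  generalize (Rle_abs x) (exp_ineq1_le (q * y)); lra.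
Qed.

Lemma div_succ_lt (a b : R) : -1 < a -> a < b -> a / (1 + a) < b / (1 + b).
Proof.
  intros Ha Hab. apply (Rmult_lt_reg_r ((1 + a) * (1 + b))); [nra|].
  replace (a / (1 + a) * ((1 + a) * (1 + b))) with (a * (1 + b)) by (field; lra).
  replace (b / (1 + b) * ((1 + a) * (1 + b))) with (b * (1 + a)) by (field; lra). nra.
Qed.

Theorem mainTheorem1 (n : nat) (ws : nat -> ereal) :
  (1 <= n)%nat ->
  (forall j, (j < n)%nat -> ele (EFin 0) (ws j)) ->
  ele (EFin (1 / INR n)) (ws 0%nat) ->
  (forall j, (1 <= j)%nat -> (j <= n - 1)%nat ->
     ele (lower_bd j (ws j)) (ws (j - 1)%nat) /\
     ele (ws (j - 1)%nat) (upper_bd n j (ws j))) ->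
  exists u : vec, Q_indep_coords n u /\
    forall j, (j <= n - 1)%nat ->
      omega n u j (ws j) /\
      omega_hat n u j (EFin (INR (j + 1) / INR (n - j))).
Proof.
  intros Hn H0 H1 H2.
  assert (Hrange := psi_of_range n ws Hn H0 H1 H2).
  destruct (path_point n Hn (psi_of n ws) Hrange (psi_of_last n ws)
    (psi_of_low n ws Hn H0 H2) (psi_of_high n ws Hn H0 H1 H2)) as (u & u0 & P1 & P2 & P3).
  set (psi := psi_of n ws) in *.
  assert (N0 : 0 < INR (S n)) by (apply lt_0_INR; lia).
  (* A finite [omega_j] satisfies [omega_j / (1 + omega_j) = 1 - psi j], and [w / (1 + w)] increases
     with [w]. This claim and the next locate the supremum; their gap is split between the deviation
     of the levels and the loss. *)
  assert (in_omega : forall j w, (j < n)%nat -> -1 < w -> w / (1 + w) < 1 - psi j ->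
    omega_set n u j w).
  { intros j w Hj Hw Hlt Q0. set (delta := (1 - psi j - w / (1 + w)) / 2).
    assert (Hd : 0 < delta) by (unfold delta; lra).
    destruct (exp_unbounded Q0 (/ (1 + w))) as [q0 Hq0]; [apply Rinv_0_lt_compat; lra|].
    destruct (P2 j delta (Rmax q0 0) Hj Hd) as (L & k & (Hk & Had & Hloss) & Hq & Hsum).
    assert (M1 := Rmax_l q0 0). assert (M2 := Rmax_r q0 0).
    destruct (Hq0 (sumN (S n) L)) as [G1 G2]; [lra|].
    exists (exp (sumN (S n) L / (1 + w))). split; [exact G1|]. split.
    - assert (E := exp_le 0 _ G2). rewrite exp_0 in E. exact E.
    - apply approx_of_adapted with (L := L) (kappa := k) (I := seq 0 (j + 1)); auto; try lra; try lia.
      + apply seq_NoDup.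
      + apply length_seq.
      + intros l Hl; apply in_seq in Hl; lia.
      + replace (w * sumN (S n) L / (1 + w)) with (w / (1 + w) * sumN (S n) L) by (field; lra).
        assert (w / (1 + w) = 1 - psi j - delta - delta) by (unfold delta; field; lra).
        rewrite H. lra. }
  assert (not_in_omega : forall j w, (j < n)%nat -> -1 < w -> 1 - psi j < w / (1 + w) ->
    ~ omega_set n u j w).
  { intros j w Hj Hw Hlt Hset. set (delta := (w / (1 + w) - (1 - psi j)) / 3).
    assert (Hd : 0 < delta) by (unfold delta; lra).
    destruct (P1 delta Hd) as [q0 Hq0].
    destruct (Hset (exp (Rmax q0 1 / (1 + w)))) as (Qb & HQ1 & HQ2 & Happ).
    (* The inverse of [Q = exp (q / (1 + w))]: a given [Qb] prescribes the time [q]. *)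
    set (q := (1 + w) * ln Qb).
    assert (EQ : Qb = exp (q / (1 + w))).
    { unfold q. replace ((1 + w) * ln Qb / (1 + w)) with (ln Qb) by (field; lra).
      rewrite exp_ln; lra. }
    assert (Hq : Rmax q0 1 <= q).
    { unfold q. rewrite <- (ln_exp (Rmax q0 1)).
      replace (ln (exp (Rmax q0 1))) with ((1 + w) * ln (exp (Rmax q0 1 / (1 + w))))
        by (rewrite !ln_exp; field; lra).
      apply Rmult_le_compat_l; [lra|]. apply ln_le; [apply exp_pos|exact HQ1]. }
    assert (M1 := Rmax_l q0 1). assert (M2 := Rmax_r q0 1).
    destruct (Hq0 q ltac:(lra)) as (L & k & (Hk & Had & Hloss) & Esum & HI).
    rewrite EQ, <- Esum in Happ. revert Happ.
    apply not_approx_of_adapted with (kappa := k) (T := (1 - psi j + delta) * q); auto; try lra; try lia.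
    rewrite Esum in *.
    replace (w * q / (1 + w)) with (w / (1 + w) * q) by (field; lra).
    assert (w / (1 + w) = 1 - psi j + delta + delta + delta) by (unfold delta; field; lra).
    rewrite H. nra. }
  exists u. split.
  - apply adapted_Q_indep; [exact u0|]. intros eps Heps.
    destruct (exp_unbounded (/ eps) (/ (2 * INR (S n)))) as [q0 Hq0].
    { apply Rinv_0_lt_compat; lra. }
    (* On the diagonal [q = N c], and a loss of at most [q / 2] gives [k <= c / 2]. Hence
       [exp k * exp (- c)] is at most [exp (- c / 2)]. *)
    destruct (P3 (1 / 2) q0 ltac:(lra)) as (L & k & (Hk & Had & Hloss) & Hq & c & Hc).
    exists L, (exp k). split; [exact Had|]. intros l Hl. rewrite Hc by exact Hl.
    rewrite (sumN_ext (S n) L (fun _ => c)), sumN_const in * by (intros; apply Hc; lia).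
    destruct (Hq0 _ Hq) as [G _].
    replace (INR (S n) * c * / (2 * INR (S n))) with (c / 2) in G by (field; lra).
    destruct (loss_terms n u u0) as [T1 T2].
    assert (Hkc : k <= c / 2).
    { apply (Rmult_le_reg_l (INR (S n))); [exact N0|].
      unfold loss in Hloss.
      assert (0 <= ln (INR (S n) ^ S n * (vnorm n u + 1))) by (rewrite <- ln_1; apply ln_le; lra).
      assert (0 <= ln (2 ^ S n * (INR (fact (S (S n))) * (1 + sumN (S n) (fun t => Rabs (u t))))))
        by (rewrite <- ln_1; apply ln_le; lra).
      lra. }
    rewrite <- exp_plus. apply Rle_trans with (exp (- (c / 2))); [apply exp_le; lra|].
    rewrite exp_Ropp, <- (Rinv_inv eps). apply Rinv_le_contravar; [|exact G].
    now apply Rinv_0_lt_compat.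
  - intros j Hj'. assert (Hj : (j < n)%nat) by lia. split.
    + assert (Hp : psi j = match ws j with EFin r => / (1 + r) | EInf => 0 end).
      { unfold psi, psi_of. destruct (Nat.ltb_spec j n); [reflexivity|lia]. }
      specialize (H0 j Hj). unfold omega, is_sup. destruct (ws j) as [r|].
      * simpl in H0.
        assert (Er : 1 - psi j = r / (1 + r)) by (rewrite Hp; field; lra).
        split.
        -- intros w Hw. destruct (Rle_lt_dec w r) as [h|h]; [exact h|]. exfalso.
           apply (not_in_omega j w); auto; [lra|]. rewrite Er. apply div_succ_lt; lra.
        -- intros b Hb. destruct (Rle_lt_dec r b) as [h|h]; [exact h|]. exfalso.
           (* The truncation keeps [w] above [-1], as [b] may be very negative. *)
           set (w := (Rmax b (-1/2) + r) / 2).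
           assert (Rmax b (-1/2) < r) by (apply Rmax_lub_lt; lra).
           assert (M1 := Rmax_l b (-1/2)). assert (M2 := Rmax_r b (-1/2)).
           assert (w <= b); [|unfold w in *; lra].
           apply Hb, in_omega; auto; [unfold w; lra|]. rewrite Er. apply div_succ_lt; unfold w; lra.
      * intros M. exists (Rmax M 0 + 1). assert (M1 := Rmax_l M 0). assert (M2 := Rmax_r M 0).
        split; [|lra]. apply in_omega; auto; [lra|]. rewrite Hp.
        apply (Rmult_lt_reg_r (1 + (Rmax M 0 + 1))); [lra|].
        unfold Rdiv. rewrite Rmult_assoc, Rinv_l by lra. lra.
    + assert (d0 : 0 < INR (n - j)) by (apply lt_0_INR; lia).
      assert (j0 : 0 < INR (j + 1)) by (apply lt_0_INR; lia).
      assert (EN : INR (S n) = INR (n - j) + INR (j + 1)) by (rewrite <- plus_INR; f_equal; lia).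
      set (h := INR (j + 1) / INR (n - j)).
      assert (h0 : 0 < h) by now apply Rdiv_lt_0_compat.
      assert (Eh : INR (j + 1) = h * INR (n - j)) by (unfold h; field; lra).
      unfold omega_hat, is_sup. split.
      * intros w (Q0 & HQ0). destruct (Rle_lt_dec w h) as [hw|hw]; [exact hw|]. exfalso.
        (* On the diagonal any [j + 1] levels have the share [(j + 1) / (n + 1) = h / (1 + h)] of
           [q], which is too small for an exponent [w > h]. *)
        set (delta := (w / (1 + w) - INR (j + 1) / INR (S n)) / 2).
        assert (Hd : 0 < delta).
        { unfold delta. rewrite EN, Eh.
          enough (h * INR (n - j) / (INR (n - j) + h * INR (n - j)) < w / (1 + w)) by lra.
          replace (h * INR (n - j) / (INR (n - j) + h * INR (n - j))) with (h / (1 + h)) by (field; nra).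
          apply div_succ_lt; lra. }
        destruct (exp_unbounded Q0 (/ (1 + w))) as [q0 Hq0]; [apply Rinv_0_lt_compat; lra|].
        destruct (P3 delta (Rmax q0 1) Hd) as (L & k & (Hk & Had & Hloss) & Hq & c & Hc).
        assert (M1 := Rmax_l q0 1). assert (M2 := Rmax_r q0 1).
        destruct (Hq0 (sumN (S n) L)) as [G1 G2]; [lra|].
        assert (Es : sumN (S n) L = INR (S n) * c).
        { rewrite (sumN_ext (S n) L (fun _ => c)), sumN_const by (intros; apply Hc; lia). reflexivity. }
        assert (Happ : approx n u j w (exp (sumN (S n) L / (1 + w)))).
        { apply HQ0; [exact G1|]. assert (E := exp_le 0 _ G2). rewrite exp_0 in E. exact E. }
        revert Happ.
        apply not_approx_of_adapted with (kappa := k) (T := INR (j + 1) * c); auto; try lra; try lia.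
        -- intros I _ HI HIn. rewrite <- HI, <- sumR_map_const. right. apply sumR_map_eq.
           intros l Hl. apply Hc, HIn, Hl.
        -- replace (w * sumN (S n) L / (1 + w)) with (w / (1 + w) * sumN (S n) L) by (field; lra).
           replace (INR (j + 1) * c) with (INR (j + 1) / INR (S n) * sumN (S n) L)
             by (rewrite Es; field; lra).
           assert (w / (1 + w) = INR (j + 1) / INR (S n) + delta + delta) by (unfold delta; field; lra).
           rewrite H. nra.
      * intros b Hb. destruct (Rle_lt_dec h b) as [hb|hb]; [exact hb|]. exfalso.
        set (w := (Rmax b 0 + h) / 2).
        assert (Rmax b 0 < h) by (apply Rmax_lub_lt; lra).
        assert (M1 := Rmax_l b 0). assert (M2 := Rmax_r b 0).
        assert (Hw : 0 < w < h) by (unfold w; lra).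
        assert (w <= b); [|unfold w in *; lra]. apply Hb. clear Hb.
        set (delta := INR (j + 1) / INR (S n) - w / (1 + w)).
        assert (Hd : 0 < delta).
        { unfold delta. rewrite EN, Eh.
          enough (w / (1 + w) < h * INR (n - j) / (INR (n - j) + h * INR (n - j))) by lra.
          replace (h * INR (n - j) / (INR (n - j) + h * INR (n - j))) with (h / (1 + h)) by (field; nra).
          apply div_succ_lt; lra. }
        destruct (P1 delta Hd) as [q0 Hq0].
        exists (exp (q0 / (1 + w))). intros Qb HQ1 HQ2.
        set (q := (1 + w) * ln Qb).
        assert (EQ : Qb = exp (q / (1 + w))).
        { unfold q. replace ((1 + w) * ln Qb / (1 + w)) with (ln Qb) by (field; lra).
          rewrite exp_ln; lra. }
        assert (Hlq : 0 <= q).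
        { unfold q. apply Rmult_le_pos; [lra|]. rewrite <- ln_1. apply ln_le; lra. }
        assert (Hq : q0 <= q).
        { unfold q. replace q0 with ((1 + w) * ln (exp (q0 / (1 + w)))) by (rewrite !ln_exp; field; lra).
          apply Rmult_le_compat_l; [lra|]. apply ln_le; [apply exp_pos|exact HQ1]. }
        destruct (Hq0 q Hq) as (L & k & (Hk & Had & Hloss) & Esum & _).
        (* Only the average of the levels matters here, so this works at every large [q]. *)
        destruct (sublist_above_average L (j + 1) (seq 0 (S n))) as (I & I1 & I2 & I3 & I4).
        { apply seq_NoDup. } { rewrite length_seq; lia. }
        rewrite length_seq in I4. change (sumR (map L (seq 0 (S n)))) with (sumN (S n) L) in I4.
        rewrite EQ, <- Esum.
        apply approx_of_adapted with (kappa := k) (I := I); auto; try lra; try lia.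
        -- intros l Hl. apply I3, in_seq in Hl. lia.
        -- rewrite Esum in *.
           apply (Rmult_le_reg_l (INR (S n))); [exact N0|]. eapply Rle_trans; [|exact I4].
           replace (w * q / (1 + w)) with (w / (1 + w) * q) by (field; lra).
           assert (E : INR (j + 1) = INR (S n) * (w / (1 + w) + delta)) by (unfold delta; field; lra).
           rewrite E, Rmult_assoc. apply Rmult_le_compat_l; [lra|]. lra.
Qed.
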